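(* Let $q\ge 2$ be an integer and let $f:\mathbb{N}\to\mathbb{U}$ satisfy the following two properties. (Weak small propagation property.) Uniformly for $(\lambda,\kappa,\rho)\in\mathbb{N}^3$ with $\rho<\lambda$, the number of integers $l$ with $0\le l<q^{\lambda}$ for which there exist $(k_1,k_2)\in\{0,\dots,q^{\kappa}-1\}^2$ with $$f(lq^{\kappa}+k_1+k_2)\overline{f(lq^{\kappa}+k_1)}\neq f^{(\kappa+\rho)}(lq^{\kappa}+k_1+k_2)\overline{f^{(\kappa+\rho)}(lq^{\kappa}+k_1)}$$ is $O\!\left(q^{\lambda-\rho+\log\rho}\right)$, the implied constant depending only on $q$ and $f$. (Fourier property.) There exist a nondecreasing function $\gamma$ with $\lim_{\lambda\to+\infty}\gamma(\lambda)=+\infty$ and an absolute constant $c>0$ such that for all positive integers $\lambda,\kappa$ with $\kappa\le c\lambda$ and every real $t$, $$\left|\frac{1}{q^{\lambda}}\sum_{0\le n<q^{\lambda}}f(q^{\kappa}n)e(-nt)\right|\le q^{-\gamma(\lambda)}.$$ Then, uniformly in $\vartheta\in\mathbb{R}$, $$\left|\sum_{n\le x}\Lambda(n)f(n)e(\vartheta n)\right|\ll c_1(q)(\log x)^{c_2(q)}\,x\,q^{-\gamma(2\lfloor(\log x)/(80\log q)\rfloor)/20+\log\left(\gamma(2\lfloor(\log x)/(80\log q)\rfloor)/20\right)},$$ where $$c_1(q)=\max(\tau(q)\log q,\log^{10}q)^{1/4}(\log q)^{2-2c_2(q)},\qquad c_2(q)=4+\frac{\log q}{4}+\frac14\ma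x(\omega(q),2).$$
   Context: $\mathbb{U}$ denotes the unit circle in $\mathbb{C}$, $e(x)=\exp(2i\pi x)$, $\Lambda$ is the von Mangoldt function, $\tau(q)$ is the number of divisors of $q$ and $\omega(q)$ the number of distinct prime factors of $q$. For an integer $\lambda\ge 0$, the truncation of $f$ is $f^{(\lambda)}(n)=f(n \bmod q^{\lambda})$, where $n\bmod q^{\lambda}$ is the remainder of the Euclidean division of $n$ by $q^{\lambda}$. *)

(* Defs.v *)
From HB Require Import structures.
From mathcomp Require Import all_boot all_order all_algebra.
From mathcomp Require Import all_classical all_reals all_analysis.
From mathcomp Require Export complex.

Set Implicit Arguments.
Unset Strict Implicit.
Unset Printing Implicit Defensive.

Import Order.TTheory GRing.Theory Num.Theory.
Import numFieldNormedType.Exports.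

Local Open Scope classical_set_scope.
Local Open Scope ring_scope.
Local Open Scope complex_scope.

Section Defs.
Variable R : realType.

Implicit Types (f : nat -> R[i]) (gamma : nat -> R) (q : nat).

Definition e (x : R) : R[i] := cos (2 * pi * x) +i* sin (2 * pi * x).

(* n is a power p ^ k (k >= 1) of a prime p iff [primes n = [:: p]]. *)
Definition von_mangoldt (n : nat) : R :=
  if primes n is [:: p] then ln p%:R else 0.

Definition tau (n : nat) : nat := size (divisors n).

Definition omega (n : nat) : nat := size (primes n).

Definition unit_circle_valued f : Prop := forall n, `|f n| = 1.

Definition trunc q f (lambda : nat) : nat -> R[i] :=
  fun n => f (n %% q ^ lambda)%N.

Definition propagation_exceptions q f (lambda kappa rho : nat) :
    {set 'I_(q ^ lambda)} :=
  [set l : 'I_(q ^ lambda) |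
    [exists k1 : 'I_(q ^ kappa), exists k2 : 'I_(q ^ kappa),
      f (l * q ^ kappa + k1 + k2)%N * (f (l * q ^ kappa + k1)%N)^*
      != trunc q f (kappa + rho) (l * q ^ kappa + k1 + k2)%N
         * (trunc q f (kappa + rho) (l * q ^ kappa + k1)%N)^*]]%SET.

(* For rho = 0 the library value ln 0 = 0 turns the bound into the trivial
   O(q ^ lambda), so that nothing is imposed on f in that case. *)
Definition weak_small_propagation q f : Prop :=
  exists K : R, forall lambda kappa rho : nat, (rho < lambda)%N ->
    #|propagation_exceptions q f lambda kappa rho|%:R
      <= K * q%:R `^ (lambda%:R - rho%:R + ln rho%:R).

Definition fourier_property q f gamma (c : R) : Prop :=
  forall lambda kappa : nat, (0 < lambda)%N -> (0 < kappa)%N ->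
    kappa%:R <= c * lambda%:R ->
    forall t : R,
      `| ((q ^ lambda)%:R)^-1 *
         \sum_(0 <= n < q ^ lambda) f (q ^ kappa * n)%N * e (- (n%:R * t)) |
      <= (q%:R `^ (- gamma lambda))%:C.

Definition c2 q : R := 4 + ln q%:R / 4 + (maxn (omega q) 2)%:R / 4.

Definition c1 q : R :=
  Num.max ((tau q)%:R * ln q%:R) (ln q%:R ^+ 10) `^ (1 / 4)
  * ln q%:R `^ (2 - 2 * c2 q).

(* [Num.truncn] is the integer part: its argument is nonnegative for x >= 1. *)
Definition gamma_index q (x : R) : nat :=
  (2 * Num.truncn (ln x / (80 * ln q%:R)))%N.

(* When gamma (gamma_index q x) <= 0, which for gamma tending to infinity only
   happens on a bounded range of x, the library sets the logarithm to 0. *)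
Definition prime_sum_bound q gamma (x : R) : R :=
  let g := gamma (gamma_index q x) / 20 in
  c1 q * ln x `^ c2 q * x * q%:R `^ (- g + ln g).

Definition mangoldt_sum f (theta x : R) : R[i] :=
  \sum_(0 <= n < (Num.truncn x).+1)
    (von_mangoldt n)%:C * f n * e (theta * n%:R).

End Defs.

(* Main.v *)
(** Vaughan's identity splits the sum into bilinear forms over boxes
    [q^(mu-1) <= m < q^mu], [n < q^nu].  Van der Corput differencing followed by
    the propagation property replaces [f] by its truncation [f_t] of period
    [Q = q^t].  For [m] coprime to [q], the substitution [n -> n + k / m] mod [Q]
    turns [f_t (m n)] into [f_t (m n + k)], which up to exceptions is
    [f_t (m n)] times a factor depending only on the low digits of [m n].
    Averaging over [k < q^kap] and applying Cauchy-Schwarz therefore bounds the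
    correlation sums by averages of the weights along progressions.  For sums of
    type II these averages are again autocorrelations of [f], whose l^2 norm is
    controlled by the Fourier property alone; for sums of type I the weights are
    indicators of intervals, whose averages along progressions are nearly
    constant.  Only the case [kappa = 1] of the Fourier property is used, and
    Parseval's identity gives [gamma l <= l / 2], which keeps all the parameters
    small compared with [log x]. *)

From mathcomp Require Import all_boot all_order all_algebra.
From mathcomp Require Import all_classical all_reals all_analysis.
From mathcomp Require Import ring lra zify.
Require Import Defs.

Set Implicit Arguments.
Unset Strict Implicit.
Unset Printing Implicit Defensive.

Import Order.TTheory GRing.Theory Num.Theory.
Import numFieldNormedType.Exports.

Local Open Scope classical_set_scope.
Local Open Scope ring_scope.
Local Open Scope complex_scope.

Local Notation cj := (@conjc _).

(** Dividing by [m] modulo [Q] requires [m] coprime to [q], so the sum over primes is restricted to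
    integers coprime to [q], at logarithmic cost. In the type II case the sum over [m] is tested
    against its own mean: the l^2 norm [z] of that mean appears on both sides of the shift bound,
    and a quadratic inequality turns [z <= d1 x + y], [y^2 <= x z + d2 x^2] into [z = O(x)]. The
    Fourier property is assumed for positive [kappa], hence for [f (q * n)] but not for [f n]; so
    the last digit is replaced by zero, and the correction, a function of a few low digits, factors
    out of correlations along suitable progressions. The saving [q^s] has [s] near [gamma l / 20]
    because the type II step needs [q^(36 s)] times the squared decay [q^(- 2 gamma l)] to stay
    bounded, and [36 / 20 < 2]. The power of log is [3 + 3/2 = 9/2 <= c2]: one factor each for the
    number of shells, the removal of [m n < Y] and the weight log, and [3/2] for the l^2 norm of the
    divisor function. *)

Ltac nneg := repeat first
  [ assumption | exact: ler0n | exact: sqr_ge0 | exact: ler01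
  | apply: mulr_ge0 | apply: addr_ge0 | rewrite invr_ge0 | apply: exprn_ge0
  | apply: ltW; assumption ].

(** * The complex modulus, additive characters and periodic sums *)

Arguments e : simpl never.
Arguments conjc : simpl never.

Section ComplexModulus.
Context {R : realType}.
Implicit Types (z w : R[i]) (x y : R).

(** The library norm lands in [R[i]], whose order is partial; a real-valued modulus keeps all
    estimates among real numbers. *)
Definition cabs z : R := complex.Re `|z|.

Lemma cabsE z : `|z| = (cabs z)%:C.
Proof. by rewrite /cabs normc_def. Qed.

Lemma cabs_le_normC z x : (`|z| <= x%:C) = (cabs z <= x).
Proof. by rewrite cabsE lecR. Qed.

Lemma cabs_ge0 z : 0 <= cabs z.
Proof. by rewrite -lecR -cabsE normr_ge0. Qed.

Lemma cabs0 : cabs 0 = 0.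
Proof. by rewrite /cabs normr0. Qed.

Lemma cabs1 : cabs 1 = 1.
Proof. by rewrite /cabs normr1. Qed.

Lemma cabsM z w : cabs (z * w) = cabs z * cabs w.
Proof. by apply: (@complexI R); rewrite -cabsE normrM !cabsE -rmorphM. Qed.

Lemma cabsN z : cabs (- z) = cabs z.
Proof. by rewrite /cabs normrN. Qed.

Lemma cabsD z w : cabs (z + w) <= cabs z + cabs w.
Proof. by rewrite -lecR rmorphD /= -!cabsE ler_normD. Qed.

Lemma cabsB z w : cabs (z - w) <= cabs z + cabs w.
Proof. by rewrite -(cabsN w) cabsD. Qed.

Lemma cabs_le_add z w : cabs z <= cabs w + cabs (z - w).
Proof. by apply: le_trans (cabsD _ _); rewrite addrC subrK. Qed.

Lemma cabsJ z : cabs (cj z) = cabs z.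
Proof. by rewrite /cabs normcJ. Qed.

Lemma cabs_real x : cabs x%:C = `|x|.
Proof. by rewrite /cabs normc_def /= expr0n addr0 sqrtr_sqr. Qed.

Lemma cabs_nat n : cabs (n%:R) = n%:R.
Proof. by rewrite /cabs normr_nat; elim: n => [|n IH] //=; rewrite -!natr1 raddfD /= IH. Qed.

Lemma cabsV z : cabs (z^-1) = (cabs z)^-1.
Proof. by apply: (@complexI R); rewrite -cabsE normfV cabsE -fmorphV. Qed.

Lemma mulcJ z : z * cj z = (cabs z ^+ 2)%:C.
Proof. by rewrite -sqr_normc cabsE -rmorphXn. Qed.

Lemma cabs_sum (I : Type) (r : seq I) (P : pred I) (F : I -> R[i]) :
  cabs (\sum_(i <- r | P i) F i) <= \sum_(i <- r | P i) cabs (F i).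
Proof.
elim/big_rec2: _ => [|i y z _ le_zy]; first by rewrite cabs0.
by apply: le_trans (cabsD _ _) _; rewrite lerD2l.
Qed.

Lemma sum_conjc (I : Type) (r : seq I) (P : pred I) (F : I -> R[i]) :
  cj (\sum_(i <- r | P i) F i) = \sum_(i <- r | P i) cj (F i).
Proof. exact: rmorph_sum. Qed.

Lemma sum_realC (I : Type) (r : seq I) (P : pred I) (F : I -> R) :
  (\sum_(i <- r | P i) F i)%:C = \sum_(i <- r | P i) (F i)%:C.
Proof. exact: rmorph_sum. Qed.

Lemma conjcM z w : cj (z * w) = cj z * cj w.
Proof. exact: rmorphM. Qed.

Lemma natC n : (n%:R : R)%:C = n%:R :> R[i].
Proof. exact: rmorph_nat. Qed.

Lemma invC x : (x^-1)%:C = (x%:C)^-1 :> R[i].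
Proof. exact: fmorphV. Qed.

Lemma cabs_real_ge0 x : 0 <= x -> cabs x%:C = x.
Proof. by move=> x0; rewrite cabs_real ger0_norm. Qed.

Lemma mulrC_sqr_le x y : x * y <= (x ^+ 2 + y ^+ 2) / 2.
Proof. by have := sqr_ge0 (x - y); rewrite sqrrB; lra. Qed.

Lemma eq_le x y : x = y -> x <= y.
Proof. by move=> ->. Qed.

Lemma ler_sum_ord n (F : 'I_n -> R) x :
  (forall i, F i <= x) -> \sum_(i < n) F i <= n%:R * x.
Proof.
move=> Fx; have -> : n%:R * x = \sum_(i < n) x by rewrite sumr_const card_ord mulr_natl.
by apply: ler_sum => i _; exact: Fx.
Qed.

Lemma sqr_sum_le (I : Type) (r : seq I) (P : pred I) (F G : I -> R) :
  (\sum_(i <- r | P i) F i * G i) ^+ 2 <=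
  (\sum_(i <- r | P i) F i ^+ 2) * (\sum_(i <- r | P i) G i ^+ 2).
Proof.
rewrite expr2 !big_distrlr /=.
set A := \sum_(i <- r | P i) \sum_(j <- r | P j) _.
set B := \sum_(i <- r | P i) \sum_(j <- r | P j) _.
have B' : B = \sum_(i <- r | P i) \sum_(j <- r | P j) F j ^+ 2 * G i ^+ 2.
  by rewrite /B exchange_big.
suff : A *+ 2 <= B + B by rewrite mulr2n; lra.
rewrite {2}B' /A /B mulr2n -!big_split /=; apply: ler_sum => i _.
rewrite -!big_split /=; apply: ler_sum => j _.
have := sqr_ge0 (F i * G j - F j * G i); nra.
Qed.

Lemma sqr_sum1_le (I : finType) (P : pred I) (F : I -> R) :
  (\sum_(i | P i) F i) ^+ 2 <= #|P|%:R * \sum_(i | P i) F i ^+ 2.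
Proof.
have := sqr_sum_le (index_enum I) P (fun=> 1) F.
under eq_bigr do rewrite mul1r.
by rewrite expr1n sumr_const.
Qed.

Lemma cabs_CS (I : Type) (r : seq I) (P : pred I) (F G : I -> R[i]) :
  cabs (\sum_(i <- r | P i) F i * G i) ^+ 2 <=
  (\sum_(i <- r | P i) cabs (F i) ^+ 2) * (\sum_(i <- r | P i) cabs (G i) ^+ 2).
Proof.
apply: le_trans (sqr_sum_le _ _ _ _).
rewrite ler_sqr ?nnegrE ?cabs_ge0 //; last first.
  by apply: sumr_ge0 => i _; rewrite mulr_ge0 ?cabs_ge0.
by apply: le_trans (cabs_sum _ _ _) _; apply: ler_sum => i _; rewrite cabsM.
Qed.

Lemma cabs_sum_sqr (I : Type) (r : seq I) (P : pred I) (F : I -> R[i]) :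
  (cabs (\sum_(i <- r | P i) F i) ^+ 2)%:C =
  \sum_(i <- r | P i) \sum_(j <- r | P j) F i * cj (F j).
Proof. by rewrite -mulcJ sum_conjc big_distrlr. Qed.

Lemma cabs_sum_const n z : cabs (\sum_(k < n) z) = n%:R * cabs z.
Proof. by rewrite sumr_const card_ord -[z *+ n]mulr_natl cabsM cabs_nat. Qed.

(** One error term for each of the two factors that are approximated, [z] by [z0 * h] and [w] by
    [w0 * k]. *)
Lemma mul_conj_perturb z w z0 w0 h k :
  z * cj w = h * cj k * (z0 * cj w0) +
    ((z - z0 * h) * cj w + z0 * h * cj (w - w0 * k)).
Proof. by rewrite rmorphB /= !conjcM; ring. Qed.

Lemma cabs_perturb z w z0 h u : cabs w = 1 -> cabs z0 = 1 -> cabs h = 1 ->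
  cabs ((z - z0 * h) * cj w + z0 * h * cj u) <= cabs (z - z0 * h) + cabs u.
Proof.
move=> w1 z1 h1; apply: le_trans (cabsD _ _) _.
by rewrite cabsM (cabsM (z0 * h)) (cabsM z0) !cabsJ w1 z1 h1 !mulr1 mul1r.
Qed.

Lemma sqr_le_add x y y' : 0 <= x -> x <= y + y' -> x ^+ 2 <= 2 * y ^+ 2 + 2 * y' ^+ 2.
Proof.
move=> x0 xy; have : x ^+ 2 <= (y + y') ^+ 2 by rewrite ler_sqr ?nnegrE //; lra.
by have := sqr_ge0 (y - y'); rewrite sqrrB sqrrD; lra.
Qed.

Lemma conj_quad z1 z2 z3 z4 :
  cj (z1 * cj z2 * (cj z3 * z4)) = z2 * cj z1 * (cj z4 * z3).
Proof. by rewrite !conjcM !conjcK; ring. Qed.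

Lemma cabs_quad z1 z2 z3 z4 :
  cabs (z1 * cj z2 * (cj z3 * z4)) = cabs z1 * cabs z2 * (cabs z3 * cabs z4).
Proof. by rewrite !cabsM !cabsJ. Qed.

Lemma mul_conj_pair z1 z2 z3 z4 :
  z1 * cj z2 * cj (z3 * cj z4) = z1 * cj z3 * (cj z2 * z4).
Proof. by rewrite !conjcM !conjcK; ring. Qed.

End ComplexModulus.

(** * The additive character [e] *)

Section AdditiveCharacter.
Context {R : realType}.
Implicit Types (x y : R).

Lemma eD x y : e (x + y) = e x * e y.
Proof.
rewrite /e mulrDr cosD sinD.
by apply/eqP; rewrite eq_complex /= eqxx /= addrC.
Qed.

Lemma e0 : e (0 : R) = 1.
Proof. by rewrite /e mulr0 cos0 sin0. Qed.

Lemma cabs_e x : cabs (e x) = 1.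
Proof. by rewrite /cabs normc_def /= cos2Dsin2 sqrtr1. Qed.

Lemma conj_e x : cj (e x) = e (- x).
Proof. by rewrite /e mulrN cosN sinN. Qed.

Lemma eN x : e x * e (- x) = 1.
Proof. by rewrite -eD subrr e0. Qed.

Lemma e_nat n : e (n%:R : R) = 1.
Proof.
elim: n => [|n IH]; first by rewrite e0.
rewrite -natr1 eD IH mul1r /e mulr1 mulr_natl cos2pi sin2pi.
by [].
Qed.

Lemma cabs_e_sub1 x : cabs (e x - 1) = 2 * `|sin (pi * x)|.
Proof.
rewrite /cabs normc_def /=.
have -> : 2 * pi * x = (pi * x) *+ 2 by rewrite -mulrA mulr_natl.
set y := pi * x; have csy := cos2Dsin2 y.
have -> : (cos (y *+ 2) - 1) ^+ 2 + (sin (y *+ 2) - 0) ^+ 2 = (2 * sin y) ^+ 2.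
  rewrite cos_mulr2n sin_mulr2n.
  transitivity ((2 * cos y ^+ 2 - 2) ^+ 2 + 4 * cos y ^+ 2 * sin y ^+ 2); first by ring.
  by rewrite (_ : cos y ^+ 2 = 1 - sin y ^+ 2); [ring|rewrite -csy addrK].
by rewrite sqrtr_sqr normrM ger0_norm.
Qed.

Lemma sin_pi_neq0 x : x != 0 -> `|x| < 1 -> sin (pi * x) != 0.
Proof.
move=> x0 x1; wlog xgt0 : x x0 x1 / 0 < x.
  move=> H; case: (ltgtP x 0) x0 => // lx _; last by apply: H => //; rewrite gt_eqF.
  by rewrite -[x]opprK mulrN sinN oppr_eq0 H ?oppr_eq0 ?lt_eqF ?normrN ?oppr_gt0.
rewrite gt_eqF // sin_gt0_pi // mulr_gt0 ?pi_gt0 //=.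
by rewrite -[ltRHS]mulr1 ltr_pM2l ?pi_gt0 // -(gtr0_norm xgt0).
Qed.

Lemma e_mulrn x n : e (x *+ n) = e x ^+ n.
Proof. by elim: n => [|n IH]; rewrite ?mulr0n ?e0 // mulrS eD IH exprS. Qed.

End AdditiveCharacter.

(** * Sums of periodic functions over a full period *)

Section Periodic.
Variables (V : zmodType).
Implicit Types (Q : nat) (F : nat -> V).

(** Stated with the remainder rather than with [n + Q], so that any congruence modulo [Q] directly
    yields an equality of values. *)
Definition periodic_mod Q F := forall n, F (n %% Q)%N = F n.

Lemma periodicP Q F m n : periodic_mod Q F -> m = n %[mod Q] -> F m = F n.
Proof. by move=> pF emn; rewrite -pF emn pF. Qed.

Lemma periodicD Q F a n : periodic_mod Q F -> F (n + Q * a)%N = F n.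
Proof. by move=> pF; apply: (periodicP pF); rewrite addnC mulnC modnMDl. Qed.

Lemma sum_periodic_addr Q F a : periodic_mod Q F ->
  \sum_(n < Q) F (n + a)%N = \sum_(n < Q) F n.
Proof.
case: Q => [|Q] pF; first by rewrite !big_ord0.
pose h (n : 'I_Q.+1) : 'I_Q.+1 := inord ((n + a) %% Q.+1).
have hE n : h n = ((n + a) %% Q.+1)%N :> nat by rewrite inordK // ltn_mod.
rewrite [RHS](reindex_inj (h := h)) /=; last first.
  move=> m n /(congr1 val) /=; rewrite !hE => /eqP.
  by rewrite eqn_modDr !modn_small // => /eqP/val_inj.
by apply: eq_bigr => n _; rewrite hE pF.
Qed.

Lemma sum_periodic_mul Q F m : coprime m Q -> periodic_mod Q F ->
  \sum_(n < Q) F (m * n)%N = \sum_(n < Q) F n.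
Proof.
case: Q => [|Q] cmQ pF; first by rewrite !big_ord0.
pose h (n : 'I_Q.+1) : 'I_Q.+1 := inord ((m * n) %% Q.+1).
have hE n : h n = ((m * n) %% Q.+1)%N :> nat by rewrite inordK // ltn_mod.
rewrite [RHS](reindex_inj (h := h)) /=; last first.
  move=> n p /(congr1 val) /=; rewrite !hE => /eqP enp; apply: val_inj => /=.
  wlog le_np : n p enp / (n <= p)%N.
    by move=> H; case/orP: (leq_total n p) => le; [exact: H|symmetry; apply: H => //; rewrite eq_sym].
  move: enp; rewrite eq_sym eqn_mod_dvd ?leq_mul2l ?le_np ?orbT // -mulnBr.
  rewrite Gauss_dvdr; last by rewrite coprime_sym.
  move=> dv; have := ltn_ord p; case: (posnP (p - n)) => [/eqP|pn_gt0].
    by rewrite subn_eq0 => le_pn _; apply/eqP; rewrite eqn_leq le_np.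
  by have := dvdn_leq pn_gt0 dv; lia.
by apply: eq_bigr => n _; rewrite hE pF.
Qed.

Lemma sum_periodic_muln Q F k : (0 < Q)%N -> periodic_mod Q F ->
  \sum_(n < Q * k) F n = (\sum_(n < Q) F n) *+ k.
Proof.
move=> Q0 pF; elim: k => [|k IH]; first by rewrite muln0 big_ord0 mulr0n.
rewrite -(big_mkord xpredT F) mulnS addnC.
rewrite (big_cat_nat (n := (Q * k)%N)) ?leq_addr //= big_mkord IH mulrSr; congr (_ + _).
rewrite -{1}[(Q * k)%N]add0n big_addn addKn big_mkord.
by apply: eq_bigr => i _; rewrite periodicD.
Qed.

End Periodic.

(** * Parseval's identity and autocorrelations modulo [Q] *)

Section Parseval.
Context {R : realType}.
Variable Q : nat.
Hypothesis Q0 : (0 < Q)%N.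

Lemma ratio_natM (n : nat) : (Q%:R : R) * n%:R / Q%:R = n%:R.
Proof. by rewrite mulrAC divff ?mul1r // pnatr_eq0 -lt0n. Qed.

Lemma e_periodic (h : nat) : periodic_mod Q (fun n => e ((h * n)%:R / Q%:R : R)).
Proof.
move=> n; rewrite {2}(divn_eq n Q) mulnDr natrD mulrDl eD.
suff -> : e ((h * (n %/ Q * Q))%:R / Q%:R : R) = 1 by rewrite mul1r.
by rewrite [(n %/ Q * Q)%N]mulnC mulnCA natrM ratio_natM e_nat.
Qed.

Lemma e_orth (m n : nat) : (m < Q)%N -> (n < Q)%N ->
  \sum_(h < Q) e ((h * m)%:R / Q%:R : R) * cj (e ((h * n)%:R / Q%:R)) =
  if m == n then Q%:R else 0.
Proof.
move=> mQ nQ; have QR : (Q%:R : R) != 0 by rewrite pnatr_eq0 -lt0n.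
pose z : R[i] := e ((m%:R - n%:R) / Q%:R).
have zE (h : nat) : e ((h * m)%:R / Q%:R : R) * cj (e ((h * n)%:R / Q%:R)) = z ^+ h.
  rewrite conj_e -eD -e_mulrn; congr (e _).
  by rewrite -mulr_natl !natrM; field.
under eq_bigr do rewrite zE.
have [mn|mn] := eqVneq m n.
  under eq_bigr do rewrite /z mn subrr mul0r e0 expr1n.
  by rewrite sumr_const card_ord.
have zQ : z ^+ Q = 1.
  rewrite -e_mulrn.
  have -> : (m%:R - n%:R) / Q%:R *+ Q = m%:R - n%:R :> R by rewrite -[_ *+ Q]mulr_natr mulfVK.
  rewrite eD e_nat mul1r -conj_e e_nat.
  exact: conjc1.
(* [(m - n) / Q] is nonzero and smaller than 1 in modulus, so the sine in [cabs_e_sub1] does not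
   vanish; as [z ^+ Q = 1], the geometric sum must. *)
have z1 : z != 1.
  apply/eqP => z1; have := cabs_e_sub1 ((m%:R - n%:R) / Q%:R : R).
  rewrite -/z z1 subrr cabs0 => /esym/eqP; rewrite mulf_eq0 pnatr_eq0 /= normr_eq0.
  apply/negP/sin_pi_neq0.
    by rewrite mulf_neq0 ?invr_neq0 // subr_eq0 eqr_nat.
  rewrite normrM normfV normr_nat ltr_pdivrMr ?ltr0n // mul1r ltr_norml.
  have [mR nR] : m%:R < Q%:R :> R /\ n%:R < Q%:R :> R by rewrite !ltr_nat.
  have := ler0n R m; have := ler0n R n; lra.
have := subrX1 z Q; rewrite zQ subrr => /esym/eqP.
by rewrite mulf_eq0 subr_eq0 (negPf z1) /= => /eqP.
Qed.

Lemma parseval (F : nat -> R[i]) :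
  \sum_(a < Q) cabs (\sum_(h < Q) F h * e ((h * a)%:R / Q%:R : R)) ^+ 2 =
  Q%:R * \sum_(h < Q) cabs (F h) ^+ 2.
Proof.
apply: (@complexI R); rewrite sum_realC rmorphM /= sum_realC natC.
under eq_bigr do rewrite cabs_sum_sqr.
rewrite exchange_big /= mulr_sumr; apply: eq_bigr => h _.
rewrite exchange_big /= (bigD1 h) //= [X in _ + X]big1 ?addr0.
  under eq_bigr => a _ do rewrite conjcM mulrACA !(mulnC h) mulcJ.
  by rewrite -mulr_sumr e_orth ?ltn_ord // eqxx mulrC.
move=> k kh.
under eq_bigr => a _ do rewrite conjcM mulrACA (mulnC h) (mulnC k).
rewrite -mulr_sumr e_orth ?ltn_ord // ifN ?mulr0 //.
by rewrite eq_sym.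
Qed.

Lemma parsevalN (F : nat -> R[i]) :
  \sum_(a < Q) cabs (\sum_(h < Q) F h * cj (e ((h * a)%:R / Q%:R : R))) ^+ 2 =
  Q%:R * \sum_(h < Q) cabs (F h) ^+ 2.
Proof.
have := parseval (fun h => cj (F h)).
under [in RHS]eq_bigr do rewrite cabsJ.
move=> <-; apply: eq_bigr => a _; congr (_ ^+ 2).
rewrite -cabsJ sum_conjc; congr cabs; apply: eq_bigr => h _.
by rewrite conjcM conjcK.
Qed.

(* The Fourier transform of the autocorrelation is the square modulus of that
   of [F], so its l^2 norm is bounded by the sup norm of the transform. *)
Lemma autocorrelation_l2 (F : nat -> R[i]) (M : R) :
  periodic_mod Q F -> (forall n, cabs (F n) <= 1) ->
  (forall h, cabs (\sum_(X < Q) F X * cj (e ((h * X)%:R / Q%:R : R))) <= M * Q%:R) ->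
  \sum_(a < Q) cabs (\sum_(X < Q) F (X + a)%N * cj (F X)) ^+ 2 <= Q%:R ^+ 3 * M ^+ 2.
Proof.
move=> pF F1 FM; have QR : (Q%:R : R) != 0 by rewrite pnatr_eq0 -lt0n.
have Q0R : 0 < (Q%:R : R) by rewrite ltr0n.
pose Ft h := \sum_(X < Q) F X * cj (e ((h * X)%:R / Q%:R : R)).
have FtL2 : \sum_(h < Q) cabs (Ft h) ^+ 2 <= Q%:R ^+ 2.
  have := parsevalN F; rewrite /Ft.
  under eq_bigr => a _ do under eq_bigr => h _ do rewrite mulnC.
  move=> ->; rewrite expr2 ler_pM2l // -[leRHS]mulr1.
  by apply: ler_sum_ord => i; rewrite expr_le1 ?cabs_ge0.
have CE (a : 'I_Q) : \sum_(X < Q) F (X + a)%N * cj (F X) =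
    \sum_(h < Q) ((cabs (Ft h) ^+ 2) / Q%:R)%:C * e ((h * a)%:R / Q%:R : R).
  transitivity (\sum_(h < Q) (Q%:R)^-1 * \sum_(X < Q) \sum_(Y < Q) F X * cj (F Y) *
      (e ((h * (Y + a))%:R / Q%:R : R) * cj (e ((h * X)%:R / Q%:R)))); last first.
    apply: eq_bigr => h _; rewrite rmorphM /= invC natC mulrAC mulrC; congr (_ * _).
    rewrite -mulcJ /Ft sum_conjc big_distrlr /= mulr_suml; apply: eq_bigr => X _.
    rewrite mulr_suml; apply: eq_bigr => Y _.
    by rewrite conjcM conjcK mulnDr natrD mulrDl eD; ring.
  rewrite -mulr_sumr exchange_big /=.
  under [in RHS]eq_bigr => X _ do rewrite exchange_big /=.
  rewrite exchange_big /= mulr_sumr; apply: eq_bigr => Y _.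
  pose Z : 'I_Q := Ordinal (ltn_pmod (Y + a) Q0).
  under eq_bigr => X _.
    rewrite -mulr_sumr.
    under eq_bigr => h _ do rewrite -(@e_periodic h (Y + a)%N).
    rewrite e_orth ?ltn_ord ?ltn_pmod //.
    over.
  rewrite (bigD1 Z) //= eqxx big1 ?addr0 => [|X XZ]; last first.
    by rewrite ifN ?mulr0 // eq_sym.
  by rewrite pF [RHS]mulrC mulfK // pnatr_eq0 -lt0n.
under eq_bigr do rewrite CE.
rewrite (parseval (fun h => (cabs (Ft h) ^+ 2 / Q%:R)%:C)) exprS -mulrA ler_pM2l //.
have M0 : 0 <= M.
  by have := le_trans (cabs_ge0 _) (FM 0%N); rewrite pmulr_lge0.
(* The fourth moment of [Ft] is at most its squared supremum times its second moment [FtL2]. *)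
apply: (@le_trans _ _ (\sum_(h < Q) cabs (Ft h) ^+ 2 * M ^+ 2)).
  apply: ler_sum => h _; rewrite cabs_real_ge0; last by rewrite divr_ge0 ?sqr_ge0 // ltW.
  have -> : (cabs (Ft h) ^+ 2 / Q%:R) ^+ 2 = cabs (Ft h) ^+ 2 * (cabs (Ft h) / Q%:R) ^+ 2 by field.
  rewrite ler_wpM2l ?sqr_ge0 // ler_sqr ?nnegrE ?divr_ge0 ?cabs_ge0 ?ler0n //.
  by rewrite ler_pdivrMr // FM.
by rewrite -mulr_suml ler_wpM2r ?sqr_ge0.
Qed.

End Parseval.

Section BlockSums.
Variable V : zmodType.

Lemma sum_mul (F : nat -> V) A B :
  \sum_(y < A * B) F y = \sum_(l < A) \sum_(i < B) F (l * B + i)%N.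
Proof.
elim: A => [|A IH]; first by rewrite mul0n !big_ord0.
rewrite big_ord_recr /= -IH -(big_mkord xpredT F) mulSn addnC.
rewrite (big_cat_nat (n := (A * B)%N)) ?leq_addr //= big_mkord; congr (_ + _).
rewrite -{1}[(A * B)%N]add0n big_addn addKn big_mkord.
by apply: eq_bigr => i _; rewrite addnC.
Qed.

Lemma sum_divn (F : nat -> V) A B :
  \sum_(y < A * B) F (y %/ B)%N = (\sum_(l < A) F l) *+ B.
Proof.
rewrite (sum_mul (fun y => F (y %/ B)%N)) -sumrMnl; apply: eq_bigr => l _.
rewrite -[X in _ *+ X]card_ord -sumr_const; apply: eq_bigr => i _.
by rewrite divnMDl ?divn_small ?addn0 // (leq_ltn_trans _ (ltn_ord i)).
Qed.

End BlockSums.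

Lemma block_bound (y A i k : nat) : (y < A -> k < A -> i * A + y + k < i.+2 * A)%N.
Proof. by rewrite !mulSn; lia. Qed.

(** The values [c * j] are one element out of each block of length [c] in [[0, Q * c)], an interval
    that covers [c] periods of [F]; since [F] is nonnegative the other elements can be added. *)
Lemma sum_dilate_le (R : realType) Q c (F : nat -> R) : (0 < Q)%N -> (0 < c)%N ->
  periodic_mod Q F -> (forall n, 0 <= F n) ->
  \sum_(j < Q) F (c * j)%N <= c%:R * \sum_(a < Q) F a.
Proof.
move=> Q0 c0 pF F0; rewrite mulr_natl -sum_periodic_muln // sum_mul.
apply: ler_sum => j _; case: c c0 => // c _.
rewrite big_ord_recl /= addn0 mulnC lerDl; apply: sumr_ge0 => i _; exact: F0.
Qed.

(** * Inverses modulo [Q] *)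

Section ModularInverse.

(** A non-unit is sent to itself, so that [minv Q] is an involution of [[0, Q)] and can reindex sums
    over all residues. *)
Definition minv Q i := if coprime i Q then ((egcdn i Q).1 %% Q)%N else i.

Lemma minvP Q i : (1 < Q)%N -> coprime i Q -> (i * minv Q i = 1 %[mod Q])%N.
Proof.
move=> Q1 ciQ; rewrite /minv ciQ modnMmr.
have i0 : (0 < i)%N.
  by case: i ciQ => // /eqP; rewrite gcd0n => Q1'; rewrite Q1' in Q1.
case: (egcdnP Q i0) => u v /= eq _; move: eq; rewrite (eqP ciQ) => E.
by rewrite mulnC E modnMDl.
Qed.

Lemma minv_coprime Q i : (1 < Q)%N -> coprime i Q -> coprime (minv Q i) Q.
Proof.
move=> Q1 ciQ; have /eqP E := minvP Q1 ciQ.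
have : coprime (i * minv Q i) Q by rewrite -coprime_modl (eqP E) coprime_modl coprime1n.
by rewrite coprimeMl => /andP[].
Qed.

Lemma minv_lt Q i : (i < Q)%N -> (minv Q i < Q)%N.
Proof. by move=> iQ; rewrite /minv; case: ifP => // _; rewrite ltn_mod; case: Q iQ. Qed.

Lemma mul_cancel_mod Q i a b : coprime i Q ->
  (i * a = i * b %[mod Q])%N -> (a = b %[mod Q])%N.
Proof.
move=> ciQ; wlog le_ab : a b / (a <= b)%N.
  by move=> H E; case/orP: (leq_total a b) => le; [exact: H|symmetry; apply: H].
move/eqP; rewrite eq_sym eqn_mod_dvd ?leq_mul2l ?le_ab ?orbT // -mulnBr.
rewrite Gauss_dvdr; last by rewrite coprime_sym.
by move=> dv; apply/eqP; rewrite eq_sym eqn_mod_dvd.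
Qed.

Lemma minvK Q i : (1 < Q)%N -> (i < Q)%N -> minv Q (minv Q i) = i.
Proof.
move=> Q1 iQ; case ciQ : (coprime i Q); last by rewrite {2}/minv ciQ /minv ciQ.
have cm := minv_coprime Q1 ciQ.
have := @mul_cancel_mod Q (minv Q i) (minv Q (minv Q i)) i cm.
rewrite minvP // [(_ * i)%N]mulnC minvP // => /(_ erefl).
by rewrite !modn_small // minv_lt // minv_lt.
Qed.

End ModularInverse.

(** * The propagation property *)

Section OffDiagonal.
Context {R : realType}.
Variables (Q : nat) (B : nat -> R[i]).
Hypotheses (Q0 : (0 < Q)%N) (pB : periodic_mod Q B).

Definition dilated_mean c n : R[i] := Q%:R^-1 * \sum_(j < Q) B (n + c * j)%N.

Lemma dilated_mean_periodic c : periodic_mod Q (dilated_mean c).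
Proof.
move=> n; congr (_ * _); apply: eq_bigr => j _.
by apply: (periodicP pB); rewrite modnDml.
Qed.

Lemma dilated_mean_shift c n t : dilated_mean c (n + c * t) = dilated_mean c n.
Proof.
rewrite /dilated_mean; congr (_ * _).
rewrite -(sum_periodic_addr (F := fun j => B (n + c * j)%N) t).
  by apply: eq_bigr => j _; rewrite mulnDr addnCA addnC addnA.
by move=> j; apply: (periodicP pB); rewrite -modnDmr modnMmr modnDmr.
Qed.

Lemma QR_neq0 : (Q%:R : R[i]) != 0.
Proof. by rewrite pnatr_eq0 -lt0n. Qed.

Lemma mean_const (z : R[i]) : Q%:R^-1 * \sum_(j < Q) z = z.
Proof. by rewrite sumr_const card_ord -[z *+ Q]mulr_natl mulKf // QR_neq0. Qed.

Lemma predn_mul a : (Q.-1 * a + a = a * Q)%N.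
Proof. by rewrite -mulSnr prednK // mulnC. Qed.

(* Averaging over [i + L j] makes the second factor range over a coset; the
   compensating shifts of [n] do not change [U], which only sees [n] mod [L]. *)
Lemma off_diagonal (U : nat -> nat -> R[i]) L k1 k2 :
  (k1 <= k2)%N ->
  (forall n, periodic_mod Q (U^~ n)) -> (forall i, periodic_mod Q (U i)) ->
  (forall i j n, U (i + L * j)%N n = U i n) ->
  (forall i j n, U i (n + L * j)%N = U i n) ->
  (forall i n, cabs (U i n) <= 1) ->
  cabs (\sum_(i < Q) \sum_(n < Q) U i n * (cj (B (n + k1 * i)%N) * B (n + k2 * i)%N))
  <= Q%:R * \sum_(n < Q) cabs (dilated_mean (L * (k2 - k1)) n) ^+ 2.
Proof.
move=> k12 pU1 pU2 U1 U2 Ub; set c := (L * (k2 - k1))%N.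
pose T i n := U i n * (cj (B (n + k1 * i)%N) * B (n + k2 * i)%N).
have pT1 n : periodic_mod Q (T^~ n).
  move=> i; rewrite /T (pU1 n i); congr (_ * (cj _ * _));
  by apply: (periodicP pB); rewrite -modnDmr modnMmr modnDmr.
pose b := dilated_mean c.
have step1 : \sum_(i < Q) \sum_(n < Q) T i n =
  \sum_(i < Q) \sum_(n < Q) U i n * (cj (B (n + k1 * i)%N) * b (n + k2 * i)%N).
  transitivity (Q%:R^-1 * \sum_(j < Q) \sum_(i < Q) \sum_(n < Q) T (i + L * j)%N n).
    rewrite -[LHS]mean_const; congr (_ * _); apply: eq_bigr => j _.
    rewrite exchange_big [RHS]exchange_big; apply: eq_bigr => n _.
    by rewrite (sum_periodic_addr (F := T^~ n)).
  rewrite exchange_big mulr_sumr; apply: eq_bigr => i _.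
  transitivity (Q%:R^-1 * \sum_(j < Q) \sum_(n < Q)
      U i n * (cj (B (n + k1 * i)%N) * B (n + k2 * i + c * j)%N)).
    congr (_ * _); apply: eq_bigr => j _.
    pose T' n := T (i + L * j)%N n.
    have pT' : periodic_mod Q T'.
      move=> n; rewrite /T' /T (pU2 _ n); congr (_ * (cj _ * _));
      by apply: (periodicP pB); rewrite modnDml.
    (* [Q.-1] plays the role of -1 modulo [Q]. Moving [n] by [- k1 * L * j] restores the first
       factor, and the second is left with the shift [c * j]. *)
    rewrite -(sum_periodic_addr (Q.-1 * (k1 * (L * j))) pT'); apply: eq_bigr => n _.
    rewrite /T' /T U1 (_ : Q.-1 * (k1 * (L * j)) = L * (Q.-1 * k1 * j))%N; last by lia.
    rewrite U2; congr (_ * (cj _ * _)); apply: (periodicP pB).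
      rewrite (_ : _ + _ = (k1 * L * j) * Q + (n + k1 * i))%N ?modnMDl //.
      by move: (predn_mul (k1 * L * j)); move: (Q.-1) => p; lia.
    rewrite (_ : _ + _ = (k1 * L * j) * Q + (n + k2 * i + c * j))%N ?modnMDl //.
    rewrite /c; move: (predn_mul (k1 * L * j)); move: (Q.-1) => p.
    by have := subnK k12; move: (k2 - k1)%N => d <-; lia.
  rewrite exchange_big mulr_sumr; apply: eq_bigr => n _.
  by rewrite -!mulr_sumr /b /dilated_mean mulrCA; congr (_ * _); rewrite mulrCA.
have step2 : \sum_(i < Q) \sum_(n < Q) T i n =
  \sum_(i < Q) \sum_(n < Q) U i n * (cj (b (n + k1 * i)%N) * b (n + k2 * i)%N).
  rewrite step1; apply: eq_bigr => i _.
  transitivity (Q%:R^-1 * \sum_(j < Q) \sum_(n < Q)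
      U i n * (cj (B (n + k1 * i + c * j)%N) * b (n + k2 * i)%N)).
    rewrite -[LHS]mean_const; congr (_ * _); apply: eq_bigr => j _.
    pose T' n := U i n * (cj (B (n + k1 * i)%N) * b (n + k2 * i)%N).
    have pT' : periodic_mod Q T'.
      move=> n; rewrite /T' (pU2 _ n); congr (_ * (cj _ * _)).
        by apply: (periodicP pB); rewrite modnDml.
      by apply: (periodicP (@dilated_mean_periodic c)); rewrite modnDml.
    rewrite -(sum_periodic_addr (c * j) pT'); apply: eq_bigr => n _.
    rewrite /T' {1}/c -mulnA U2; congr (_ * (cj _ * _)); first by rewrite addnAC.
    by rewrite addnAC mulnA -/c /b dilated_mean_shift.
  rewrite exchange_big mulr_sumr; apply: eq_bigr => n _.
  rewrite -!mulr_sumr -mulr_suml -sum_conjc mulrCA; congr (_ * _).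
  rewrite mulrA; congr (_ * _).
  by rewrite /b /dilated_mean conjcM conjc_inv conjc_nat.
rewrite -/(T _ _) (_ : \sum_(i < Q) _ = \sum_(i < Q) \sum_(n < Q) T i n) //.
rewrite step2; apply: le_trans (cabs_sum _ _ _) _; apply: ler_sum_ord => i.
apply: le_trans (cabs_sum _ _ _) _.
apply: (@le_trans _ _ (\sum_(n < Q) (cabs (b (n + k1 * i)%N) ^+ 2 / 2 + cabs (b (n + k2 * i)%N) ^+ 2 / 2))).
  apply: ler_sum => n _; rewrite -mulrDl; apply: le_trans (mulrC_sqr_le _ _).
  rewrite cabsM [cabs (cj _ * _)]cabsM cabsJ -[leRHS]mul1r ler_wpM2r ?mulr_ge0 ?cabs_ge0 //; exact: Ub.
have pb : periodic_mod Q (fun n => cabs (b n) ^+ 2 / 2).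
  by move=> n; rewrite /b dilated_mean_periodic.
rewrite big_split /= !(sum_periodic_addr _ pb) -big_split /=.
by apply: eq_le; apply: eq_bigr => n _; rewrite -splitr.
Qed.

End OffDiagonal.

(** * The propagation property in terms of truncations *)

Section Propagation.
Context {R : realType}.
Variables (q : nat) (f : nat -> R[i]) (K : R).
Hypothesis q2 : (2 <= q)%N.
Hypothesis fU : forall n, cabs (f n) = 1.

(** The factor [q^(log rho)] lost in the propagation bound, that is, [rho^(log q)]; at [rho = 0] it
    is 1, because [ln 0 = 0]. *)
Definition weight (rho : nat) : R := q%:R `^ ln rho%:R.

Hypothesis K1 : 1 <= K.
Hypothesis propK : forall lam kap rho, (rho < lam)%N ->
  #|propagation_exceptions q f lam kap rho|%:R
  <= K * weight rho * (q ^ lam)%:R / (q ^ rho)%:R.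

Lemma q_gt0 : (0 < q)%N. Proof. exact: leq_trans q2. Qed.

Lemma expq_gt0 n : (0 < q ^ n)%N. Proof. by rewrite expn_gt0 q_gt0. Qed.

Lemma expqR_gt0 n : 0 < (q ^ n)%:R :> R. Proof. by rewrite ltr0n expq_gt0. Qed.

Lemma expqR_neq0 n : (q ^ n)%:R != 0 :> R. Proof. by rewrite gt_eqF ?expqR_gt0. Qed.

Lemma weight_ge1 rho : 1 <= weight rho.
Proof.
rewrite /weight; have q1 : 1 <= q%:R :> R by rewrite ler1n q_gt0.
case: rho => [|rho]; first by rewrite ln0 // powRr0.
by rewrite -[leLHS](powRr0 (q%:R : R)) ler_powR // ln_ge0 // ler1n.
Qed.

Lemma weight_le rho1 rho2 : (rho1 <= rho2)%N -> weight rho1 <= weight rho2.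
Proof.
move=> le12; case: rho1 le12 => [|rho1] le12.
  by rewrite {1}/weight ln0 // powRr0 weight_ge1.
rewrite /weight ler_powR ?ler1n ?q_gt0 // ler_ln ?posrE ?ltr0n ?ler_nat //.
exact: leq_trans le12.
Qed.

(** A predicate on [nat], false outside [[0, q ^ lam)], so that quotients such as [X %/ q ^ kap] can
    be tested without being packed as ordinals. *)
Definition exceptional lam kap rho (l : nat) : bool :=
  [exists l' : 'I_(q ^ lam), (l' == l :> nat) && (l' \in propagation_exceptions q f lam kap rho)].

Lemma exceptional_card lam kap rho :
  \sum_(l < q ^ lam) (exceptional lam kap rho l)%:R =
  #|propagation_exceptions q f lam kap rho|%:R :> R.
Proof.
rewrite -natr_sum -sum1_card [in RHS]big_mkcond /=; congr (_%:R).
apply: eq_bigr => l _; rewrite /exceptional.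
case: (boolP (l \in _)) => lE.
  by rewrite (_ : [exists _, _] = true) //; apply/existsP; exists l; rewrite eqxx.
rewrite (_ : [exists _, _] = false) //; apply/negbTE/existsPn => l'.
by apply/negP => /andP[/eqP/val_inj -> lE']; rewrite lE' in lE.
Qed.

Lemma exceptionalN lam kap rho l k1 k2 :
  (l < q ^ lam)%N -> (k1 < q ^ kap)%N -> (k2 < q ^ kap)%N ->
  ~~ exceptional lam kap rho l ->
  f (l * q ^ kap + k1 + k2)%N * cj (f (l * q ^ kap + k1)%N) =
  trunc q f (kap + rho) (l * q ^ kap + k1 + k2) *
  cj (trunc q f (kap + rho) (l * q ^ kap + k1)).
Proof.
move=> lL k1K k2K /existsPn /(_ (Ordinal lL)); rewrite eqxx /= inE.
move=> /existsPn /(_ (Ordinal k1K)) /existsPn /(_ (Ordinal k2K)).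
by rewrite negbK => /eqP.
Qed.

Lemma exceptional_sum lam kap rho : (rho < lam)%N ->
  \sum_(X < q ^ lam * q ^ kap) (exceptional lam kap rho (X %/ q ^ kap))%:R
  <= K * weight rho * (q ^ (lam + kap))%:R / (q ^ rho)%:R :> R.
Proof.
move=> lt_rl.
rewrite (sum_divn (fun l => (exceptional lam kap rho l)%:R : R)) exceptional_card.
rewrite -[_ *+ _]mulr_natr; apply: le_trans (ler_wpM2r _ (propK _ lt_rl)) _ => //.
by rewrite expnD natrM !mulrA [leLHS]mulrAC.
Qed.

Lemma trunc_unit t X : cabs (trunc q f t X) = 1.
Proof. exact: fU. Qed.

Lemma trunc_mod t X Y : X = Y %[mod q ^ t] -> trunc q f t X = trunc q f t Y.
Proof. by rewrite /trunc => ->. Qed.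

Lemma trunc_periodic t : periodic_mod (q ^ t) (trunc q f t).
Proof. by move=> n; rewrite /trunc modn_mod. Qed.

(** The factor gained by the truncation at level [J] when [k] is added. It depends on [X] modulo
    [q ^ J] only, and by [badN], for [J = kap + rho] and [k < q ^ kap], it is also the factor gained
    at every level [t >= J] outside the bad set. *)
Definition delta J k X := trunc q f J (X + k) * cj (trunc q f J X).

Lemma delta_mod J k X Y : X = Y %[mod q ^ J] -> delta J k X = delta J k Y.
Proof.
by move=> XY; rewrite /delta (trunc_mod XY); congr (_ * _); apply: trunc_mod;
   rewrite -modnDml XY modnDml.
Qed.

Lemma delta_unit J k X : cabs (delta J k X) = 1.
Proof. by rewrite /delta cabsM cabsJ !trunc_unit mulr1. Qed.

(** The last block is declared bad as well: from there [X + k] may pass a multiple of [q ^ t], and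
    the truncation would start again at the beginning. *)
Definition bad t kap rho X : bool :=
  let l := ((X %% q ^ t) %/ q ^ kap)%N in
  exceptional (t - kap) kap rho l || (l.+1 == q ^ (t - kap))%N.

Lemma bad_periodic t kap rho : periodic_mod (q ^ t) (fun X => (bad t kap rho X)%:R : R).
Proof. by move=> X; rewrite /bad modn_mod. Qed.

Lemma bad_sum t kap rho : (rho < t - kap)%N ->
  \sum_(X < q ^ t) (bad t kap rho X)%:R <= 2 * (K * weight rho * (q ^ t)%:R / (q ^ rho)%:R) :> R.
Proof.
move=> rt; have kt : (kap <= t)%N by lia.
have tE : (q ^ t = q ^ (t - kap) * q ^ kap)%N by rewrite -expnD subnK.
apply: (@le_trans _ _ (\sum_(X < q ^ t) (exceptional (t - kap) kap rho (X %/ q ^ kap))%:R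
   + \sum_(X < q ^ t) ((X %/ q ^ kap).+1 == q ^ (t - kap))%N%:R)).
  rewrite -big_split; apply: ler_sum => X _; rewrite /bad modn_small //.
  by case: exceptional; case: eqP => /= _; rewrite ?addr0 ?add0r ?lerDl.
rewrite mulr_natl mulr2n; apply: lerD.
  by have := @exceptional_sum (t - kap) kap rho rt; rewrite -tE subnK.
rewrite tE (sum_divn (fun l => ((l.+1 == q ^ (t - kap))%N%:R : R))).
have -> : \sum_(l < q ^ (t - kap)) (l.+1 == q ^ (t - kap))%N%:R = 1 :> R.
  have := expq_gt0 (t - kap); case: (q ^ (t - kap))%N => // n _.
  rewrite big_ord_recr /= eqxx big1 ?add0r // => i _.
  by rewrite eqSS ltn_eqF.
(* The last block has [q ^ kap] elements, at most [q ^ t / q ^ rho] since [rho < t - kap]. *)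
rewrite -tE ler_pdivlMr ?expqR_gt0 // -natrM -expnD.
apply: (@le_trans _ _ (1 * (q ^ t)%:R)).
  by rewrite mul1r ler_nat leq_exp2l //; lia.
rewrite ler_wpM2r // -[leLHS]mulr1; apply: ler_pM => //; exact: weight_ge1.
Qed.

Lemma badN t kap rho X k : (kap + rho <= t)%N -> (k < q ^ kap)%N ->
  ~~ bad t kap rho X ->
  trunc q f t (X + k) = trunc q f t X * delta (kap + rho) k X.
Proof.
move=> Jt kK; rewrite /bad negb_or => /andP[nexc nlast].
have kt : (kap <= t)%N by lia.
set Y := (X %% q ^ t)%N in nexc nlast.
have XY : X = Y %[mod q ^ t] by rewrite /Y modn_mod.
have YJ : X = Y %[mod q ^ (kap + rho)].
  by rewrite /Y modn_dvdm // dvdn_exp2l.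
set l := (Y %/ q ^ kap)%N in nexc nlast.
have YQ : (Y < q ^ t)%N by rewrite ltn_mod expq_gt0.
have tE : (q ^ t = q ^ (t - kap) * q ^ kap)%N by rewrite -expnD subnK.
have lL : (l < q ^ (t - kap))%N by rewrite ltn_divLR ?expq_gt0 // -tE.
have YE : Y = (l * q ^ kap + Y %% q ^ kap)%N by exact: divn_eq.
have YkQ : (Y + k < q ^ t)%N.
  have l2 : (l.+2 <= q ^ (t - kap))%N by rewrite ltn_neqAle nlast.
  apply: leq_trans (_ : l.+2 * q ^ kap <= _)%N; last by rewrite tE leq_mul2r l2 orbT.
  by rewrite {1}YE; apply: block_bound; rewrite ?ltn_mod ?expq_gt0.
have := @exceptionalN _ _ _ _ _ _ lL (ltn_pmod Y (expq_gt0 kap)) kK nexc.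
rewrite -YE => E.
have -> : trunc q f t (X + k) = f (Y + k)%N.
  by rewrite /trunc -modnDml modn_small.
have -> : trunc q f t X = f Y by rewrite /trunc.
rewrite (delta_mod k YJ) /delta -E mulrCA mulcJ fU expr1n mulr1.
by [].
Qed.

Lemma shift_error t kap rho X k : (kap + rho <= t)%N -> (k < q ^ kap)%N ->
  cabs (trunc q f t (X + k) - trunc q f t X * delta (kap + rho) k X)
  <= 2 * (bad t kap rho X)%:R.
Proof.
move=> Jt kK; case: (boolP (bad _ _ _ _)) => [_|/badN ->//]; last by rewrite subrr cabs0 mulr0.
by apply: le_trans (cabsB _ _) _; rewrite cabsM delta_unit !trunc_unit /=; lra.
Qed.

(** * Averaging over the shifts [k / m] *)

Section Shift.
Variables (t kap rho r : nat) (B : nat -> R[i]) (P : pred nat).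
Let Q := (q ^ t)%N.
Let J := (kap + rho)%N.
Let L := (q ^ J)%N.
Hypotheses (J0 : (0 < J)%N) (Jt : (J < t)%N).
Hypotheses (pB : periodic_mod Q B) (B1 : forall n, cabs (B n) <= 1).
Hypothesis PQ : forall m, P m -> coprime m q.

Definition pair_phase m n := trunc q f t (m * n + m * r) * cj (trunc q f t (m * n)).

(** The factor by which [pair_phase] changes, outside the bad set, when [n] moves by [k / m] modulo
    [Q]; it depends on [m] and [n] modulo [L] only. *)
Let W k m n := delta J k (m * n + m * r) * cj (delta J k (m * n)).

Let Q1 : (1 < Q)%N.
Proof. by rewrite /Q -(expn0 q) ltn_exp2l //; lia. Qed.

Let Q0 : (0 < Q)%N. Proof. exact: expq_gt0. Qed.

Let LQ : (L %| Q)%N. Proof. by rewrite dvdn_exp2l //; exact: ltnW. Qed.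

Let qL : (q %| L)%N. Proof. by rewrite /L -{1}(expn1 q) dvdn_exp2l. Qed.

Let copQ m : coprime m q -> coprime m Q. Proof. by move=> c; rewrite coprimeXr. Qed.

Let copqQ m : coprime m Q = coprime m q.
Proof. by rewrite coprime_pexpr //; lia. Qed.

Let W_unit k m n : cabs (W k m n) = 1.
Proof. by rewrite /W cabsM cabsJ !delta_unit mulr1. Qed.

Let W_mod k m m' n n' : m = m' %[mod L] -> n = n' %[mod L] -> W k m n = W k m' n'.
Proof.
move=> mm nn; have E : (m * n = m' * n' %[mod L])%N by rewrite -modnMm mm nn modnMm.
rewrite /W (delta_mod k E); congr (_ * _); apply: delta_mod.
by rewrite -modnDm E -(modnMml m) mm modnMml modnDm.
Qed.

Let D m n := \sum_(k < q ^ kap) W k m n * cj (B (n + k * minv Q m)%N).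

(** Moving [n] by [k * minv Q m] adds [k] to both [m n] and [m (n + r)] modulo [Q]. The inner sum
    equals each of its [q ^ kap] shifted forms, and adding these leaves [D]. The 8 is a product of
    three factors 2: the size of an error at a bad point, the constant in [bad_sum], and the two
    arguments. *)
Lemma shift_single m : coprime m q ->
  (q ^ kap)%:R * cabs (\sum_(n < Q) pair_phase m n * cj (B n)) <=
  (q ^ kap)%:R * (8 * (K * weight rho * Q%:R / (q ^ rho)%:R)) + \sum_(n < Q) cabs (D m n).
Proof.
move=> cm; have cmQ := copQ cm.
pose G n := pair_phase m n * cj (B n).
have Gk k : \sum_(n < Q) G n = \sum_(n < Q)
    trunc q f t (m * n + m * r + k) * cj (trunc q f t (m * n + k)) * cj (B (n + k * minv Q m)%N).
  have pG : periodic_mod Q G.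
    move=> n; rewrite /G /pair_phase pB; congr (_ * cj _ * _); apply: trunc_mod;
    by rewrite ?[in LHS]modnMmr // -modnDml modnMmr modnDml.
  rewrite -(sum_periodic_addr (k * minv Q m) pG); apply: eq_bigr => n _.
  have E : (m * (n + k * minv Q m) = m * n + k %[mod Q])%N.
    rewrite mulnDr mulnCA -modnDmr -modnMmr minvP // modnMmr muln1 modnDmr.
    by [].
  rewrite /G /pair_phase; congr (_ * cj _ * _); apply: trunc_mod => //.
  by rewrite -modnDml E modnDml addnAC.
pose bd n := (bad t kap rho (m * n + m * r))%:R + (bad t kap rho (m * n))%:R : R.
have bdS : \sum_(n < Q) bd n <= 4 * (K * weight rho * Q%:R / (q ^ rho)%:R).
  have rt : (rho < t - kap)%N by move: Jt; rewrite /J; lia.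
  rewrite big_split /= (_ : 4 = 2 + 2); last by lra.
  rewrite mulrDl; have pbd := @bad_periodic t kap rho.
  apply: lerD; apply: le_trans (bad_sum rt); rewrite -(sum_periodic_mul cmQ pbd) //.
  have pb' : periodic_mod Q (fun n => (bad t kap rho (m * n))%:R : R).
    by move=> n; apply: (periodicP pbd); rewrite modnMmr.
  rewrite -(sum_periodic_addr r pb') le_eqVlt; apply/orP; left; apply/eqP.
  by apply: eq_bigr => n _; rewrite mulnDr.
have -> : (q ^ kap)%:R * cabs (\sum_(n < Q) G n) = cabs (\sum_(k < q ^ kap) \sum_(n < Q) G n).
  by rewrite cabs_sum_const.
under eq_bigr => k _ do rewrite (Gk k).
apply: (@le_trans _ _ (cabs (\sum_(k < q ^ kap) \sum_(n < Q)
    pair_phase m n * (W k m n * cj (B (n + k * minv Q m)%N))) +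
   \sum_(k < q ^ kap) \sum_(n < Q) 2 * bd n)).
  set S1 := \sum_(k < q ^ kap) \sum_(n < Q) pair_phase m n * _.
  apply: le_trans (cabs_le_add _ S1) _; rewrite lerD2l /S1.
  rewrite -sumrB; apply: le_trans (cabs_sum _ _ _) _; apply: ler_sum => k _.
  rewrite -sumrB; apply: le_trans (cabs_sum _ _ _) _; apply: ler_sum => n _.
  rewrite mulrA -mulrBl cabsM cabsJ.
  apply: le_trans (ler_wpM2l (cabs_ge0 _) (B1 _)) _; rewrite mulr1.
  rewrite /pair_phase /W /bd.
  set X := (m * n)%N; set Y := (X + m * r)%N.
  have -> : trunc q f t (Y + k) * cj (trunc q f t (X + k)) -
      trunc q f t Y * cj (trunc q f t X) * (delta J k Y * cj (delta J k X)) =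
    (trunc q f t (Y + k) - trunc q f t Y * delta J k Y) * cj (trunc q f t (X + k)) +
    (trunc q f t Y * delta J k Y) * cj (trunc q f t (X + k) - trunc q f t X * delta J k X).
    by rewrite rmorphB /= !conjcM; ring.
  apply: le_trans (cabs_perturb _ _ (trunc_unit _ _) (trunc_unit _ _) (delta_unit _ _ _)) _; rewrite mulrDr.
  by apply: lerD; apply: shift_error => //; exact: ltnW.
rewrite addrC; apply: lerD.
  rewrite sumr_const card_ord -[_ *+ _]mulr_natl ler_pM2l ?expqR_gt0 // -mulr_sumr.
  by move: bdS; lra.
rewrite exchange_big; apply: le_trans (cabs_sum _ _ _) _; apply: ler_sum => n _.
by rewrite -mulr_sumr cabsM /pair_phase cabsM cabsJ !trunc_unit !mul1r.
Qed.

Variable Pmax : R.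
Hypothesis Pm0 : 0 <= Pmax.
Hypothesis PmaxP : forall k, (0 < k < q ^ kap)%N ->
  \sum_(n < Q) cabs (dilated_mean Q B (L * k) n) ^+ 2 <= Pmax.

Let SB := \sum_(n < Q) cabs (B n) ^+ 2.

Let T k1 k2 := \sum_(m < Q | coprime m q) \sum_(n < Q)
  (W k1 m n * cj (W k2 m n)) * (cj (B (n + k1 * minv Q m)%N) * B (n + k2 * minv Q m)%N).

Let TC k1 k2 : T k2 k1 = cj (T k1 k2).
Proof.
rewrite /T sum_conjc; apply: eq_bigr => m _; rewrite sum_conjc; apply: eq_bigr => n _.
by rewrite conj_quad.
Qed.

Let Tdiag k : cabs (T k k) <= Q%:R * SB.
Proof.
rewrite /T big_mkcond /=; apply: le_trans (cabs_sum _ _ _) _; apply: ler_sum_ord => m.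
have SB0 : 0 <= SB by apply: sumr_ge0 => n _; rewrite sqr_ge0.
case: ifP => _; last by rewrite cabs0.
apply: le_trans (cabs_sum _ _ _) _.
have pB2 : periodic_mod Q (fun n => cabs (B n) ^+ 2) by move=> n; rewrite pB.
rewrite /SB -(sum_periodic_addr (k * minv Q m) pB2); apply: ler_sum => n _.
by rewrite cabs_quad !W_unit !mul1r expr2.
Qed.

Let Toff k1 k2 : (k1 < k2)%N -> (k2 < q ^ kap)%N -> cabs (T k1 k2) <= Q%:R * Pmax.
Proof.
move=> k12 k2K.
(* The inverse of [m] becomes the variable [i], so that the shifts [k1 * i] and [k2 * i] are linear
   in it. The factor [U] sees [i] through its inverse, which modulo [L] depends on [i] modulo [L]
   only, as [off_diagonal] requires. *)
pose U i n := if coprime i q then W k1 (minv Q (i %% Q)) n * cj (W k2 (minv Q (i %% Q)) n) else 0.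
have -> : T k1 k2 = \sum_(i < Q) \sum_(n < Q) U i n * (cj (B (n + k1 * i)%N) * B (n + k2 * i)%N).
  rewrite /T big_mkcond /=.
  pose h (i : 'I_Q) : 'I_Q := Ordinal (minv_lt (ltn_ord i)).
  have hK : involutive h by move=> i; apply: val_inj; rewrite /= minvK.
  rewrite (reindex_inj (inv_inj hK)) /=; apply: eq_bigr => i _.
  have -> : coprime (minv Q i) q = coprime i q.
    rewrite -!copqQ; case ci: (coprime i Q); first by rewrite minv_coprime.
    by rewrite /minv ci ci.
  case: ifP => ci; last by rewrite big1 // => n _; rewrite /U ci mul0r.
  by apply: eq_bigr => n _; rewrite /U ci minvK // modn_small.
apply: le_trans (@off_diagonal R Q B Q0 pB U L k1 k2 (ltnW k12) _ _ _ _ _) _.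
- move=> n i; rewrite /U modn_mod; congr (if _ then _ else _).
  by rewrite -copqQ coprime_modl copqQ.
- move=> i n; rewrite /U; case: ifP => // _.
  by congr (_ * cj _); apply: W_mod => //; rewrite modn_dvdm.
- move=> i j n; rewrite /U.
  have -> : coprime (i + L * j) q = coprime i q.
    by rewrite -coprime_modl -modnDmr -modnMml (eqP qL) mul0n mod0n addn0 coprime_modl.
  case: ifP => // ci; have E : minv Q ((i + L * j) %% Q) = minv Q (i %% Q) %[mod L].
    have cL : coprime i L by rewrite coprimeXr.
    have ciL : coprime ((i + L * j) %% Q) Q.
      rewrite coprime_modl copqQ -coprime_modl -modnDmr -modnMml (eqP qL).
      by rewrite mul0n mod0n addn0 coprime_modl.
    have ciQ : coprime (i %% Q) Q by rewrite coprime_modl copqQ.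
    apply: (mul_cancel_mod cL).
    have E1 := minvP Q1 ciL; have E2 := minvP Q1 ciQ.
    have E1' : ((i + L * j) %% Q * minv Q ((i + L * j) %% Q) = 1 %[mod L])%N.
      by rewrite -(modn_dvdm _ LQ) E1 modn_dvdm.
    have E2' : (i %% Q * minv Q (i %% Q) = 1 %[mod L])%N.
      by rewrite -(modn_dvdm _ LQ) E2 modn_dvdm.
    rewrite -modnMml (_ : i %% L = (i + L * j) %% Q %% L)%N; last first.
      by rewrite modn_dvdm // addnC mulnC modnMDl.
    rewrite modnMml E1' -E2' -[RHS]modnMml -[in LHS]modnMml.
    by congr ((_ * _) %% _)%N; rewrite modn_dvdm.
  by congr (_ * cj _); apply: W_mod.
- move=> i j n; rewrite /U; case: ifP => // _.
  by congr (_ * cj _); apply: W_mod => //; rewrite addnC mulnC modnMDl.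
- move=> i n; rewrite /U; case: ifP => _; last by rewrite cabs0.
  by rewrite cabsM cabsJ !W_unit mulr1.
rewrite ler_wpM2l //; apply: PmaxP; rewrite subn_gt0 k12 /=.
exact: leq_ltn_trans (leq_subr _ _) k2K.
Qed.

(** Expanding the square gives a double sum over [k1], [k2]: the [q ^ kap] diagonal terms cost the
    norm of [B], and the others are averages of [B] along progressions of step [L * (k2 - k1)],
    hence [Pmax]. *)
Lemma shift_square :
  \sum_(m < Q | coprime m q) \sum_(n < Q) cabs (D m n) ^+ 2
  <= Q%:R * ((q ^ kap)%:R * SB + (q ^ kap)%:R ^+ 2 * Pmax).
Proof.
have SB0 : 0 <= SB by apply: sumr_ge0 => n _; rewrite sqr_ge0.
have E : (\sum_(m < Q | coprime m q) \sum_(n < Q) cabs (D m n) ^+ 2)%:C =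
    \sum_(k1 < q ^ kap) \sum_(k2 < q ^ kap) T k1 k2.
  rewrite sum_realC.
  under eq_bigr => m _.
    rewrite sum_realC; under eq_bigr => n _ do rewrite cabs_sum_sqr.
    rewrite exchange_big /=; under eq_bigr => k1 _ do rewrite exchange_big /=.
    over.
  rewrite exchange_big /=; apply: eq_bigr => k1 _; rewrite exchange_big /=.
  apply: eq_bigr => k2 _; apply: eq_bigr => m _; apply: eq_bigr => n _.
  exact: mul_conj_pair.
have S0 : 0 <= \sum_(m < Q | coprime m q) \sum_(n < Q) cabs (D m n) ^+ 2.
  by apply: sumr_ge0 => m _; apply: sumr_ge0 => n _; rewrite sqr_ge0.
rewrite -(cabs_real_ge0 S0) E; apply: le_trans (cabs_sum _ _ _) _.
rewrite (_ : Q%:R * _ = (q ^ kap)%:R * (Q%:R * (SB + (q ^ kap)%:R * Pmax))); last by ring.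
apply: ler_sum_ord => k1'; apply: le_trans (cabs_sum _ _ _) _.
rewrite (bigD1 k1') //= mulrDr; apply: lerD; first exact: Tdiag.
apply: (@le_trans _ _ (\sum_(k2 < q ^ kap) Q%:R * Pmax)); last first.
  by rewrite sumr_const card_ord -[_ *+ _]mulr_natl mulrCA.
rewrite [leRHS](bigD1 k1') //= -[leLHS]add0r; apply: lerD; first by rewrite mulr_ge0.
apply: ler_sum => k2 k21; case: (ltngtP k1' k2) => [lt|lt|/val_inj E'].
- exact: Toff.
- by rewrite TC cabsJ; exact: Toff.
- by rewrite E' eqxx in k21.
Qed.


(** Cauchy-Schwarz in [m] and [n] brings in [shift_square]. The main term is delivered as a [Y] with
    a bound on [Y ^+ 2], because in the type II case [SB] is itself the unknown. *)
Lemma shift_bound (em : nat -> R[i]) (M := \sum_(m < Q | P m) (1 : R)) :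
  (forall m, cabs (em m) <= 1) ->
  exists Y, [/\ 0 <= Y, Y ^+ 2 <= M * Q%:R * (Q%:R * (SB / (q ^ kap)%:R + Pmax)) &
  cabs (\sum_(m < Q | P m) em m * \sum_(n < Q) pair_phase m n * cj (B n))
  <= M * (8 * (K * weight rho * Q%:R / (q ^ rho)%:R)) + Y].
Proof.
move=> em1; have A0 := expqR_gt0 kap; set A := (q ^ kap)%:R in A0 *.
pose S m := \sum_(n < Q) cabs (D m n).
exists (A^-1 * \sum_(m < Q | P m) S m).
have S0 m : 0 <= S m by apply: sumr_ge0 => n _; exact: cabs_ge0.
have SS0 : 0 <= \sum_(m < Q | P m) S m by exact: sumr_ge0.
split.
- by rewrite mulr_ge0 // invr_ge0 ltW.
- rewrite exprMn exprVn mulrC ler_pdivrMr ?exprn_gt0 //.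
  have M0 : 0 <= M by exact: sumr_ge0.
  apply: (@le_trans _ _ (M * (Q%:R * \sum_(m < Q | coprime m q) \sum_(n < Q) cabs (D m n) ^+ 2))).
    have := sqr_sum_le (index_enum 'I_Q) P (fun=> 1) S.
    under [in X in X <= _]eq_bigr do rewrite mul1r.
    rewrite expr1n => /le_trans; apply; rewrite ler_wpM2l // mulr_sumr.
    rewrite big_mkcond [leRHS]big_mkcond /=; apply: ler_sum => m _.
    case: ifP => [Pm|_]; last first.
      by case: ifP => // _; rewrite mulr_ge0 //; apply: sumr_ge0 => n _; rewrite sqr_ge0.
    rewrite (PQ Pm).
    have := sqr_sum_le (index_enum 'I_Q) xpredT (fun=> 1) (fun n => cabs (D m n)).
    under [in X in X <= _]eq_bigr do rewrite mul1r.
    by rewrite expr1n sumr_const card_ord.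
  rewrite -!mulrA ler_wpM2l // ler_wpM2l //.
  apply: le_trans shift_square _; rewrite ler_wpM2l //.
  by apply: eq_le; rewrite -/A; field; rewrite gt_eqF.
- apply: le_trans (cabs_sum _ _ _) _.
  rewrite mulr_suml mulr_sumr -big_split /=; apply: ler_sum => m Pm.
  rewrite mul1r cabsM; apply: le_trans (ler_wpM2r (cabs_ge0 _) (em1 _)) _; rewrite mul1r.
  by rewrite -(ler_pM2l A0) mulrDr mulVKf ?gt_eqF //; exact: shift_single (PQ Pm).
Qed.

End Shift.

(** * Energy of correlations along progressions *)

Section Correlation.
Variables (t rho c : nat).
Let Q := (q ^ t)%N.
Hypotheses (rt : (rho.+1 < t)%N) (Lc : (q ^ rho.+1 %| c)%N) (c0 : (0 < c)%N).

(** The truncation with its last digit set to zero. Its values are those of [f (q * l)], to which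
    the Fourier property with [kappa = 1] applies. *)
Definition coarse X := f (q * ((X %% q ^ t) %/ q)).

Definition corr (g : nat -> R[i]) a X :=
  Q%:R^-1 * \sum_(j < Q) g (X + a + c * j)%N * cj (g (X + c * j)%N).

Definition corr_energy g a : R := Q%:R^-1 * \sum_(X < Q) cabs (corr g a X) ^+ 2.

Let Q0 : (0 < Q)%N. Proof. exact: expq_gt0. Qed.
Let QR0 : 0 < (Q%:R : R). Proof. by rewrite ltr0n. Qed.

(** The contribution of the last digit: propagation with [kap = 1], started at a multiple of [q],
    says that [trunc q f t X] is [coarse X * h X] outside [exc], and [h] sees only [rho.+1]
    digits. *)
Let h X := trunc q f rho.+1 X * cj (trunc q f rho.+1 (q * (X %/ q))).

Let h_mod X Y : X = Y %[mod q ^ rho.+1] -> h X = h Y.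
Proof.
move=> XY; rewrite /h (trunc_mod XY); congr (_ * cj _); apply: trunc_mod.
have E Z : (q * (Z %/ q) %% q ^ rho.+1 = q * ((Z %% q ^ rho.+1) %/ q))%N.
  by rewrite expnS -muln_modr modn_divl [(_ * q)%N]mulnC.
by rewrite !E XY.
Qed.

Let h_unit X : cabs (h X) = 1.
Proof. by rewrite /h cabsM cabsJ !trunc_unit mulr1. Qed.

Let exc X := exceptional t.-1 1 rho ((X %% Q) %/ q).

Let tE : (Q = q ^ t.-1 * q ^ 1)%N.
Proof. by rewrite -expnD addn1 prednK //; lia. Qed.

Let exc_sum : \sum_(X < Q) (exc X)%:R <= K * weight rho * Q%:R / (q ^ rho)%:R :> R.
Proof.
have r1 : (rho < t.-1)%N by lia.
have := @exceptional_sum t.-1 1 rho r1; rewrite -expnD addn1 prednK; last by lia.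
apply: le_trans; rewrite le_eqVlt; apply/orP; left; apply/eqP.
by apply: eq_bigr => X _; rewrite /exc modn_small // expn1.
Qed.

Let eps X := trunc q f t X - coarse X * h X.

Let eps_le X : cabs (eps X) <= 2 * (exc X)%:R.
Proof.
rewrite /eps; case: (boolP (exc X)) => [_|nexc].
  by apply: le_trans (cabsB _ _) _; rewrite cabsM h_unit trunc_unit /coarse fU /=; lra.
rewrite mulr0; set Y := (X %% Q)%N.
have YQ : (Y < Q)%N by rewrite ltn_mod.
have lL : (Y %/ q < q ^ t.-1)%N by rewrite ltn_divLR ?q_gt0 // -{2}(expn1 q) -tE.
have k0 : (0 < q ^ 1)%N by exact: expq_gt0.
have k2 : (Y %% q < q ^ 1)%N by rewrite expn1 ltn_mod q_gt0.
have := @exceptionalN _ _ _ _ _ _ lL k0 k2 nexc.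
rewrite addn0 expn1 -divn_eq add1n => E.
have XY : X = Y %[mod q ^ rho.+1] by rewrite /Y modn_dvdm // dvdn_exp2l //; exact: ltnW.
rewrite (h_mod XY) /coarse -/Q -/Y /h [(q * _)%N]mulnC.
have -> : trunc q f t X = f Y by [].
by rewrite -E mulrCA mulcJ fU expr1n mulr1 subrr cabs0.
Qed.

Let eps_periodic : periodic_mod Q (fun X => cabs (eps X) ^+ 2).
Proof.
move=> X; rewrite /eps /coarse -/Q modn_mod (trunc_periodic t X).
by rewrite (h_mod (X := X %% Q) (Y := X)) // modn_dvdm // dvdn_exp2l //; exact: ltnW.
Qed.

Let eps_sum : \sum_(X < Q) cabs (eps X) ^+ 2 <= 4 * (K * weight rho * Q%:R / (q ^ rho)%:R).
Proof.
apply: le_trans (ler_wpM2l _ exc_sum) => //; rewrite mulr_sumr; apply: ler_sum => X _.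
have := eps_le X; have := cabs_ge0 (eps X); case: (exc X) => /=; nra.
Qed.

(** Since [c] is a multiple of [q ^ rho.+1], [h] is constant along each progression and factors out
    of the correlation with modulus one; only [eps] is paid for. The constant is [32 = 2 * 4 * 4]:
    from squaring a sum, from the two error terms, and from [cabs (eps X) <= 2]. *)
Lemma corr_energy_le a :
  corr_energy (trunc q f t) a <=
  2 * corr_energy coarse a + 32 * (K * weight rho / (q ^ rho)%:R).
Proof.
rewrite /corr_energy -(ler_pM2l QR0) mulrDr mulVKf ?gt_eqF // [X in X + _]mulrCA mulVKf ?gt_eqF //.
pose er X := Q%:R^-1 * \sum_(j < Q) (cabs (eps (X + a + c * j)%N) + cabs (eps (X + c * j)%N)).
have hc X j : h (X + c * j)%N = h X.
  apply: h_mod; have /dvdnP[d ->] := Lc.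
  by rewrite mulnAC addnC modnMDl.
have step X : cabs (corr (trunc q f t) a X) <= cabs (corr coarse a X) + er X.
  have -> : corr (trunc q f t) a X = h (X + a) * cj (h X) * corr coarse a X +
    Q%:R^-1 * \sum_(j < Q) (eps (X + a + c * j)%N * cj (trunc q f t (X + c * j)) +
       coarse (X + a + c * j)%N * h (X + a + c * j)%N * cj (eps (X + c * j)%N)).
    rewrite /corr mulrCA -mulrDr; congr (_ * _).
    rewrite mulr_sumr -big_split; apply: eq_bigr => j _ /=.
    by rewrite !hc; rewrite [LHS](mul_conj_perturb _ _ (coarse (X + a + c * j)) (coarse (X + c * j)) (h (X + a)) (h X)) /eps !hc.
  apply: le_trans (cabsD _ _) _.
  have -> : cabs (h (X + a) * cj (h X) * corr coarse a X) = cabs (corr coarse a X).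
    rewrite cabsM (_ : cabs (h (X + a) * cj (h X)) = 1) ?mul1r //.
    by rewrite cabsM cabsJ !h_unit mulr1.
  rewrite lerD2l /er cabsM cabsV cabs_nat ler_pM2l ?invr_gt0 //.
  apply: le_trans (cabs_sum _ _ _) _; apply: ler_sum => j _.
  apply: le_trans (cabsD _ _) _.
  rewrite [cabs (eps _ * _)]cabsM [cabs (_ * cj (eps _))]cabsM [cabs (coarse _ * h _)]cabsM.
  by rewrite !cabsJ trunc_unit h_unit /coarse fU !mulr1 mul1r.
have er2 X : er X ^+ 2 <= Q%:R^-1 * \sum_(j < Q)
    (2 * cabs (eps (X + a + c * j)%N) ^+ 2 + 2 * cabs (eps (X + c * j)%N) ^+ 2).
  rewrite /er exprMn expr2 -mulrA ler_pM2l ?invr_gt0 // mulrC ler_pdivrMr //.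
  have := sqr_sum_le (index_enum 'I_Q) xpredT (fun=> 1)
    (fun j : 'I_Q => cabs (eps (X + a + c * j)%N) + cabs (eps (X + c * j)%N)).
  under [in X in X <= _]eq_bigr do rewrite mul1r.
  rewrite expr1n sumr_const card_ord => /le_trans; apply.
  rewrite mulrC ler_wpM2r //; apply: ler_sum => j _.
  set x := cabs _; set y := cabs _; have := sqr_ge0 (x - y); nra.
apply: (@le_trans _ _ (\sum_(X < Q) (2 * cabs (corr coarse a X) ^+ 2 + 2 * er X ^+ 2))).
  apply: ler_sum => X _; have := step X; have := cabs_ge0 (corr (trunc q f t) a X).
  by move=> x0 xyz; exact: sqr_le_add.
rewrite big_split /= -!mulr_sumr lerD2l.
have : \sum_(X < Q) er X ^+ 2 <= \sum_(X < Q) 4 * cabs (eps X) ^+ 2.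
  apply: (@le_trans _ _ (\sum_(X < Q) Q%:R^-1 * \sum_(j < Q)
    (2 * cabs (eps (X + a + c * j)%N) ^+ 2 + 2 * cabs (eps (X + c * j)%N) ^+ 2))).
    by apply: ler_sum => X _; exact: er2.
  rewrite -mulr_sumr exchange_big /= mulrC ler_pdivrMr // mulrC; apply: ler_sum_ord => j.
  pose p2 X := 2 * cabs (eps X) ^+ 2.
  have pp : periodic_mod Q p2 by move=> X; rewrite /p2 eps_periodic.
  have := sum_periodic_addr (a + c * j) pp; have := sum_periodic_addr (c * j) pp.
  rewrite big_split /= /p2 => E1 E2.
  under eq_bigr => X _ do rewrite -addnA.
  by rewrite E1 E2 -mulr_sumr -mulr_sumr -mulrDl; lra.
rewrite -mulr_sumr => er4; have := eps_sum.
have -> : Q%:R * (32 * (K * weight rho / (q ^ rho)%:R)) =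
  32 * (K * weight rho * Q%:R / (q ^ rho)%:R) by ring.
lra.
Qed.

Variable Mf : R.
Hypothesis MfP : forall x : R,
  cabs (\sum_(l < q ^ t.-1) f (q * l)%N * e (- (l%:R * x))) <= Mf * (q ^ t.-1)%:R.

Lemma coarse_periodic : periodic_mod Q coarse.
Proof. by move=> X; rewrite /coarse modn_mod. Qed.

(** Writing [X = l q + i] separates the digit [i], of which [coarse] is independent, and leaves [q]
    twisted sums over [f (q * l)]. *)
Lemma coarse_fourier k :
  cabs (\sum_(X < Q) coarse X * cj (e ((k * X)%:R / Q%:R : R))) <= Mf * Q%:R.
Proof.
have QE : (Q = q ^ t.-1 * q)%N by rewrite tE expn1.
have -> : \sum_(X < Q) coarse X * cj (e ((k * X)%:R / Q%:R : R)) =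
  \sum_(i < q) e (- ((k * i)%:R / Q%:R)) *
    \sum_(l < q ^ t.-1) f (q * l)%N * e (- (l%:R * ((k * q)%:R / Q%:R))).
  pose F X := coarse X * cj (e ((k * X)%:R / Q%:R : R)).
  transitivity (\sum_(X < q ^ t.-1 * q) F X); first by rewrite -QE.
  rewrite (sum_mul F) exchange_big /=; apply: eq_bigr => i _.
  rewrite mulr_sumr; apply: eq_bigr => l _; rewrite /F /coarse -/Q modn_small; last first.
    rewrite QE; have := ltn_ord l; have := ltn_ord i.
    by move: (q ^ t.-1)%N (nat_of_ord l) (nat_of_ord i) => A l' i' i'q lA; nia.
  rewrite divnMDl ?q_gt0 // divn_small // addn0 conj_e mulrCA -eD; congr (_ * e _).
  by rewrite mulnDr natrD !natrM; field; rewrite gt_eqF // ltr0n q_gt0.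
apply: le_trans (cabs_sum _ _ _) _.
have -> : Mf * Q%:R = q%:R * (Mf * (q ^ t.-1)%:R) by rewrite QE natrM; ring.
apply: ler_sum_ord => i.
by rewrite cabsM cabs_e mul1r; exact: MfP.
Qed.

(** Summed over [a], the arguments [X + a] and [X] become independent, and opening the square over
    [j], [k] gives the squared modulus of the full autocorrelation [C] at [c (j - k)]. The dilation
    costs the factor [c], and the rest is [autocorrelation_l2]. *)
Lemma corr_energy_sum : \sum_(a < Q) corr_energy coarse a <= Q%:R * c%:R * Mf ^+ 2.
Proof.
pose C a := \sum_(X < Q) coarse (X + a)%N * cj (coarse X).
have pco := coarse_periodic.
have pC : periodic_mod Q (fun a => cabs (C a) ^+ 2).
  move=> a; congr (cabs _ ^+ 2); apply: eq_bigr => X _; congr (_ * _).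
  by apply: (periodicP pco); rewrite modnDmr.
(* Here again [Q.-1 * k] stands for [- k] modulo [Q]. *)
have CC j k : \sum_(X < Q) coarse (X + c * j)%N * cj (coarse (X + c * k)%N) =
    C (c * (j + Q.-1 * k))%N.
  pose F X := coarse (X + c * j)%N * cj (coarse (X + c * k)%N).
  have pF : periodic_mod Q F.
    by move=> X; congr (_ * cj _); apply: (periodicP pco); rewrite modnDml.
  rewrite -(sum_periodic_addr (Q.-1 * (c * k)) pF); apply: eq_bigr => X _.
  congr (_ * cj _); apply: (periodicP pco).
    by congr (_ %% _)%N; lia.
  by rewrite -addnA predn_mul // addnC modnMDl.
have E : \sum_(a < Q) corr_energy coarse a = Q%:R ^- 2 * \sum_(j < Q) cabs (C (c * j)%N) ^+ 2.
  rewrite /corr_energy -mulr_sumr exchange_big /=.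
  have -> : \sum_(X < Q) \sum_(a < Q) cabs (corr coarse a X) ^+ 2 =
     Q%:R ^- 2 * \sum_(X < Q) \sum_(Y < Q) cabs (\sum_(j < Q) coarse (Y + c * j)%N * cj (coarse (X + c * j)%N)) ^+ 2.
    rewrite mulr_sumr; apply: eq_bigr => X _; rewrite mulr_sumr.
    pose F Y := Q%:R ^- 2 * cabs (\sum_(j < Q) coarse (Y + c * j)%N * cj (coarse (X + c * j)%N)) ^+ 2.
    have pF : periodic_mod Q F.
      move=> Y; congr (_ * cabs _ ^+ 2); apply: eq_bigr => j _; congr (_ * _).
      by apply: (periodicP pco); rewrite modnDml.
    rewrite -[RHS](sum_periodic_addr X pF); apply: eq_bigr => a _.
    rewrite /F /corr cabsM cabsV cabs_nat exprMn exprVn; congr (_ * cabs _ ^+ 2).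
    by apply: eq_bigr => j _; rewrite [(a + X)%N]addnC.
  have -> : \sum_(X < Q) \sum_(Y < Q) cabs (\sum_(j < Q) coarse (Y + c * j)%N * cj (coarse (X + c * j)%N)) ^+ 2
     = \sum_(j < Q) \sum_(k < Q) cabs (C (c * (j + Q.-1 * k))%N) ^+ 2.
    apply: (@complexI R); rewrite !sum_realC.
    under eq_bigr => X _.
      rewrite sum_realC; under eq_bigr => Y _ do rewrite cabs_sum_sqr.
      over.
    rewrite exchange_big /=.
    under eq_bigr => Y _.
      rewrite exchange_big /=; under eq_bigr => j _ do rewrite exchange_big /=.
      over.
    rewrite exchange_big /=; apply: eq_bigr => j _.
    rewrite exchange_big /= sum_realC; apply: eq_bigr => k _.
    rewrite -mulcJ -CC sum_conjc big_distrlr /=.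
    apply: eq_bigr => Y _; apply: eq_bigr => X _.
    by rewrite !conjcM !conjcK; ring.
  rewrite exchange_big /=.
  have -> : \sum_(k < Q) \sum_(j < Q) cabs (C (c * (j + Q.-1 * k))%N) ^+ 2 =
      Q%:R * \sum_(j < Q) cabs (C (c * j)%N) ^+ 2.
    pose F j := cabs (C (c * j)%N) ^+ 2.
    have pF : periodic_mod Q F.
      by move=> j; rewrite /F; apply: (periodicP pC); rewrite modnMmr.
    under eq_bigr => k _ do rewrite (sum_periodic_addr (Q.-1 * k) pF).
    by rewrite sumr_const card_ord -[_ *+ Q]mulr_natl.
  by field; rewrite gt_eqF.
rewrite E mulrC ler_pdivrMr ?exprn_gt0 //.
apply: le_trans (sum_dilate_le Q0 c0 pC _) _; first by move=> n; rewrite sqr_ge0.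
have := @autocorrelation_l2 R Q Q0 coarse Mf pco _ coarse_fourier.
move=> /(_ (fun n => _)); rewrite -/C => H.
have {}H : \sum_(a < Q) cabs (C a) ^+ 2 <= Q%:R ^+ 3 * Mf ^+ 2.
  by apply: H => n; rewrite /coarse fU.
by apply: le_trans (ler_wpM2l _ H) _ => //; apply: eq_le; ring.
Qed.

End Correlation.
End Propagation.

(** * Van der Corput differencing *)

Section SumTools.
Variable V : zmodType.

Lemma sum_ord_shift (F : nat -> V) r v w : (v + r <= w)%N ->
  (forall n, (v <= n)%N -> F n = 0) ->
  \sum_(n < w) (if (r <= n)%N then F (n - r)%N else 0) = \sum_(n < v) F n.
Proof.
move=> vrw F0; rewrite -(big_mkord xpredT (fun n => if (r <= n)%N then F (n - r)%N else 0)).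
rewrite (big_cat_nat (n := r)) //=; last by lia.
rewrite big_nat_cond big1 ?add0r; last by move=> n /andP[/andP[_ nr] _]; rewrite leqNgt nr.
rewrite -{1}[r]add0n big_addn (big_cat_nat (n := v)) //=; last by lia.
rewrite [X in _ + X]big_nat_cond [X in _ + X]big1 ?addr0; last first.
  by move=> n /andP[/andP[vn _] _]; rewrite leq_addl addnK F0.
by rewrite big_mkord; apply: eq_bigr => n _; rewrite leq_addl addnK.
Qed.

Lemma sum_multiples (F : nat -> V) Y a : (0 < a)%N ->
  (forall n, (Y <= n)%N -> F n = 0) ->
  \sum_(k < Y | (0 < k)%N) F (a * k)%N = \sum_(n < Y | (0 < n)%N && (a %| n)%N) F n.
Proof.
move=> a0 F0.
transitivity (\sum_(k < Y | (0 < k)%N) \sum_(n < Y | (n == a * k :> nat)%N) F n).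
  apply: eq_bigr => k k0; case: (ltnP (a * k) Y) => akY.
    rewrite (bigD1 (Ordinal akY)) //= big1 ?addr0 // => n /andP[/eqP E]; case/eqP.
    by apply: val_inj.
  rewrite F0 // big1 // => n /eqP E; apply: F0; rewrite E.
  by [].
rewrite (exchange_big_dep (fun n : 'I_Y => (0 < n)%N && (a %| n)%N)) /=; last first.
  by move=> k n k0 /eqP ->; rewrite muln_gt0 a0 k0 dvdn_mulr.
apply: eq_bigr => n /andP[n0 an].
have kY : (n %/ a < Y)%N by apply: leq_ltn_trans (leq_div _ _) _.
rewrite (bigD1 (Ordinal kY)) /=; last first.
  by rewrite divn_gt0 // dvdn_leq // mulnC divnK ?eqxx.
rewrite big1 ?addr0 // => k /andP[/andP[k0 /eqP E]]; case/eqP.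
by apply: val_inj; rewrite /= E mulKn.
Qed.

Lemma widen_sum (F : nat -> V) (P : pred nat) n w : (n <= w)%N ->
  (forall m, P m -> (m < n)%N) -> \sum_(m < n | P m) F m = \sum_(m < w | P m) F m.
Proof.
move=> nw Pn; rewrite (big_ord_widen_cond w) //; apply: eq_bigl => m /=.
by case Pm: (P m) => //=; rewrite Pn.
Qed.

End SumTools.

Lemma count_interval W c D : (\sum_(n < W) (c <= n < c + D)%N <= D)%N.
Proof.
suff : (\sum_(n < W) (c <= n < c + D)%N <= minn D (W - c))%N by rewrite leq_min => /andP[].
elim: W => [|W IH]; first by rewrite big_ord0.
rewrite big_ord_recr /=; move: IH; set S := (\sum_(n < W) _)%N => IH.
by case: (leqP c W) => cW; case: (ltnP W (c + D)) => WD; rewrite /= ?addn1 ?addn0; lia.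
Qed.

Section VanDerCorput.
Context {R : realType}.
Variables (A v H : nat) (P : pred nat) (c : nat -> nat -> R[i]).
Hypotheses (H0 : (0 < H)%N) (cV : forall m n, (v <= n)%N -> c m n = 0).

Definition vdc_corr r : R :=
  cabs (\sum_(n < v) \sum_(m < A | P m) c m (n + r)%N * cj (c m n)).

(** The sequence moved to the right by [r] inside [[0, v + H)]: its sum does not depend on [r <= H],
    so it can be averaged over [H] shifts before Cauchy-Schwarz in [n]. *)
Let g m r n := if (r <= n)%N then c m (n - r)%N else 0.

Let g_sum m r : (r <= H)%N -> \sum_(n < v + H) g m r n = \sum_(n < v) c m n.
Proof. by move=> rH; apply: sum_ord_shift => [|n]; [lia|exact: cV]. Qed.

Let g_corr r1 r2 : (r1 <= r2)%N -> (r2 <= H)%N ->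
  cabs (\sum_(m < A | P m) \sum_(n < v + H) g m r1 n * cj (g m r2 n)) = vdc_corr (r2 - r1).
Proof.
move=> r12 r2H; rewrite /vdc_corr exchange_big /=; congr cabs.
rewrite exchange_big /= [RHS]exchange_big /=; apply: eq_bigr => m _.
pose F n := c m (n + (r2 - r1))%N * cj (c m n).
have F0 n : (v <= n)%N -> F n = 0 by move=> vn; rewrite /F (cV m vn) conjc0 mulr0.
rewrite -(@sum_ord_shift _ F r2 v (v + H)) //; last by rewrite leq_add2l.
apply: eq_bigr => n _; rewrite /g /F; case: (leqP r2 n) => r2n.
  by rewrite (leq_trans r12 r2n); congr (c m _ * _); lia.
by rewrite conjc0 mulr0.
Qed.

Let g_corrC r1 r2 : 
  cabs (\sum_(m < A | P m) \sum_(n < v + H) g m r1 n * cj (g m r2 n)) =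
  cabs (\sum_(m < A | P m) \sum_(n < v + H) g m r2 n * cj (g m r1 n)).
Proof.
rewrite -cabsJ sum_conjc; congr cabs; apply: eq_bigr => m _.
by rewrite sum_conjc; apply: eq_bigr => n _; rewrite conjcM conjcK mulrC.
Qed.

Let vdc_corr_ge0 r : 0 <= vdc_corr r. Proof. exact: cabs_ge0. Qed.

Let g_row r1 : (r1 < H)%N ->
  \sum_(r2 < H) cabs (\sum_(m < A | P m) \sum_(n < v + H) g m r1 n * cj (g m r2 n))
  <= 2 * \sum_(r < H) vdc_corr r.
Proof.
(* Both signs of [r2 - r1] occur, and on either side each distance occurs at most once; hence the
   factor 2. *)
move=> r1H; rewrite (bigID (fun r2 : 'I_H => (r2 < r1.+1)%N)) /= mulr_natl mulr2n; apply: lerD.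
  rewrite -(big_ord_widen H (fun r2 => cabs (\sum_(m < A | P m) \sum_(n < v + H) g m r1 n * cj (g m r2 n)))) //.
  apply: (@le_trans _ _ (\sum_(r < r1.+1) vdc_corr r)).
    rewrite (reindex_inj rev_ord_inj) /=; apply: ler_sum => r _.
    rewrite subSS g_corrC g_corr ?leq_subr //; last by lia.
    by rewrite subKn // -ltnS.
  rewrite (big_ord_widen H vdc_corr r1H) [leRHS](bigID (fun r : 'I_H => (r < r1.+1)%N)) /=.
  by rewrite lerDl sumr_ge0.
apply: (@le_trans _ _ (\sum_(r2 < H) (if (r1 < r2)%N then vdc_corr (r2 - r1) else 0))).
  rewrite big_mkcond /=; apply: ler_sum => r2 _; rewrite -leqNgt.
  by case: ifP => // lt; rewrite g_corr // ltnW.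
rewrite -(big_mkord xpredT (fun r2 => if (r1 < r2)%N then vdc_corr (r2 - r1) else 0)).
rewrite (big_cat_nat (n := r1)) //= ?(ltnW r1H) //.
rewrite [X in X + _]big_nat_cond [X in X + _]big1 ?add0r; last first.
  by move=> r2 /andP[/andP[_ lt] _]; rewrite ltnNge ltnW.
rewrite -{1}[r1]add0n big_addn big_mkord.
rewrite -(big_mkord xpredT vdc_corr) [leRHS](big_cat_nat (n := (H - r1)%N)) //= ?leq_subr //.
rewrite big_mkord -[leLHS]addr0; apply: lerD; last by apply: sumr_ge0.
by apply: ler_sum => r _; rewrite addnK; case: ifP.
Qed.

Lemma vdc :
  \sum_(m < A | P m) cabs (\sum_(n < v) c m n) ^+ 2 <=
  2 * (v + H)%:R / H%:R * \sum_(r < H) vdc_corr r.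
Proof.
have HR : 0 < (H%:R : R) by rewrite ltr0n.
rewrite mulrAC ler_pdivlMr //.
have E m : H%:R * cabs (\sum_(n < v) c m n) = cabs (\sum_(n < v + H) \sum_(r < H) g m r n).
  rewrite -cabs_sum_const [in RHS]exchange_big /=; congr cabs; apply: eq_bigr => r _.
  by rewrite g_sum // ltnW.
have S1 m : H%:R ^+ 2 * cabs (\sum_(n < v) c m n) ^+ 2 <=
    (v + H)%:R * \sum_(n < v + H) cabs (\sum_(r < H) g m r n) ^+ 2.
  rewrite -exprMn E.
  have := cabs_CS (index_enum 'I_(v + H)) xpredT (fun=> 1) (fun n : 'I_(v + H) => \sum_(r < H) g m r n).
  under [in X in X <= _]eq_bigr do rewrite mul1r.
  by rewrite cabs1 expr1n sumr_const card_ord.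
have S2 : \sum_(m < A | P m) \sum_(n < v + H) cabs (\sum_(r < H) g m r n) ^+ 2 <=
    H%:R * (2 * \sum_(r < H) vdc_corr r).
  have S20 : 0 <= \sum_(m < A | P m) \sum_(n < v + H) cabs (\sum_(r < H) g m r n) ^+ 2.
    by apply: sumr_ge0 => m _; apply: sumr_ge0 => n _; rewrite sqr_ge0.
  rewrite -(cabs_real_ge0 S20).
  have -> : (\sum_(m < A | P m) \sum_(n < v + H) cabs (\sum_(r < H) g m r n) ^+ 2)%:C =
    \sum_(r1 < H) \sum_(r2 < H) \sum_(m < A | P m) \sum_(n < v + H) g m r1 n * cj (g m r2 n).
    rewrite sum_realC.
    under eq_bigr => m _.
      rewrite sum_realC; under eq_bigr => n _ do rewrite cabs_sum_sqr.
      rewrite exchange_big /=; under eq_bigr => r1 _ do rewrite exchange_big /=.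
      over.
    by rewrite exchange_big /=; apply: eq_bigr => r1 _; rewrite exchange_big.
  apply: le_trans (cabs_sum _ _ _) _; apply: ler_sum_ord => r1.
  by apply: le_trans (cabs_sum _ _ _) _; exact: g_row.
have {}S1 : H%:R ^+ 2 * \sum_(m < A | P m) cabs (\sum_(n < v) c m n) ^+ 2 <=
    (v + H)%:R * (H%:R * (2 * \sum_(r < H) vdc_corr r)).
  apply: le_trans (ler_wpM2l _ S2) => //; rewrite !mulr_sumr; apply: ler_sum => m _; exact: S1.
by rewrite -(ler_pM2l HR); apply: le_trans (le_trans _ S1) _; apply: eq_le; ring.
Qed.

End VanDerCorput.

(** * Truncation of [f] after differencing *)

Section Truncation.
Context {R : realType}.
Variables (q : nat) (f : nat -> R[i]) (K : R).
Hypothesis q2 : (2 <= q)%N.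
Hypothesis fU : forall n, cabs (f n) = 1.
Hypothesis K1 : 1 <= K.
Hypothesis propK : forall lam kap rho, (rho < lam)%N ->
  #|propagation_exceptions q f lam kap rho|%:R
  <= K * weight q rho * (q ^ lam)%:R / (q ^ rho)%:R.

Definition shell mu m : bool := [&& (q ^ mu.-1 <= m)%N, (m < q ^ mu)%N & coprime m q].

Lemma shell_lt mu m : shell mu m -> (m < q ^ mu)%N.
Proof. by case/and3P. Qed.

Lemma shell_coprime mu m : shell mu m -> coprime m q.
Proof. by case/and3P. Qed.

Lemma shell_card mu w : \sum_(m < w | shell mu m) (1 : R) <= (q ^ mu)%:R.
Proof.
have le_card w' : \sum_(m < w' | shell mu m) (1 : R) <= w'%:R.
  by rewrite sumr_const -[X in _ <= X%:R]card_ord ler_nat max_card.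
case: (leqP w (q ^ mu)) => le; first by apply: le_trans (le_card w) _; rewrite ler_nat.
by rewrite -(widen_sum (fun=> 1 : R) (ltnW le) (@shell_lt mu)) le_card.
Qed.

(** The [n] with [m n] in a given block of length [A] lie in an interval of length [A %/ m + 2], and
    the lower end [q ^ mu.-1] of the shell gives [A %/ m <= q ^ rho1.+1]. *)
Lemma count_block mu rho1 m l W : (0 < mu)%N -> shell mu m ->
  (\sum_(n < W) (m * n %/ q ^ (mu + rho1) == l) <= 2 * q ^ rho1.+1)%N.
Proof.
move=> mu0 /and3P[mlo mhi _]; set A := (q ^ (mu + rho1))%N.
have m0 : (0 < m)%N by apply: leq_trans mlo; rewrite expn_gt0; lia.
have A0 : (0 < A)%N by rewrite expn_gt0; lia.
have Am : (A %/ m <= q ^ rho1.+1)%N.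
  rewrite -ltnS ltn_divLR // mulSn.
  have : (A <= q ^ rho1.+1 * m)%N.
    rewrite /A (_ : mu + rho1 = rho1.+1 + mu.-1)%N; last by lia.
    by rewrite expnD leq_mul2l mlo orbT.
  by move: (q ^ rho1.+1)%N => B; nia.
have B2 : (2 <= q ^ rho1.+1)%N.
  by apply: leq_trans q2 _; rewrite -{1}(expn1 q) leq_pexp2l //; lia.
apply: leq_trans (_ : A %/ m + 2 <= _)%N; last by move: Am B2; lia.
apply: leq_trans (count_interval W (l * A %/ m) (A %/ m + 2)); apply: leq_sum => n _.
case: eqP => // E; rewrite (_ : (_ && _) = true) //.
have E1 : (l * A <= m * n)%N by rewrite -E leq_trunc_div.
have E2 : (m * n < l.+1 * A)%N by rewrite -E ltn_ceil.
apply/andP; split; first by rewrite -(mulKn n m0) leq_div2r.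
have : (n <= l.+1 * A %/ m)%N by rewrite -{1}(mulKn n m0) leq_div2r // ltnW.
have : (l.+1 * A %/ m <= l * A %/ m + A %/ m + 1)%N.
  by rewrite mulSn addnC divnD // leq_add2l leq_b1.
lia.
Qed.

(** Since [m r < q ^ (mu + rho1)], passing from [m n] to [m (n + r)] adds less than the block length
    [q ^ kap], so propagation applies to the block of [m n]; for each [m], an exceptional block is
    met at most [2 * q ^ rho1.+1] times. *)
Lemma trunc_error mu nu rho1 rho2 r :
  (0 < mu)%N -> (rho2 + rho1 < nu)%N -> (r < q ^ rho1)%N ->
  \sum_(n < q ^ nu) \sum_(m < q ^ mu | shell mu m)
    cabs (f (m * (n + r))%N * cj (f (m * n)%N) -
          pair_phase q f (mu + rho1 + rho2) r m n)
  <= 4 * q%:R * K * weight q rho2 * ((q ^ mu)%:R * (q ^ nu)%:R) / (q ^ rho2)%:R.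
Proof.
move=> mu0 rn rH; have q0 := q_gt0 q2.
set kap := (mu + rho1)%N; set lam := (nu - rho1)%N.
have klE : (kap + lam = mu + nu)%N by rewrite /kap /lam; lia.
pose ex l := exceptional q f lam kap rho2 l.
have term m n : (n < q ^ nu)%N -> shell mu m ->
    cabs (f (m * (n + r))%N * cj (f (m * n)%N) - pair_phase q f (kap + rho2) r m n)
    <= 2 * (ex (m * n %/ q ^ kap)%N)%:R.
  move=> nN mM; case: (boolP (ex _)) => [_|nex].
    rewrite /pair_phase; apply: le_trans (cabsB _ _) _.
    by rewrite !cabsM !cabsJ !trunc_unit // !fU /=; lra.
  have mr : (m * r < q ^ kap)%N.
    rewrite /kap expnD; apply: leq_ltn_trans (_ : m * q ^ rho1 < _)%N.
      by rewrite leq_mul2l (ltnW rH) orbT.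
    by rewrite ltn_pmul2r ?expn_gt0 ?q0 // (shell_lt mM).
  have lL : (m * n %/ q ^ kap < q ^ lam)%N.
    rewrite ltn_divLR ?expn_gt0 ?q0 // -expnD addnC klE expnD.
    apply: leq_ltn_trans (_ : m * q ^ nu < _)%N; first by rewrite leq_mul2l (ltnW nN) orbT.
    by rewrite ltn_pmul2r ?expn_gt0 ?q0 // (shell_lt mM).
  have k1 : ((m * n) %% q ^ kap < q ^ kap)%N by rewrite ltn_mod expn_gt0 q0.
  have := exceptionalN lL k1 mr nex; rewrite -divn_eq -mulnDr => ->.
  by rewrite /pair_phase mulnDr subrr cabs0 mulr0.
apply: (@le_trans _ _ (\sum_(m < q ^ mu | shell mu m) \sum_(n < q ^ nu)
    2 * (ex (m * n %/ q ^ kap)%N)%:R)).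
  rewrite exchange_big /=; apply: ler_sum => m mM; apply: ler_sum => n _.
  exact: term.
have row m : shell mu m -> \sum_(n < q ^ nu) 2 * (ex (m * n %/ q ^ kap)%N)%:R <=
    4 * (q ^ rho1.+1)%:R * (K * weight q rho2 * (q ^ lam)%:R / (q ^ rho2)%:R) :> R.
  move=> mM; rewrite -mulr_sumr.
  have -> : \sum_(n < q ^ nu) (ex (m * n %/ q ^ kap)%N)%:R =
      \sum_(l < q ^ lam) (ex l)%:R * (\sum_(n < q ^ nu) (m * n %/ q ^ kap == l))%N%:R :> R.
    under [RHS]eq_bigr => l _ do rewrite natr_sum mulr_sumr.
    rewrite exchange_big /=; apply: eq_bigr => n _.
    have lL : (m * n %/ q ^ kap < q ^ lam)%N.
      rewrite ltn_divLR ?expn_gt0 ?q0 // -expnD addnC klE expnD.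
      apply: leq_ltn_trans (_ : m * q ^ nu < _)%N; first by rewrite leq_mul2l (ltnW (ltn_ord n)) orbT.
      by rewrite ltn_pmul2r ?expn_gt0 ?q0 // (shell_lt mM).
    rewrite (bigD1 (Ordinal lL)) //= eqxx mulr1 big1 ?addr0 // => l ll.
    rewrite (_ : (_ == _) = false) ?mulr0 //; apply/negbTE; apply: contra ll => /eqP E.
    by apply/eqP; apply: val_inj.
  apply: (@le_trans _ _ (2 * \sum_(l < q ^ lam) (ex l)%:R * (2 * (q ^ rho1.+1)%:R))).
    rewrite ler_wpM2l //; apply: ler_sum => l _; rewrite ler_wpM2l //.
    by rewrite -natrM ler_nat; exact: count_block.
  rewrite -mulr_suml exceptional_card.
  have rl : (rho2 < lam)%N by rewrite /lam; lia.
  set E := #|_|%:R; set B := (q ^ rho1.+1)%:R.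
  apply: (@le_trans _ _ (4 * B * E)); first by apply: eq_le; ring.
  by apply: ler_wpM2l; [rewrite mulr_ge0|exact: propK].
apply: (@le_trans _ _ (\sum_(m < q ^ mu | shell mu m) 1 *
   (4 * (q ^ rho1.+1)%:R * (K * weight q rho2 * (q ^ lam)%:R / (q ^ rho2)%:R)))).
  by apply: ler_sum => m mM; rewrite mul1r; exact: row.
have w1 := weight_ge1 (R:=R) q2 rho2.
rewrite -mulr_suml; apply: le_trans (ler_wpM2r _ (shell_card mu (q ^ mu))) _.
  have K0 : 0 <= K := le_trans ler01 K1.
  have w0 : 0 <= weight q rho2 :> R := le_trans ler01 w1.
  by nneg.
apply: eq_le; have -> : (q ^ nu)%:R = (q ^ rho1)%:R * (q ^ lam)%:R :> R.
  by rewrite -natrM -expnD; congr ((q ^ _)%:R); rewrite /lam; lia.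
by rewrite expnS natrM; ring.
Qed.

End Truncation.

(** * Type II sums *)

(** If [y] exceeded [(1 + d1 + d2) * x], inserting the bound on [z] into the bound on [y ^+ 2] would
    give [y (y - x) <= (d1 + d2) x^2], which is then impossible. *)
Lemma quadratic_bound (R : realType) (x y z d1 d2 : R) :
  0 < x -> 0 <= y -> 0 <= d1 -> 0 <= d2 ->
  z <= d1 * x + y -> y ^+ 2 <= x * z + d2 * x ^+ 2 ->
  z <= (2 * d1 + d2 + 1) * x.
Proof.
move=> x0 y0 d10 d20 zy yz.
suff : y <= (1 + d1 + d2) * x by lra.
rewrite leNgt; apply/negP => ly.
have : y * (y - x) <= (d1 + d2) * x ^+ 2.
  have : x * z <= x * (d1 * x + y) by rewrite ler_pM2l.
  rewrite !expr2 in yz *; lra.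
have : (d1 + d2) * x ^+ 2 < y * (y - x).
  have h1 : (d1 + d2) * x < y - x by lra.
  have h2 : x < y by nra.
  by rewrite expr2; nra.
lra.
Qed.

Lemma shift_arith1 (R : realType) (k w a y : R) : a != 0 -> y != 0 ->
  32 * (k * w / y) = 32 * a * k * (a * y)^-1 * w.
Proof. by move=> a0 y0; field; rewrite a0 y0. Qed.

Lemma shift_arith2 (R : realType) (x k : R) : x != 0 ->
  2 * x^-1 * x ^- 5 * (k * x ^+ 9) = 2 * k * x ^+ 3 * 1.
Proof. by move=> x0; field. Qed.

Lemma shift_arith3 (R : realType) (a x z k : R) : x != 0 ->
  a * (a * x^-1) * (a * x^-1 * (a * x^-1 * z / x ^- 2 + a * x^-1 * (k * x ^+ 3))) =
  (x * z + k * x ^+ 2) * (a * (a * x^-1)) ^+ 2.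
Proof. by move=> x0; field. Qed.

Lemma sum_injective_le (R : realType) (F : nat -> R) (P : pred nat) w r :
  (0 < r)%N -> (forall n, 0 <= F n) -> (forall m, P m -> (0 < m)%N /\ (m * r < w)%N) ->
  \sum_(m < w | P m) F (m * r)%N <= \sum_(a < w) F a.
Proof.
move=> r0 F0 Pm; pose G n := if (n < w)%N then F n else 0.
apply: (@le_trans _ _ (\sum_(m < w | (0 < m)%N) G (r * m)%N)).
  rewrite big_mkcond [leRHS]big_mkcond /=; apply: ler_sum => m _.
  case: ifP => [/Pm[m0 mr]|_]; first by rewrite m0 /G [(r * m)%N]mulnC mr.
  by case: ifP => // _; rewrite /G; case: ifP.
rewrite sum_multiples //; last by move=> n wn; rewrite /G ltnNge wn.
rewrite big_mkcond /=; apply: ler_sum => a _; rewrite /G ltn_ord.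
by case: ifP.
Qed.

Section Bilinear.
Context {R : realType}.
Variables (q : nat) (f : nat -> R[i]) (K : R).
Hypothesis q2 : (2 <= q)%N.
Hypothesis fU : forall n, cabs (f n) = 1.
Hypothesis K1 : 1 <= K.
Hypothesis propK : forall lam kap rho, (rho < lam)%N ->
  #|propagation_exceptions q f lam kap rho|%:R
  <= K * weight q rho * (q ^ lam)%:R / (q ^ rho)%:R.

Let q0 : (0 < q)%N. Proof. exact: q_gt0. Qed.
Let qn0 n : 0 < (q ^ n)%:R :> R. Proof. exact: expqR_gt0. Qed.
Let qnN n : (q ^ n)%:R != 0 :> R. Proof. exact: expqR_neq0. Qed.
Let qnD a b : (q ^ (a + b))%:R = (q ^ a)%:R * (q ^ b)%:R :> R.
Proof. by rewrite expnD natrM. Qed.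
Let w1 rho : 1 <= weight q rho :> R. Proof. exact: weight_ge1. Qed.
Let w0 rho : 0 <= weight q rho :> R. Proof. exact: le_trans (w1 rho). Qed.
Let K0 : 0 <= K. Proof. exact: le_trans K1. Qed.

(** The predecessor matches [coarse q f t], which runs through the values [f (q * l)] with
    [l < q ^ t.-1]. *)
Definition fourier_sup t (Mf : R) := forall x : R,
  cabs (\sum_(l < q ^ t.-1) f (q * l)%N * e (- (l%:R * x))) <= Mf * (q ^ t.-1)%:R.

Let shell_gt0 mu m : (0 < mu)%N -> shell q mu m -> (0 < m)%N.
Proof. by move=> mu0 /and3P[lo _ _]; apply: leq_trans lo; rewrite expn_gt0 q0. Qed.

Section Fibre.
Variables (mu t r : nat) (em : nat -> R[i]).
Let Q := (q ^ t)%N.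
Hypotheses (mu0 : (0 < mu)%N) (em1 : forall m, cabs (em m) <= 1).
Hypothesis rQ : forall m, shell q mu m -> (m * r < Q)%N.
Hypothesis r0 : (0 < r)%N.

Let Q0 : (0 < Q)%N. Proof. exact: expq_gt0. Qed.

(** Divided by [q ^ mu] it is at most one in modulus, and so can serve as the weight [B] in the
    shift bound for the very sum that it represents. *)
Definition fibre_mean n : R[i] :=
  ((q ^ mu)%:R)^-1 * \sum_(m < Q | shell q mu m) em m * pair_phase q f t r m n.

Lemma pair_phase_periodic m : periodic_mod Q (pair_phase q f t r m).
Proof.
move=> n; rewrite /pair_phase; congr (_ * cj _); apply: trunc_mod;
by rewrite ?modnMmr // -modnDml modnMmr modnDml.
Qed.

Lemma pair_phase_unit m n : cabs (pair_phase q f t r m n) = 1.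
Proof. by rewrite /pair_phase cabsM cabsJ !trunc_unit // mulr1. Qed.

Lemma fibre_mean_periodic : periodic_mod Q fibre_mean.
Proof.
move=> n; rewrite /fibre_mean; congr (_ * _); apply: eq_bigr => m _.
by rewrite pair_phase_periodic.
Qed.

Lemma fibre_mean_le1 n : cabs (fibre_mean n) <= 1.
Proof.
rewrite /fibre_mean cabsM cabsV cabs_nat mulrC ler_pdivrMr // mul1r.
apply: le_trans (cabs_sum _ _ _) _; apply: le_trans (shell_card q mu Q).
by apply: ler_sum => m _; rewrite cabsM pair_phase_unit mulr1.
Qed.

Lemma corr_periodic c (g : nat -> R[i]) a : periodic_mod Q g -> periodic_mod Q (corr q t c g a).
Proof.
move=> pg X; rewrite /corr; congr (_ * _); apply: eq_bigr => j _; congr (_ * cj _);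
by apply: (periodicP pg); rewrite -?addnA modnDml.
Qed.

Lemma corr_energy_ge0 c (g : nat -> R[i]) a : 0 <= corr_energy q t c g a.
Proof.
by rewrite /corr_energy mulr_ge0 ?invr_ge0 //; apply: sumr_ge0 => X _; rewrite sqr_ge0.
Qed.

(** As [m] is invertible modulo [Q], the step [m c] can be replaced by [c]; the averaged phase is
    then a correlation of [trunc q f t] at distance [m r], taken at the point [m n]. *)
Lemma dilated_fibre_mean c n : dilated_mean Q fibre_mean c n =
  ((q ^ mu)%:R)^-1 * \sum_(m < Q | shell q mu m)
     em m * corr q t c (trunc q f t) (m * r) (m * n).
Proof.
rewrite /dilated_mean /fibre_mean -mulr_sumr mulrCA; congr (_ * _).
rewrite exchange_big /= mulr_sumr; apply: eq_bigr => m mM.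
rewrite -mulr_sumr mulrCA /corr; congr (_ * (_ * _)).
have cm : coprime m Q by rewrite coprimeXr // (shell_coprime mM).
pose F j := trunc q f t (m * n + m * r + c * j) * cj (trunc q f t (m * n + c * j)).
have pF : periodic_mod Q F.
  move=> j; rewrite /F; congr (_ * cj _); apply: trunc_mod;
  by rewrite -modnDmr modnMmr modnDmr.
rewrite -(sum_periodic_mul cm pF); apply: eq_bigr => j _.
by rewrite /F /pair_phase; congr (trunc _ _ _ _ * cj (trunc _ _ _ _)); lia.
Qed.

(** After Cauchy-Schwarz in [m], the permutation [n -> m n] modulo [Q] yields [corr_energy] at
    distance [m r]. As [m -> m r] is injective into [[0, Q)], the sum over [m] is at most the sum
    over all distances. *)
Lemma dilated_fibre_mean_le rho k Mf : (rho.+1 < t)%N -> (0 < k)%N -> fourier_sup t Mf ->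
  \sum_(n < Q) cabs (dilated_mean Q fibre_mean (q ^ rho.+1 * k) n) ^+ 2 <=
  Q%:R * (2 * (Q%:R / (q ^ mu)%:R) * (q ^ rho.+1 * k)%:R * Mf ^+ 2 +
          32 * (K * weight q rho / (q ^ rho)%:R)).
Proof.
move=> rt k0 FM; set c := (q ^ rho.+1 * k)%N.
have c0 : (0 < c)%N by rewrite muln_gt0 expn_gt0 q0.
have Lc : (q ^ rho.+1 %| c)%N by rewrite dvdn_mulr.
pose ce a := corr_energy q t c (trunc q f t) a.
pose ce1 a := corr_energy q t c (coarse q f t) a.
have qm : 0 < (q ^ mu)%:R :> R by [].
have S1 n : cabs (dilated_mean Q fibre_mean c n) ^+ 2 <=
   ((q ^ mu)%:R)^-1 * \sum_(m < Q | shell q mu m) cabs (corr q t c (trunc q f t) (m * r) (m * n)) ^+ 2.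
  rewrite dilated_fibre_mean cabsM cabsV cabs_nat exprMn exprVn mulrC ler_pdivrMr ?exprn_gt0 //.
  apply: le_trans (cabs_CS _ _ _ _) _.
  rewrite (_ : _^-1 * _ * _ = (q ^ mu)%:R * \sum_(m < Q | shell q mu m)
     cabs (corr q t c (trunc q f t) (m * r) (m * n)) ^+ 2); last by field.
  rewrite ler_wpM2r //; first by apply: sumr_ge0 => m _; rewrite sqr_ge0.
  apply: le_trans (shell_card q mu Q); apply: ler_sum => m _.
  by rewrite expr_le1 ?cabs_ge0.
apply: (@le_trans _ _ (\sum_(n < Q) ((q ^ mu)%:R)^-1 * \sum_(m < Q | shell q mu m)
    cabs (corr q t c (trunc q f t) (m * r) (m * n)) ^+ 2)).
  by apply: ler_sum => n _; exact: S1.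
rewrite -mulr_sumr exchange_big /=.
apply: (@le_trans _ _ (((q ^ mu)%:R)^-1 * \sum_(m < Q | shell q mu m) Q%:R *
    (2 * ce1 (m * r)%N + 32 * (K * weight q rho / (q ^ rho)%:R)))).
  rewrite ler_pM2l ?invr_gt0 //; apply: ler_sum => m mM.
  have cm : coprime m Q by rewrite coprimeXr // (shell_coprime mM).
  pose F X := cabs (corr q t c (trunc q f t) (m * r) X) ^+ 2.
  have pF : periodic_mod Q F.
    by move=> X; rewrite /F corr_periodic //; exact: trunc_periodic.
  rewrite (sum_periodic_mul cm pF).
  apply: le_trans (ler_wpM2l _ (corr_energy_le q2 fU K1 propK rt Lc c0 (m * r))) => //.
  by rewrite /corr_energy mulVKf //; exact: qnN.
set D := 32 * _; rewrite -mulr_sumr big_split /= -mulr_sumr mulrCA ler_pM2l ?ltr0n //.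
rewrite mulrDr; apply: lerD.
  have H1 : \sum_(m < Q | shell q mu m) ce1 (m * r)%N <= Q%:R * c%:R * Mf ^+ 2.
    apply: le_trans (corr_energy_sum q2 fU K1 propK rt Lc c0 FM).
    apply: (@sum_injective_le R ce1) => // [a|m mM]; first exact: corr_energy_ge0.
    by split; [exact: shell_gt0 mM|exact: rQ].
  apply: (@le_trans _ _ (((q ^ mu)%:R)^-1 * (2 * (Q%:R * c%:R * Mf ^+ 2)))).
    by rewrite ler_pM2l ?invr_gt0 // ler_pM2l.
  by apply: eq_le; field.
rewrite mulrC ler_pdivrMr // -{2}[D]mul1r.
have -> : \sum_(m < Q | shell q mu m) D = (\sum_(m < Q | shell q mu m) 1) * D.
  by rewrite mulr_suml; apply: eq_bigr => m _; rewrite mul1r.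
rewrite mul1r mulrC; apply: ler_wpM2l; last exact: shell_card.
by rewrite /D; have := w0 rho; have := K0; move=> ? ?; nneg.
Qed.

(* [S = mean |fibre_mean|^2] satisfies [S^2 <= (S + ...) q^-4s] by the shift bound. *)
Lemma fibre_mean_square s Mf Cf :
  (0 < s)%N -> t = (mu + 4 * s)%N -> (8 * s < mu)%N -> 0 <= Cf ->
  fourier_sup t Mf -> Mf ^+ 2 * (q ^ (36 * s))%:R <= Cf ->
  \sum_(n < Q) cabs (fibre_mean n) ^+ 2 <=
  Q%:R * ((2 * Cf + (32 * q%:R + 16) * K + 1) * weight q (12 * s) / (q ^ (4 * s))%:R).
Proof.
move=> s0 tE smu Cf0 FM FC.
have E36 : (36 * s = 9 * (4 * s))%N by lia.
have E12 : (12 * s = 3 * (4 * s))%N by lia.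
have E12p : ((12 * s).-1.+1 = 12 * s)%N by lia.
have E20 : (8 * s + 4 * s + 8 * s <= 5 * (4 * s))%N by lia.
have E8 : (8 * s = 2 * (4 * s))%N by lia.
have E4 : (4 * s <= 12 * s)%N by lia.
have JE : (8 * s + 4 * s = (12 * s).-1.+1)%N by lia.
have Jt : (8 * s + 4 * s < t)%N by lia.
set w := weight q (12 * s); have w1' : 1 <= w := w1 _.
set x := ((q ^ (4 * s))%:R : R)^-1.
have x0 : 0 < x by rewrite invr_gt0.
pose SB := \sum_(n < Q) cabs (fibre_mean n) ^+ 2.
pose kap := (8 * s)%N; pose rho := (4 * s)%N.
have J0 : (0 < kap + rho)%N by rewrite JE.
have xN : x != 0 by rewrite gt_eqF.
have qs n : (q ^ (n * (4 * s)))%:R = x ^- n :> R.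
  by rewrite /x exprVn invrK mulnC expnM natrX.
pose C1 := 2 * Cf + 32 * q%:R * K.
have w0' : 0 <= w := w0 _.
have K0' := K0.
have C10 : 0 <= C1 by rewrite /C1; nneg.
pose Pmax := Q%:R * (C1 * w * x ^+ 3).
have Pm0 : 0 <= Pmax.
  by rewrite /Pmax; nneg.
have PmaxP k : (0 < k < q ^ kap)%N ->
    \sum_(n < Q) cabs (dilated_mean Q fibre_mean (q ^ (kap + rho) * k) n) ^+ 2 <= Pmax.
  move=> /andP[k0 kK]; rewrite JE.
  apply: le_trans (dilated_fibre_mean_le _ k0 FM) _; first by rewrite -JE.
  rewrite /Pmax ler_pM2l ?ltr0n //.
  have -> : C1 * w * x ^+ 3 = 2 * Cf * x ^+ 3 * w + 32 * q%:R * K * x ^+ 3 * w by rewrite /C1; ring.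
  apply: lerD.
    have -> : Q%:R / (q ^ mu)%:R = x^-1.
      by rewrite /Q tE qnD mulrAC divff // mul1r /x invrK.
    have ck : (q ^ (12 * s).-1.+1 * k)%:R <= x ^- 5 :> R.
      rewrite -qs ler_nat -JE; apply: leq_trans (_ : q ^ (kap + rho) * q ^ kap <= _)%N.
        by rewrite leq_mul2l (ltnW kK) orbT.
      by rewrite -expnD leq_exp2l.
    (* In powers of [x = q^(-4 s)]: the ratio [Q / q ^ mu] costs [x^-1], the step at most [x^-5],
       and [36 s = 9 * 4 s] makes the squared decay [x^9], which leaves the [x^3] wanted in
       [Pmax]. *)
    have M9 : Mf ^+ 2 <= Cf * x ^+ 9.
      rewrite -ler_pdivrMr ?exprn_gt0 //; apply: le_trans FC; apply: eq_le.
      by rewrite E36 qs.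
    apply: (@le_trans _ _ (2 * x^-1 * x ^- 5 * (Cf * x ^+ 9))).
      apply: ler_pM => //; [by nneg|exact: sqr_ge0|].
      by rewrite ler_pM2l // mulr_gt0 // invr_gt0.
    apply: (@le_trans _ _ (2 * Cf * x ^+ 3 * 1)).
      by apply: eq_le; exact: shift_arith2.
    by rewrite ler_wpM2l //; nneg.
  have wl : weight q (12 * s).-1 <= w by apply: weight_le => //; exact: leq_pred.
  have -> : 32 * (K * weight q (12 * s).-1 / (q ^ (12 * s).-1)%:R) =
     32 * q%:R * K * x ^+ 3 * weight q (12 * s).-1.
    have -> : x ^+ 3 = (q%:R * (q ^ (12 * s).-1)%:R)^-1.
      by rewrite -natrM -expnS E12p E12 qs invrK.
    by apply: shift_arith1 => //; rewrite pnatr_eq0 -lt0n.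
  by rewrite ler_wpM2l //; nneg.
have [Y [Y0 Y2 HY]] := shift_bound q2 fU K1 propK r J0 Jt fibre_mean_periodic
  fibre_mean_le1 (@shell_coprime q mu) Pm0 PmaxP em1.
move: Y2 HY; rewrite -/Q -/SB; set M := \sum_(m < Q | shell q mu m) 1 => Y2 HY.
have Mle : M <= (q ^ mu)%:R := shell_card q mu Q.
have M0 : 0 <= M by apply: sumr_ge0.
have QR : 0 < (Q%:R : R) by rewrite ltr0n.
have SB0 : 0 <= SB by apply: sumr_ge0 => n _; rewrite sqr_ge0.
pose z := SB / Q%:R; pose y := Y / ((q ^ mu)%:R * Q%:R).
have SBz : SB = Q%:R * z by rewrite /z mulrC mulfVK // gt_eqF.
have Yy : Y = y * ((q ^ mu)%:R * Q%:R) by rewrite /y mulfVK // mulf_neq0 // gt_eqF.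
(* Tested against the conjugate of its own mean, the bilinear sum is exactly [q ^ mu] times the norm
   [SB] to be bounded. *)
have LHS : cabs (\sum_(m < Q | shell q mu m) em m *
    \sum_(n < Q) pair_phase q f t r m n * cj (fibre_mean n)) = (q ^ mu)%:R * SB.
  have -> : \sum_(m < Q | shell q mu m) em m *
    \sum_(n < Q) pair_phase q f t r m n * cj (fibre_mean n) = ((q ^ mu)%:R * SB)%:C.
    rewrite rmorphM /= natC /SB sum_realC mulr_sumr.
    under eq_bigr => m _ do rewrite mulr_sumr.
    rewrite exchange_big /=; apply: eq_bigr => n _.
    rewrite -mulcJ mulrA {1}/fibre_mean mulVKf ?pnatr_eq0 -?lt0n ?expn_gt0 ?q0 //.
    by rewrite mulr_suml; apply: eq_bigr => m _; rewrite mulrA.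
  by rewrite cabs_real_ge0 // mulr_ge0.
have zy : z <= 8 * K * w * x + y.
  rewrite LHS in HY.
  have wl : weight q rho <= w by apply: weight_le.
  have {}HY : (q ^ mu)%:R * SB <= (q ^ mu)%:R * (8 * (K * w * Q%:R * x)) + Y.
    apply: le_trans HY _; rewrite lerD2r; apply: ler_pM => //.
      by have := w0 rho => ?; nneg.
    rewrite ler_pM2l // -/x ler_wpM2r ?(ltW x0) // ler_wpM2r //.
    by rewrite ler_wpM2l.
  move: HY; rewrite SBz Yy.
  have -> : (q ^ mu)%:R * (8 * (K * w * Q%:R * x)) + y * ((q ^ mu)%:R * Q%:R) =
     (q ^ mu)%:R * Q%:R * (8 * K * w * x + y) by ring.
  by rewrite mulrA ler_pM2l // mulr_gt0.
have yz : y ^+ 2 <= x * z + C1 * w * x ^+ 2.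
  have {}Y2 : Y ^+ 2 <= (q ^ mu)%:R * Q%:R * (Q%:R * (SB / (q ^ kap)%:R + Pmax)).
    apply: le_trans Y2 _; rewrite ler_wpM2r //.
      by nneg.
    by rewrite ler_wpM2r.
  have QE : Q%:R = (q ^ mu)%:R * x^-1 :> R by rewrite /x invrK /Q tE qnD.
  have kE : (q ^ kap)%:R = x ^- 2 :> R by rewrite -qs /kap E8.
  rewrite /y expr_div_n ler_pdivrMr ?exprn_gt0 ?mulr_gt0 //.
  apply: le_trans Y2 _; apply: eq_le; rewrite kE SBz /Pmax QE.
  exact: shift_arith3.
have y0 : 0 <= y by rewrite /y; nneg.
have H : z <= (2 * (8 * K * w) + C1 * w + 1) * x.
  by apply: (quadratic_bound x0 y0 _ _ zy yz); nneg.
rewrite -/SB SBz ler_pM2l //; apply: le_trans H _; rewrite -/x ler_pM2r //.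
have -> : (2 * Cf + (32 * q%:R + 16) * K + 1) * w = 2 * (8 * K * w) + C1 * w + w by rewrite /C1; ring.
by rewrite lerD2l.
Qed.

End Fibre.
End Bilinear.

(** Written as a sum over ordinals because it arises from exchanging such sums; it vanishes at 0. *)
Definition ndiv a : nat := (\sum_(d < a.+1 | (0 < d) && (d %| a)) 1)%N.

Lemma ndiv_ge (P : pred nat) w a : (0 < a)%N -> (forall m, P m -> (0 < m)%N) ->
  (\sum_(m < w | P m && (m %| a)) 1 <= ndiv a)%N.
Proof.
move=> a0 Pm; case: (leqP w a.+1) => wa.
  rewrite /ndiv (big_ord_widen_cond a.+1 (fun m => P m && (m %| a)%N) (fun=> 1%N) wa).
  rewrite big_mkcond [leqRHS]big_mkcond /=; apply: leq_sum => d _.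
  by case: ifP => // /andP[/andP[/Pm -> ->]].
have -> : (\sum_(m < w | P m && (m %| a)) 1 = \sum_(m < a.+1 | P m && (m %| a)) 1)%N.
  rewrite (big_ord_widen_cond w (fun m => P m && (m %| a)%N) (fun=> 1%N) (ltnW wa)).
  apply: eq_bigl => m; rewrite -andbA; congr (_ && _).
  by case dv: (m %| a)%N => //=; rewrite ltnS dvdn_leq.
rewrite /ndiv big_mkcond [leqRHS]big_mkcond /=; apply: leq_sum => d _.
by case: ifP => // /andP[/Pm -> ->].
Qed.

Lemma bool_sub_le (R : realType) (b1 b2 b3 : bool) : (b1 ==> b2 || b3) ->
  b1%:R - b2%:R <= b3%:R :> R.
Proof. by case: b1 b2 b3 => [] [] [] //= _; rewrite ?subrr ?subr0 ?sub0r ?ler01 ?oppr_le0 ?ler01 // (le_trans _ ler01) ?lerN10. Qed.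

(** * Discrepancy of an interval along progressions modulo [Q] *)

Section IntervalDiscrepancy.
Context {R : realType}.
Variables (Q v c : nat).
Hypotheses (Q0 : (0 < Q)%N) (vQ : (v <= Q)%N) (c0 : (0 < c)%N).

Let h y : R := (y %% Q < v)%N%:R.

Let cnt n : R := \sum_(j < Q) h (n + c * j)%N.

Let h_periodic : periodic_mod Q h. Proof. by move=> y; rewrite /h modn_mod. Qed.

Let h_sum : \sum_(y < Q) h y = v%:R.
Proof.
rewrite /h -natr_sum; congr (_%:R).
rewrite -[RHS](card_ord v) -sum1_card (big_ord_widen Q (fun=> 1%N) vQ) [RHS]big_mkcond /=.
by apply: eq_bigr => y _; rewrite modn_small //; case: (_ < v)%N.
Qed.

Let multiplicity n a : \sum_(j < Q) ((n + c * j) %% Q == a)%N%:R <= c%:R :> R.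
Proof.
pose F y : R := ((n + y) %% Q == a)%N%:R.
have pF : periodic_mod Q F by move=> y; rewrite /F modnDmr.
apply: le_trans (@sum_dilate_le R Q c F Q0 c0 pF _) _; first by move=> y; exact: ler0n.
rewrite -[leRHS]mulr1 ler_pM2l ?ltr0n //.
pose G y : R := (y %% Q == a)%N%:R.
have pG : periodic_mod Q G by move=> y; rewrite /G modn_mod.
have -> : \sum_(y < Q) F y = \sum_(y < Q) G y.
  by rewrite -(sum_periodic_addr n pG); apply: eq_bigr => y _; rewrite /F addnC.
case: (ltnP a Q) => aQ; last first.
  rewrite big1 ?ler01 // => y _; rewrite /G modn_small //.
  by rewrite ltn_eqF // (leq_trans (ltn_ord y)).
rewrite (bigD1 (Ordinal aQ)) //= {1}/G modn_small // eqxx big1 ?addr0 //.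
move=> y ya; rewrite /G modn_small // (_ : (_ == _) = false) //.
by apply/negbTE; apply: contra ya => /eqP E; apply/eqP; apply: val_inj.
Qed.

(** Moving by one changes [h] only at the ends of the interval: it can increase at the residue
    [Q.-1] and decrease at [v.-1], and each residue is met at most [c] times. *)
Let cnt_step n : `|cnt n.+1 - cnt n| <= c%:R.
Proof.
have hs y : (h y.+1 - h y <= (y %% Q == Q.-1)%N%:R) /\ (h y - h y.+1 <= (y %% Q == v.-1)%N%:R).
  have yQ : (y %% Q < Q)%N by rewrite ltn_mod.
  have yS : (y.+1 %% Q = if y %% Q == Q.-1 then 0 else (y %% Q).+1)%N.
    rewrite -addn1 -modnDml addn1; case: eqP => [->|ne]; first by rewrite prednK // modnn.
    by rewrite modn_small //; lia.
  rewrite /h yS; move: (y %% Q)%N yQ => z zQ; clear yS.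
  split; apply: bool_sub_le; apply/implyP.
    by case: eqP => [//|_] zv; rewrite ?orbT // (ltnW zv).
  case: eqP => [_ zv|_ zv]; first by rewrite (leq_ltn_trans _ zv).
  case: (ltnP z.+1 v) => //= vz; apply/eqP; clear -zv vz.
  by lia.
have S1 : cnt n.+1 - cnt n <= c%:R.
  apply: le_trans (multiplicity n Q.-1); rewrite /cnt -sumrB; apply: ler_sum => j _.
  by rewrite addSn; exact: (hs _).1.
have S2 : cnt n - cnt n.+1 <= c%:R.
  apply: le_trans (multiplicity n v.-1); rewrite /cnt -sumrB; apply: ler_sum => j _.
  by rewrite addSn; exact: (hs _).2.
by rewrite ler_norml; lra.
Qed.

Let cnt_lip n d : `|cnt (n + d)%N - cnt n| <= d%:R * c%:R.
Proof.
elim: d => [|d IH]; first by rewrite addn0 subrr normr0 mul0r.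
rewrite -natr1 mulrDl mul1r addnS.
have -> : cnt (n + d).+1 - cnt n = (cnt (n + d)%N - cnt n) + (cnt (n + d).+1 - cnt (n + d)%N) by ring.
by apply: le_trans (ler_normD _ _) _; apply: lerD => //; exact: cnt_step.
Qed.

Let cnt_shift n t : cnt (n + c * t)%N = cnt n.
Proof.
rewrite /cnt -(sum_periodic_addr (F := fun j => h (n + c * j)%N) t).
  by apply: eq_bigr => j _; rewrite mulnDr addnCA addnC addnA.
by move=> j; apply: (periodicP h_periodic); rewrite -modnDmr modnMmr modnDmr.
Qed.

Let cnt_mean : \sum_(n < c) cnt n = c%:R * v%:R.
Proof.
rewrite mulr_natl -h_sum -sum_periodic_muln // sum_mul exchange_big /=.
by apply: eq_bigr => j _; apply: eq_bigr => n _; rewrite addnC mulnC.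
Qed.

(** The count depends on [n] modulo [c] only, changes by at most [c] from [n] to [n.+1], and has
    mean [v] over [c] consecutive [n]; so it stays within [c * c] of that mean. *)
Lemma interval_discrepancy n :
  `|\sum_(j < Q) ((n + c * j) %% Q < v)%N%:R - v%:R| <= c%:R ^+ 2 :> R.
Proof.
rewrite -/(cnt n) (divn_eq n c) addnC mulnC cnt_shift; set m := (n %% c)%N.
have mc : (m < c)%N by rewrite ltn_mod.
have cR : 0 < c%:R :> R by rewrite ltr0n.
rewrite -(ler_pM2l cR) -{1}(ger0_norm (ltW cR)) -normrM mulrBr -cnt_mean.
have -> : c%:R * cnt m = \sum_(i < c) cnt m by rewrite sumr_const card_ord -[in RHS]mulr_natl.
rewrite -sumrB; apply: le_trans (ler_norm_sum _ _ _) _; apply: ler_sum_ord => i.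
have lip a b : (a <= b)%N -> (b < c)%N -> `|cnt b - cnt a| <= c%:R ^+ 2.
  move=> ab bc; rewrite -{1}(subnKC ab); apply: le_trans (cnt_lip _ _) _.
  by rewrite expr2 ler_pM2r // ler_nat; apply: leq_trans (leq_subr _ _) (ltnW bc).
by case/orP: (leq_total i m) => le; [exact: lip|rewrite distrC; exact: lip].
Qed.

End IntervalDiscrepancy.

(** * Differencing on one box *)

Section BoxCorrelation.
Context {R : realType}.
Variables (q : nat) (f : nat -> R[i]) (K : R).
Hypothesis q2 : (2 <= q)%N.
Hypothesis fU : forall n, cabs (f n) = 1.
Hypothesis K1 : 1 <= K.
Hypothesis propK : forall lam kap rho, (rho < lam)%N ->
  #|propagation_exceptions q f lam kap rho|%:R
  <= K * weight q rho * (q ^ lam)%:R / (q ^ rho)%:R.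

Let q0 : (0 < q)%N. Proof. exact: q_gt0. Qed.
Let qn0 n : 0 < (q ^ n)%:R :> R. Proof. exact: expqR_gt0. Qed.
Let qnN n : (q ^ n)%:R != 0 :> R. Proof. exact: expqR_neq0. Qed.
Let qnD a b : (q ^ (a + b))%:R = (q ^ a)%:R * (q ^ b)%:R :> R.
Proof. by rewrite expnD natrM. Qed.
Let w1 rho : 1 <= weight q rho :> R. Proof. exact: weight_ge1. Qed.
Let w0 rho : 0 <= weight q rho :> R. Proof. exact: le_trans (w1 rho). Qed.
Let K0 : 0 <= K. Proof. exact: le_trans K1. Qed.

Variables (mu nu rho1 rho2 : nat) (theta : R) (b : nat -> R[i]) (Lb : R).
Hypotheses (mu0 : (0 < mu)%N) (rn : (rho2 + rho1 < nu)%N).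
Hypothesis bL : forall n, cabs (b n) <= Lb.
Let t := (mu + rho1 + rho2)%N.
Let v := (q ^ nu)%N.
Let H := (q ^ rho1)%N.

Definition box_term m n : R[i] :=
  if (n < q ^ nu)%N then b n * (f (m * n)%N * e (theta * (m * n)%:R)) else 0.

(** In the correlation at distance [r] the phase [e (theta * (m * n)%:R)] leaves this factor, free
    of [n]; the shift bound allows any coefficients in [m] of modulus at most one, hence uniformity
    in [theta]. *)
Definition twist r m : R[i] := e (theta * (m * r)%:R).

Definition box_weight r n : R[i] := (if (n + r < q ^ nu)%N then b (n + r)%N else 0) * cj (b n).

Definition fibre_sum r n : R[i] :=
  \sum_(m < q ^ mu | shell q mu m) twist r m * pair_phase q f t r m n.

Definition trunc_loss : R :=
  4 * q%:R * K * weight q rho2 * ((q ^ mu)%:R * (q ^ nu)%:R) / (q ^ rho2)%:R.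

Lemma twist_le1 r m : cabs (twist r m) <= 1.
Proof. by rewrite /twist cabs_e. Qed.

Lemma Lb_ge0 : 0 <= Lb. Proof. exact: le_trans (cabs_ge0 _) (bL 0). Qed.

Lemma box_weight_le r n : cabs (box_weight r n) <= Lb ^+ 2.
Proof.
have L0 := Lb_ge0; rewrite /box_weight cabsM cabsJ expr2; apply: ler_pM; rewrite ?cabs_ge0 //.
by case: ifP => _; rewrite ?cabs0.
Qed.

Lemma box_term_corr r m n : (n < q ^ nu)%N ->
  box_term m (n + r) * cj (box_term m n) =
  box_weight r n * (twist r m * (f (m * (n + r))%N * cj (f (m * n)%N))).
Proof.
move=> nv; rewrite /box_term nv /box_weight; case: ifP => _; last by rewrite !mul0r.
rewrite !conjcM conj_e /twist.
have -> : e (theta * (m * (n + r))%:R) = e (theta * (m * n)%:R) * e (theta * (m * r)%:R) :> R[i].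
  by rewrite -eD -mulrDr -natrD -mulnDr.
have E := eN (theta * (m * n)%:R : R).
set z := e (theta * (m * n)%:R) in E *; set z' := e (- _) in E *.
rewrite -[RHS]mulr1 -E; ring.
Qed.

Lemma box_corr0 : vdc_corr (q ^ mu) v (shell q mu) box_term 0 <= Lb ^+ 2 * ((q ^ mu)%:R * (q ^ nu)%:R).
Proof.
rewrite /vdc_corr; apply: le_trans (cabs_sum _ _ _) _.
rewrite mulrA [leRHS]mulrC; apply: ler_sum_ord => n.
apply: le_trans (cabs_sum _ _ _) _.
apply: (@le_trans _ _ (\sum_(m < q ^ mu | shell q mu m) Lb ^+ 2 * 1)).
  apply: ler_sum => m mM; rewrite box_term_corr // cabsM mulr1.
  by rewrite (cabsM (twist _ _)) /twist cabs_e cabsM cabsJ !fU !mulr1 box_weight_le.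
rewrite -mulr_sumr ler_wpM2l ?sqr_ge0 //; exact: shell_card.
Qed.

Lemma box_corr_trunc r : (r < q ^ rho1)%N ->
  vdc_corr (q ^ mu) v (shell q mu) box_term r <=
  cabs (\sum_(n < q ^ nu) box_weight r n * fibre_sum r n) + Lb ^+ 2 * trunc_loss.
Proof.
move=> rH; rewrite /vdc_corr.
have -> : \sum_(n < v) \sum_(m < q ^ mu | shell q mu m) box_term m (n + r) * cj (box_term m n) =
  \sum_(n < q ^ nu) box_weight r n * \sum_(m < q ^ mu | shell q mu m)
     twist r m * (f (m * (n + r))%N * cj (f (m * n)%N)).
  apply: eq_bigr => n _; rewrite mulr_sumr; apply: eq_bigr => m _.
  exact: box_term_corr.
set S1 := \sum_(n < q ^ nu) box_weight r n * fibre_sum r n.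
apply: le_trans (cabs_le_add _ S1) _; rewrite lerD2l /S1 -sumrB.
apply: le_trans (cabs_sum _ _ _) _.
have L2 : 0 <= Lb ^+ 2 by rewrite sqr_ge0.
apply: le_trans (ler_wpM2l L2 (trunc_error q2 fU K1 propK mu0 rn rH)).
rewrite mulr_sumr; apply: ler_sum => n _.
rewrite -mulrBr cabsM; apply: ler_pM; rewrite ?cabs_ge0 ?box_weight_le //.
rewrite /fibre_sum -sumrB; apply: le_trans (cabs_sum _ _ _) _; apply: ler_sum => m _.
by rewrite -mulrBr cabsM /twist cabs_e mul1r.
Qed.

Lemma box_vdc : (rho1 <= nu)%N ->
  \sum_(m < q ^ mu | shell q mu m)
    cabs (\sum_(n < q ^ nu) b n * (f (m * n)%N * e (theta * (m * n)%:R))) ^+ 2 <=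
  4 * (q ^ nu)%:R / (q ^ rho1)%:R *
    \sum_(r < q ^ rho1) vdc_corr (q ^ mu) v (shell q mu) box_term r.
Proof.
move=> r1n; have H0 : (0 < q ^ rho1)%N by rewrite expn_gt0 q0.
have cV m n : (v <= n)%N -> box_term m n = 0 by move=> vn; rewrite /box_term ltnNge vn.
have := vdc (q ^ mu) (shell q mu) H0 cV.
have -> : \sum_(m < q ^ mu | shell q mu m) cabs (\sum_(n < v) box_term m n) ^+ 2 =
  \sum_(m < q ^ mu | shell q mu m)
    cabs (\sum_(n < q ^ nu) b n * (f (m * n)%N * e (theta * (m * n)%:R))) ^+ 2.
  apply: eq_bigr => m _; congr (cabs _ ^+ 2); apply: eq_bigr => n _.
  by rewrite /box_term ltn_ord.
move/le_trans; apply; rewrite ler_wpM2r //; first by apply: sumr_ge0 => r _; exact: cabs_ge0.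
rewrite ler_pM2r ?invr_gt0 // natrD.
have : (q ^ rho1)%:R <= (q ^ nu)%:R :> R by rewrite ler_nat leq_exp2l.
by rewrite -/v; lra.
Qed.

Lemma fibre_sumE r n : fibre_sum r n = (q ^ mu)%:R * fibre_mean q f mu t r (twist r) n.
Proof.
rewrite /fibre_mean mulVKf; last by rewrite pnatr_eq0 -lt0n expn_gt0 q0.
rewrite /fibre_sum; apply: (widen_sum (fun m => twist r m * pair_phase q f t r m n)).
  by rewrite leq_exp2l // /t -addnA leq_addr.
exact: shell_lt.
Qed.

Lemma shell_twist_lt r m : (r < q ^ rho1)%N -> shell q mu m -> (m * r < q ^ t)%N.
Proof.
move=> rH mM; apply: leq_trans (_ : q ^ (mu + rho1) <= _)%N; last by rewrite leq_exp2l // leq_addr.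
rewrite expnD; apply: leq_ltn_trans (_ : m * q ^ rho1 < _)%N.
  by rewrite leq_mul2l (ltnW rH) orbT.
by rewrite ltn_pmul2r ?expn_gt0 ?q0 // (shell_lt mM).
Qed.

End BoxCorrelation.

Lemma sqrt_bound (R : realType) (s Q C x : R) : 0 <= s -> 0 < Q -> 1 <= C -> 0 <= x ->
  s ^+ 2 <= Q * (Q * (C * x ^+ 2)) -> s <= Q * (C * x).
Proof.
move=> s0 Q0 C1 x0 H; have C0 : 0 <= C := le_trans ler01 C1.
rewrite -ler_sqr ?nnegrE //; last by nneg.
apply: le_trans H _; rewrite !exprMn mulrA -expr2 ler_pM2l ?exprn_gt0 //.
by rewrite ler_wpM2r ?sqr_ge0 // expr2 ler_peMr.
Qed.

Section TypeTwo.
Context {R : realType}.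
Variables (q : nat) (f : nat -> R[i]) (K : R).
Hypothesis q2 : (2 <= q)%N.
Hypothesis fU : forall n, cabs (f n) = 1.
Hypothesis K1 : 1 <= K.
Hypothesis propK : forall lam kap rho, (rho < lam)%N ->
  #|propagation_exceptions q f lam kap rho|%:R
  <= K * weight q rho * (q ^ lam)%:R / (q ^ rho)%:R.

(** Differencing with [q ^ (2 * s)] distances and [2 * s] additional digits gives the period
    [q ^ t], [t = mu + 4 * s]. The distance 0, one among [q ^ (2 * s)], is bounded trivially; the
    others follow from [fibre_mean_square] by Cauchy-Schwarz in [n], since [t <= nu] makes the range
    a union of full periods. *)
Lemma type_two_square mu nu s theta (b : nat -> R[i]) Lb Mf Cf :
  (0 < s)%N -> (8 * s < mu)%N -> (mu + 4 * s <= nu)%N -> 0 <= Cf ->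
  (forall n, cabs (b n) <= Lb) ->
  fourier_sup q f (mu + 4 * s) Mf -> Mf ^+ 2 * (q ^ (36 * s))%:R <= Cf ->
  \sum_(m < q ^ mu | shell q mu m)
    cabs (\sum_(n < q ^ nu) b n * (f (m * n)%N * e (theta * (m * n)%:R))) ^+ 2 <=
  8 * (2 * Cf + (36 * q%:R + 16) * K + 1) * weight q (12 * s) * Lb ^+ 2 *
   ((q ^ mu)%:R * (q ^ nu)%:R ^+ 2) / (q ^ (2 * s))%:R.
Proof.
move=> s0 smu munu Cf0 bL FM FC.
have mu0 : (0 < mu)%N by lia.
have tE : (mu + 2 * s + 2 * s = mu + 4 * s)%N by lia.
have rn : (2 * s + 2 * s < nu)%N by lia.
have r1n : (2 * s <= nu)%N by lia.
have E42 : (4 * s = 2 * s * 2)%N by lia.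
have w212 : (2 * s <= 12 * s)%N by lia.
have nuE : (mu + 4 * s + (nu - (mu + 4 * s)) = nu)%N by lia.
set w : R := weight q (12 * s); set C2 := 2 * Cf + (32 * q%:R + 16) * K + 1.
have w1 : 1 <= w := weight_ge1 q2 _.
have K0 : 0 <= K := le_trans ler01 K1.
have w0 : 0 <= w := le_trans ler01 w1.
have C21 : 1 <= C2.
  by rewrite /C2 lerDr; nneg.
set x := ((q ^ (2 * s))%:R : R)^-1.
have x0 : 0 < x by rewrite invr_gt0 expqR_gt0.
have x4 : ((q ^ (4 * s))%:R : R)^-1 = x ^+ 2 by rewrite E42 expnM natrX exprVn.
set A : R := (q ^ mu)%:R; set V : R := (q ^ nu)%:R.
have A0 : 0 < A by exact: expqR_gt0.
have V0 : 0 < V by exact: expqR_gt0.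
have L0 : 0 <= Lb := le_trans (cabs_ge0 _) (bL 0%N).
set t := (mu + 4 * s)%N in tE nuE FM.
have Q0 : (0 < q ^ t)%N by exact: expq_gt0.
have C2w : 1 <= C2 * w by rewrite -[leLHS]mulr1; apply: ler_pM.
have Tn r : (0 < r < q ^ (2 * s))%N ->
    \sum_(n < q ^ nu) cabs (fibre_sum q f mu (2 * s) (2 * s) theta r n) <= A * V * (C2 * w * x).
  move=> /andP[r0 rH].
  pose F n := cabs (fibre_mean q f mu t r (twist theta r) n).
  have pF : periodic_mod (q ^ t) F by move=> n; rewrite /F fibre_mean_periodic.
  have -> : \sum_(n < q ^ nu) cabs (fibre_sum q f mu (2 * s) (2 * s) theta r n) =
      A * ((q ^ (nu - t))%:R * \sum_(n < q ^ t) F n).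
    rewrite mulr_natl -sum_periodic_muln // -expnD nuE mulr_sumr; apply: eq_bigr => n _.
    by rewrite fibre_sumE // tE cabsM cabs_nat.
  rewrite -mulrA ler_pM2l //.
  have -> : V = (q ^ (nu - t))%:R * (q ^ t)%:R by rewrite -natrM -expnD addnC nuE.
  rewrite -[leRHS]mulrA ler_pM2l ?expqR_gt0 //.
  apply: sqrt_bound => //; [by apply: sumr_ge0 => n _; exact: cabs_ge0|exact: expqR_gt0|exact: ltW|].
  have rQ m : shell q mu m -> (m * r < q ^ t)%N.
    by move=> mM; rewrite -tE; exact: shell_twist_lt.
  have := fibre_mean_square q2 fU K1 propK mu0 (twist_le1 theta r) rQ r0 s0 erefl smu Cf0 FM FC.
  rewrite x4 -/C2 -/w => H.
  have := sqr_sum1_le xpredT (fun n : 'I_(q ^ t) => F n); rewrite card_ord.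
  move/le_trans; apply; rewrite ler_pM2l ?expqR_gt0 //.
have corr r : (0 < r < q ^ (2 * s))%N ->
    vdc_corr (q ^ mu) (q ^ nu) (shell q mu) (box_term q f nu theta b) r <=
    Lb ^+ 2 * (A * V) * ((C2 + 4 * q%:R * K) * w * x).
  move=> rr; have /andP[r0 rH] := rr.
  apply: le_trans (box_corr_trunc q2 fU K1 propK theta mu0 rn bL rH) _.
  have -> : Lb ^+ 2 * (A * V) * ((C2 + 4 * q%:R * K) * w * x) =
    Lb ^+ 2 * (A * V * (C2 * w * x)) + Lb ^+ 2 * (4 * q%:R * K * w * (A * V) * x) by ring.
  apply: lerD.
    apply: le_trans (cabs_sum _ _ _) _.
    apply: le_trans (ler_wpM2l (sqr_ge0 _) (Tn r rr)); rewrite mulr_sumr; apply: ler_sum => n _.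
    by rewrite cabsM ler_wpM2r ?cabs_ge0 // box_weight_le.
  rewrite /trunc_loss -/A -/V -/x ler_wpM2l ?sqr_ge0 // ler_pM2r // ler_wpM2r ?mulr_ge0 ?(ltW A0) ?(ltW V0) //.
  by apply: ler_wpM2l; [nneg|exact: weight_le].
apply: le_trans (box_vdc f q2 mu theta b r1n) _.
set H := (q ^ (2 * s))%N in Tn corr *.
have H0 : (0 < H)%N by exact: expq_gt0.
have Hx : (H%:R : R) = x^-1 by rewrite /x invrK.
set C3 := C2 + 4 * q%:R * K in corr *.
have C31 : 1 <= C3 by rewrite /C3 -[leLHS]addr0; apply: lerD => //; nneg.
have sum_corr : \sum_(r < H) vdc_corr (q ^ mu) (q ^ nu) (shell q mu) (box_term q f nu theta b) r <=
    Lb ^+ 2 * (A * V) * (2 * (C3 * w)).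
  rewrite -(prednK H0) big_ord_recl.
  have -> : Lb ^+ 2 * (A * V) * (2 * (C3 * w)) = Lb ^+ 2 * (A * V) * (C3 * w) + Lb ^+ 2 * (A * V) * (C3 * w) by ring.
  have LAV : 0 <= Lb ^+ 2 * (A * V) by rewrite mulr_ge0 ?sqr_ge0 // mulr_ge0 // ltW.
  have C3w : 1 <= C3 * w by rewrite -[leLHS]mulr1; apply: ler_pM.
  apply: lerD.
    apply: le_trans (box_corr0 q fU _ _ _ bL) _.
    by rewrite -[leLHS]mulr1 ler_wpM2l.
  apply: (@le_trans _ _ (H.-1%:R * (Lb ^+ 2 * (A * V) * (C3 * w * x)))).
    apply: ler_sum_ord => i; apply: corr; rewrite /= /bump /= add1n.
    by rewrite -ltn_predRL.
  have : H.-1%:R <= x^-1 by rewrite -Hx ler_nat leq_pred.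
  move=> Hle; apply: (@le_trans _ _ (x^-1 * (Lb ^+ 2 * (A * V) * (C3 * w * x)))).
    rewrite ler_wpM2r // mulr_ge0 // mulr_ge0 ?(ltW x0) //; exact: le_trans C3w.
  by apply: eq_le; field; rewrite gt_eqF.
have VH : 0 <= 4 * V / H%:R by rewrite !mulr_ge0 ?invr_ge0 ?ler0n ?(ltW V0).
apply: le_trans (ler_wpM2l VH sum_corr) _; rewrite Hx; apply: eq_le.
by rewrite /C3 /C2 invrK; ring.
Qed.

End TypeTwo.

(** * Type I sums *)

(** Grouping the pairs by the product [a = m r] gives at most [ndiv a] pairs for each [a]; then
    Cauchy-Schwarz in [a]. *)
Lemma pair_sum_le (R : realType) (P : pred nat) (x : nat -> R) A W H :
  (H <= W)%N -> (forall a, 0 <= x a) -> (forall m, P m -> (0 < m)%N) ->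
  (forall m r, P m -> (r < H)%N -> (m * r < W)%N) ->
  (\sum_(m < A | P m) \sum_(r < H | (0 < r)%N) x (m * r)%N) ^+ 2 <=
  (\sum_(a < W) (ndiv a)%:R ^+ 2) * \sum_(a < W) x a ^+ 2.
Proof.
move=> HW x0 P0 PW; pose G n := if (n < W)%N then x n else 0.
have G0 n : 0 <= G n by rewrite /G; case: ifP.
have S1 : \sum_(m < A | P m) \sum_(r < H | (0 < r)%N) x (m * r)%N <=
    \sum_(a < W) (ndiv a)%:R * x a.
  apply: (@le_trans _ _ (\sum_(m < A | P m) \sum_(n < W | (0 < n)%N && (m %| n)%N) G n)).
    apply: ler_sum => m Pm; rewrite -(sum_multiples (P0 m Pm)); last first.
      by move=> n Wn; rewrite /G ltnNge Wn.
    rewrite (big_ord_widen_cond W (fun r => 0 < r)%N (fun r => x (m * r)%N) HW).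
    rewrite big_mkcond [leRHS]big_mkcond /=; apply: ler_sum => r _.
    case: ifP => [/andP[-> rH]|_]; first by rewrite /G PW.
    by case: ifP.
  rewrite (exchange_big_dep (fun n : 'I_W => (0 < n)%N)) /=; last by move=> m n _ /andP[].
  rewrite big_mkcond /=; apply: ler_sum => n _; case: ifP => [n0|_]; last by rewrite mulr_ge0.
  rewrite /G ltn_ord.
  have -> : \sum_(m < A | [&& P m, (0 < n)%N & (m %| n)%N]) x n =
      (\sum_(m < A | P m && (m %| n)) 1)%N%:R * x n.
    by rewrite natr_sum mulr_suml; apply: eq_big => [m|m _]; [rewrite n0|rewrite mul1r].
  by rewrite ler_wpM2r // ler_nat; exact: ndiv_ge.
apply: le_trans (sqr_sum_le _ _ _ _); rewrite ler_sqr ?nnegrE //.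
  by apply: sumr_ge0 => m _; apply: sumr_ge0.
by apply: sumr_ge0 => a _; rewrite mulr_ge0.
Qed.

Section TypeOne.
Context {R : realType}.
Variables (q : nat) (f : nat -> R[i]) (K : R).
Hypothesis q2 : (2 <= q)%N.
Hypothesis fU : forall n, cabs (f n) = 1.
Hypothesis K1 : 1 <= K.
Hypothesis propK : forall lam kap rho, (rho < lam)%N ->
  #|propagation_exceptions q f lam kap rho|%:R
  <= K * weight q rho * (q ^ lam)%:R / (q ^ rho)%:R.

Let q0 : (0 < q)%N. Proof. exact: q_gt0. Qed.
Let qn0 n : 0 < (q ^ n)%:R :> R. Proof. exact: expqR_gt0. Qed.
Let qnN n : (q ^ n)%:R != 0 :> R. Proof. exact: expqR_neq0. Qed.
Let w1 rho : 1 <= weight q rho :> R. Proof. exact: weight_ge1. Qed.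
Let w0 rho : 0 <= weight q rho :> R. Proof. exact: le_trans (w1 rho). Qed.
Let K0 : 0 <= K. Proof. exact: le_trans K1. Qed.

Definition unit_ind n : R[i] := (coprime n q)%:R.

Lemma unit_ind_le1 n : cabs (unit_ind n) <= 1.
Proof. by rewrite /unit_ind; case: coprime; rewrite ?cabs1 ?cabs0. Qed.

Lemma unit_ind_conj n : cj (unit_ind n) = unit_ind n.
Proof. by rewrite /unit_ind conjc_nat. Qed.

Lemma unit_ind_mod c n : (q %| c)%N -> unit_ind (n + c) = unit_ind n.
Proof.
move=> qc; rewrite /unit_ind -coprime_modl -modnDmr (eqP qc) addn0.
by rewrite coprime_modl.
Qed.

Lemma unit_ind_mul m n : coprime m q -> unit_ind (m * n) = unit_ind n.
Proof. by move=> cm; rewrite /unit_ind coprimeMl cm. Qed.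

Lemma unit_ind_periodic t : (0 < t)%N -> periodic_mod (q ^ t) unit_ind.
Proof.
move=> t0 n; rewrite {2}(divn_eq n (q ^ t)) addnC unit_ind_mod //.
by rewrite dvdn_mull // -{1}(expn1 q) dvdn_exp2l.
Qed.

Section UnitCorr.
Variable t : nat.
Let Q := (q ^ t)%N.
Hypothesis t0 : (0 < t)%N.

Definition unit_corr a : R[i] := Q%:R^-1 * \sum_(X < Q)
  (unit_ind (X + a) * unit_ind X) * (trunc q f t (X + a) * cj (trunc q f t X)).

Let QN : (Q%:R : R[i]) != 0.
Proof. by rewrite pnatr_eq0 -lt0n expn_gt0 q0. Qed.

(** As [q] divides [c], the indicators of units are constant along progressions of step [c];
    averaging over such a progression first therefore turns the correlation into the local [corr],
    and Cauchy-Schwarz in [X] concludes. *)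
Lemma unit_corr_sqr c a : (q %| c)%N ->
  cabs (unit_corr a) ^+ 2 <= corr_energy q t c (trunc q f t) a.
Proof.
move=> qc.
have pu := unit_ind_periodic t0.
pose F X := (unit_ind (X + a) * unit_ind X) * (trunc q f t (X + a) * cj (trunc q f t X)).
have pF : periodic_mod Q F.
  move=> X; rewrite /F (periodicP pu (n := X + a)) ?modnDml // pu.
  by congr (_ * (_ * cj _)); apply: trunc_mod; rewrite ?modn_mod // modnDml.
have -> : unit_corr a = Q%:R^-1 * \sum_(X < Q) (unit_ind (X + a) * unit_ind X) * corr q t c (trunc q f t) a X.
  rewrite /unit_corr -/F; congr (_ * _).
  transitivity (Q%:R^-1 * \sum_(j < Q) \sum_(X < Q) F (X + c * j)%N).
    under [in RHS]eq_bigr => j _ do rewrite (sum_periodic_addr (c * j) pF).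
    by rewrite mean_const // expn_gt0 q0.
  rewrite exchange_big mulr_sumr; apply: eq_bigr => X _.
  rewrite /corr [RHS]mulrCA -/Q; congr (_ * _); rewrite mulr_sumr; apply: eq_bigr => j _.
  have qcj : (q %| c * j)%N by rewrite dvdn_mulr.
  by rewrite /F (addnAC X (c * j) a) (unit_ind_mod (X + a) qcj) (unit_ind_mod X qcj).
rewrite cabsM cabsV cabs_nat exprMn exprVn /corr_energy -/Q.
have QR : 0 < (Q%:R : R) by exact: qn0.
rewrite expr2 invfM -mulrA ler_pM2l ?invr_gt0 // mulrC ler_pdivrMr // mulrC.
apply: le_trans (cabs_CS _ _ _ _) _; rewrite ler_wpM2r //.
  by apply: sumr_ge0 => X _; rewrite sqr_ge0.
rewrite -[leRHS]mulr1; apply: ler_sum_ord => X; rewrite expr_le1 ?cabs_ge0 // cabsM.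
by rewrite -[leRHS]mulr1; apply: ler_pM; rewrite ?cabs_ge0 ?unit_ind_le1.
Qed.

Lemma unit_corr_sum rho Mf : (rho.+1 < t)%N -> fourier_sup q f t Mf ->
  \sum_(a < Q) cabs (unit_corr a) ^+ 2 <=
  Q%:R * (2 * (q ^ rho.+1)%:R * Mf ^+ 2 + 32 * (K * weight q rho / (q ^ rho)%:R)).
Proof.
move=> rt FM; set c := (q ^ rho.+1)%N.
have c0 : (0 < c)%N by rewrite expn_gt0 q0.
have qc : (q %| c)%N by rewrite /c expnS dvdn_mulr.
apply: (@le_trans _ _ (\sum_(a < Q) (2 * corr_energy q t c (coarse q f t) a +
    32 * (K * weight q rho / (q ^ rho)%:R)))).
  apply: ler_sum => a _; apply: le_trans (unit_corr_sqr a qc) _.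
  exact: (corr_energy_le q2 fU K1 propK rt (dvdnn _) c0).
rewrite big_split /= -mulr_sumr mulrDr; apply: lerD.
  have := corr_energy_sum q2 fU K1 propK rt (dvdnn _) c0 FM; rewrite -/Q -/c => H.
  have two : 0 <= 2 :> R by [].
  by apply: le_trans (ler_wpM2l two H) _; apply: eq_le; ring.
by rewrite sumr_const card_ord -[_ *+ Q]mulr_natl.
Qed.

(** Multiplication by the unit [m] preserves coprimality to [q], so the weights are functions of
    [m n] too, and [X = m n] can be substituted. *)
Lemma pair_unit_corr r m : coprime m q ->
  \sum_(n < Q) (unit_ind (n + r) * unit_ind n) * pair_phase q f t r m n =
  Q%:R * unit_corr (m * r).
Proof.
move=> cm; rewrite /unit_corr mulVKf //.
have cmQ : coprime m Q by rewrite coprimeXr.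
have pu := unit_ind_periodic t0.
pose F X := (unit_ind (X + m * r) * unit_ind X) *
   (trunc q f t (X + m * r) * cj (trunc q f t X)).
have pF : periodic_mod Q F.
  move=> X; rewrite /F (periodicP pu (n := X + m * r)) ?modnDml // pu.
  by congr (_ * (_ * cj _)); apply: trunc_mod; rewrite ?modn_mod // modnDml.
rewrite -(sum_periodic_mul cmQ pF); apply: eq_bigr => n _.
by rewrite /F -mulnDr !unit_ind_mul // mulnDr.
Qed.

End UnitCorr.

Section Box.
Variables (mu nu rho1 s : nat) (theta Mf Cf hh : R).
Let t := (mu + rho1 + 2 * s)%N.
Let Q := (q ^ t)%N.
Let H := (q ^ rho1)%N.
Let A : R := (q ^ mu)%:R.
Let V : R := (q ^ nu)%:R.
Let x : R := ((q ^ (2 * s))%:R)^-1.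
Let w : R := weight q (12 * s).
Hypotheses (mu0 : (0 < mu)%N) (s0 : (0 < s)%N) (rho1s : (2 * s <= rho1)%N).
Hypotheses (rn : (rho1 + 2 * s < nu)%N) (t6 : (6 * s < t)%N).
Hypotheses (Cf0 : 0 <= Cf) (FM : fourier_sup q f t Mf).
Hypothesis FC : Mf ^+ 2 * (q ^ (36 * s))%:R <= Cf.
Hypothesis hh1 : 1 <= hh.
Hypothesis hhP : \sum_(a < q ^ (mu + rho1)) (ndiv a)%:R ^+ 2 <= (q ^ (mu + rho1))%:R * hh ^+ 2.

Definition type_one_const (C0 : R) : R := 4 * (C0 + 2 * Cf + 36 * q%:R * K + 3).

Let t0 : (0 < t)%N. Proof. by rewrite /t -addnA ltn_addr. Qed.
Let A0 : 0 < A. Proof. exact: qn0. Qed.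
Let V0 : 0 < V. Proof. exact: qn0. Qed.
Let x0 : 0 < x. Proof. by rewrite /x invr_gt0. Qed.
Let xV : (q ^ (2 * s))%:R = x^-1. Proof. by rewrite /x invrK. Qed.

Let xpow n : (q ^ (2 * s * n))%:R = x ^- n.
Proof. by rewrite expnM natrX xV exprVn. Qed.

(** The correlations are summed over [a < W] but controlled over [a < Q], a range [x^-1] times
    longer. The choice [rho = (6 * s).-1] gains [x^3], of which [x^2] remains, and the root of this
    is the factor [x]. The divisor function enters through [hh]. *)
Let pair_bound :
  \sum_(m < q ^ mu | shell q mu m) \sum_(r < H | (0 < r)%N) cabs (unit_corr t (m * r)) <=
  A * H%:R * (hh * (2 * Cf + 32 * q%:R * K) * w * x) * 1 + A * H%:R * hh * w * x.
Proof.
have E6 : (6 * s = (6 * s).-1.+1)%N by rewrite prednK // muln_gt0.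
have ex3 : (6 * s = 2 * s * 3)%N by clear; lia.
have ex18 : (36 * s = 2 * s * 18)%N by clear; lia.
have le12 : ((6 * s).-1 <= 12 * s)%N by clear; lia.
pose W := (q ^ (mu + rho1))%N.
have HW : (H <= W)%N by rewrite leq_exp2l // leq_addl.
have WQ : (W <= Q)%N by rewrite leq_exp2l // leq_addr.
have P0 m : shell q mu m -> (0 < m)%N.
  by move=> /and3P[lo _ _]; apply: leq_trans lo; rewrite expn_gt0 q0.
have PW m r : shell q mu m -> (r < H)%N -> (m * r < W)%N.
  move=> mM rH; have := shell_twist_lt q2 0 rH mM; by rewrite addn0.
have C0' : 0 <= 2 * Cf + 32 * q%:R * K by have := K0 => ?; nneg.
set C4 := 2 * Cf + 32 * q%:R * K in C0' *.
have w1' : 1 <= w := w1 _.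
have hh0 : 0 <= hh := le_trans ler01 hh1.
have := pair_sum_le (q ^ mu) HW (fun a => cabs_ge0 (unit_corr t a)) P0 PW.
set S := \sum_(m < _ | _) _ => S2.
have Qs : (Q%:R : R) = W%:R * x^-1 by rewrite /Q /t expnD natrM xV.
have S3 : \sum_(a < W) cabs (unit_corr t a) ^+ 2 <= W%:R * (C4 * w * x ^+ 2).
  apply: (@le_trans _ _ (\sum_(a < Q) cabs (unit_corr t a) ^+ 2)).
    rewrite (big_ord_widen Q (fun a => cabs (unit_corr t a) ^+ 2) WQ).
    rewrite [leRHS](bigID (fun a : 'I_Q => (a < W)%N)) /= lerDl.
    by apply: sumr_ge0 => a _; rewrite sqr_ge0.
  have rt : ((6 * s).-1.+1 < t)%N by rewrite -E6.
  apply: le_trans (unit_corr_sum t0 rt FM) _; rewrite -/Q Qs -[leLHS]mulrA.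
  rewrite ler_pM2l; last by rewrite ltr0n expn_gt0 q0.
  rewrite mulrC ler_pdivrMr //.
  have -> : C4 * w * x ^+ 2 * x = 2 * Cf * x ^+ 3 * w + 32 * q%:R * K * x ^+ 3 * w by rewrite /C4; ring.
  have x1 : x <= 1 by rewrite /x invf_le1 // ler1n expn_gt0 q0.
  apply: lerD.
    have M18 : Mf ^+ 2 <= Cf * x ^+ 18.
      by rewrite -ler_pdivrMr ?exprn_gt0 //; apply: le_trans FC; apply: eq_le; rewrite ex18 xpow.
    have -> : (q ^ (6 * s).-1.+1)%:R = x ^- 3 :> R by rewrite -E6 ex3 xpow.
    apply: (@le_trans _ _ (2 * x ^- 3 * (Cf * x ^+ 18))).
      by rewrite ler_pM2l // mulr_gt0 // invr_gt0 exprn_gt0.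
    apply: (@le_trans _ _ (2 * Cf * x ^+ 15)).
      by apply: eq_le; field; rewrite gt_eqF.
    have x0' := ltW x0.
    apply: (@le_trans _ _ (2 * Cf * x ^+ 3)); last by apply: ler_peMr => //; nneg.
    by apply: ler_wpM2l; [nneg|apply: ler_wiXn2l].
  have wl : weight q (6 * s).-1 <= w by exact: weight_le.
  have -> : 32 * (K * weight q (6 * s).-1 / (q ^ (6 * s).-1)%:R) =
     32 * q%:R * K * x ^+ 3 * weight q (6 * s).-1.
    have -> : x ^+ 3 = (q%:R * (q ^ (6 * s).-1)%:R)^-1.
      by rewrite -natrM -expnS -E6 ex3 xpow invrK.
    by apply: shift_arith1 => //; rewrite pnatr_eq0 -lt0n.
  by rewrite ler_wpM2l //; have := K0 => ?; nneg.
have WE : A * H%:R = W%:R by rewrite /A /W /H -natrM -expnD.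
rewrite WE.
have S0 : 0 <= S by apply: sumr_ge0 => m _; apply: sumr_ge0 => r _; exact: cabs_ge0.
have -> : W%:R * (hh * C4 * w * x) * 1 + W%:R * hh * w * x = W%:R * ((C4 + 1) * w * (hh * x)) by ring.
apply: sqrt_bound => //.
- by rewrite ltr0n expn_gt0 q0.
- by rewrite -[leLHS]mulr1; apply: ler_pM => //; rewrite lerDr.
- by rewrite mulr_ge0 // ltW.
apply: le_trans S2 _.
apply: (@le_trans _ _ (W%:R * hh ^+ 2 * (W%:R * (C4 * w * x ^+ 2)))).
  apply: ler_pM => //.
  - by apply: sumr_ge0 => a _; rewrite sqr_ge0.
  - by apply: sumr_ge0 => a _; rewrite sqr_ge0.
have W0 : 0 <= W%:R :> R by [].
have -> : W%:R * hh ^+ 2 * (W%:R * (C4 * w * x ^+ 2)) = W%:R * (W%:R * (C4 * w * (hh * x) ^+ 2)) by ring.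
rewrite ler_wpM2l // ler_wpM2l // ler_wpM2r ?sqr_ge0 // ler_wpM2r ?(le_trans ler01 w1') //.
by rewrite lerDl.
Qed.

(** The bound for the sum over [n] is taken as a hypothesis, as it is obtained in different ways
    according to whether the range of [n] contains a full period [Q]. *)
Lemma type_one_square (C0 : R) : 0 <= C0 ->
  (forall r, (0 < r < H)%N ->
     cabs (\sum_(n < q ^ nu) (unit_ind (n + r) * unit_ind n) * fibre_sum q f mu rho1 (2 * s) theta r n)
     <= C0 * w * (A * V) * x + V * \sum_(m < q ^ mu | shell q mu m) cabs (unit_corr t (m * r))) ->
  \sum_(m < q ^ mu | shell q mu m)
    cabs (\sum_(n < q ^ nu) unit_ind n * (f (m * n)%N * e (theta * (m * n)%:R))) ^+ 2 <=
  type_one_const C0 * w * hh * ((q ^ mu)%:R * (q ^ nu)%:R ^+ 2) / (q ^ (2 * s))%:R.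
Proof.
move=> C00 main.
have w1' : 1 <= w := w1 _.
have w0' : 0 <= w := le_trans ler01 w1'.
have hh0 : 0 <= hh := le_trans ler01 hh1.
have K0' := K0.
have r1n : (rho1 <= nu)%N by apply: leq_trans (ltnW rn); rewrite leq_addr.
have rn' : (2 * s + rho1 < nu)%N by rewrite addnC.
have H0 : (0 < H)%N by rewrite expn_gt0 q0.
have HV : (H <= q ^ nu)%N by rewrite leq_exp2l.
have Hx : H%:R <= V * x.
  rewrite /V /x ler_pdivlMr // -natrM -expnD ler_nat leq_exp2l //; exact: ltnW.
have xH : 1 <= H%:R * x by rewrite /x ler_pdivlMr // mul1r ler_nat leq_exp2l.
have AV0 : 0 <= A * V by rewrite mulr_ge0 // ltW.
have x0' := ltW x0; have A0' := ltW A0; have V0' := ltW V0.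
have fs r n : cabs (fibre_sum q f mu rho1 (2 * s) theta r n) <= A.
  apply: le_trans (cabs_sum _ _ _) _; apply: le_trans (shell_card q mu (q ^ mu)).
  by apply: ler_sum => m _; rewrite cabsM /twist cabs_e mul1r pair_phase_unit.
have corr r : (0 < r < H)%N ->
    vdc_corr (q ^ mu) (q ^ nu) (shell q mu) (box_term q f nu theta unit_ind) r <=
    V * \sum_(m < q ^ mu | shell q mu m) cabs (unit_corr t (m * r)) +
    (C0 + 1 + 4 * q%:R * K) * w * (A * V) * x.
  move=> rr; have /andP[r0 rH] := rr.
  apply: le_trans (box_corr_trunc q2 fU K1 propK theta mu0 rn' unit_ind_le1 rH) _.
  rewrite expr1n mul1r.
  have -> : (C0 + 1 + 4 * q%:R * K) * w * (A * V) * x =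
    C0 * w * (A * V) * x + w * (A * V) * x + 4 * q%:R * K * w * (A * V) * x by ring.
  rewrite !addrA; apply: lerD; last first.
    rewrite /trunc_loss -/A -/V -/x ler_pM2r // ler_wpM2r //.
    apply: ler_wpM2l; first by nneg.
    by apply: weight_le => //; rewrite leq_mul2r orbT.
  (* The condition [n + r < q ^ nu] in [box_weight] is dropped at the cost of the last [r] values of
     [n]. *)
  set S1 := \sum_(n < q ^ nu) (unit_ind (n + r) * unit_ind n) * fibre_sum q f mu rho1 (2 * s) theta r n.
  apply: le_trans (cabs_le_add _ S1) _; rewrite [V * _ + _]addrC; apply: lerD.
    exact: main.
  rewrite /S1 -sumrB; apply: le_trans (cabs_sum _ _ _) _.
  apply: (@le_trans _ _ (\sum_(n < q ^ nu) (q ^ nu - r <= n < q ^ nu - r + r)%N%:R * A)).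
    apply: ler_sum => n _; rewrite -mulrBl cabsM; apply: ler_pM; rewrite ?cabs_ge0 ?fs //.
    rewrite /box_weight unit_ind_conj subnK; last by apply: leq_trans HV; exact: ltnW.
    rewrite ltn_ord andbT leq_subLR; case: (ltnP (n + r) (q ^ nu)) => nr.
      by rewrite subrr cabs0.
    rewrite mul0r sub0r cabsN [(r + n)%N]addnC nr cabsM -[leRHS]mulr1.
    by apply: ler_pM; rewrite ?cabs_ge0 //; exact: unit_ind_le1.
  rewrite -mulr_suml.
  apply: (@le_trans _ _ (H%:R * A)).
    rewrite ler_pM2r // -natr_sum ler_nat; apply: leq_trans (count_interval _ _ _) _.
    exact: ltnW.
  apply: (@le_trans _ _ (1 * (A * V) * x)).
    by rewrite mul1r mulrC -mulrA ler_pM2l.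
  by rewrite ler_pM2r // ler_wpM2r.
apply: le_trans (box_vdc f q2 mu theta unit_ind r1n) _; rewrite -/H.
have sum_corr : \sum_(r < H) vdc_corr (q ^ mu) (q ^ nu) (shell q mu) (box_term q f nu theta unit_ind) r <=
    H%:R * ((C0 + 2 * Cf + 36 * q%:R * K + 3) * w * hh * (A * V) * x).
  have split0 : \sum_(r < H) vdc_corr (q ^ mu) (q ^ nu) (shell q mu) (box_term q f nu theta unit_ind) r =
     vdc_corr (q ^ mu) (q ^ nu) (shell q mu) (box_term q f nu theta unit_ind) 0 +
     \sum_(r < H | (0 < r)%N) vdc_corr (q ^ mu) (q ^ nu) (shell q mu) (box_term q f nu theta unit_ind) r.
    rewrite (bigID (fun r : 'I_H => (0 < r)%N)) /= addrC; congr (_ + _).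
    rewrite (bigD1 (Ordinal H0)) //= big1 ?addr0 // => r /andP[]; rewrite -leqNgt leqn0 => /eqP r0.
    by case/eqP; apply: val_inj.
  rewrite split0.
  have c0 : vdc_corr (q ^ mu) (q ^ nu) (shell q mu) (box_term q f nu theta unit_ind) 0 <=
      H%:R * (hh * w * (A * V) * x).
    apply: le_trans (box_corr0 q fU _ _ _ unit_ind_le1) _; rewrite expr1n mul1r -/A -/V.
    have -> : H%:R * (hh * w * (A * V) * x) = (H%:R * x) * (hh * w) * (A * V) by ring.
    rewrite -[leLHS]mul1r ler_wpM2r // -[leLHS]mulr1; apply: ler_pM => //.
    by rewrite -[leLHS]mulr1; apply: ler_pM.
  have c1 : \sum_(r < H | (0 < r)%N) vdc_corr (q ^ mu) (q ^ nu) (shell q mu) (box_term q f nu theta unit_ind) r <=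
      V * (A * H%:R * (hh * (2 * Cf + 32 * q%:R * K) * w * x) * 1 + A * H%:R * hh * w * x) +
      H%:R * ((C0 + 1 + 4 * q%:R * K) * w * (A * V) * x).
    apply: (@le_trans _ _ (\sum_(r < H | (0 < r)%N)
      (V * \sum_(m < q ^ mu | shell q mu m) cabs (unit_corr t (m * r)) +
       (C0 + 1 + 4 * q%:R * K) * w * (A * V) * x))).
      by apply: ler_sum => r r0; apply: corr; rewrite r0 /=.
    rewrite big_split /=; apply: lerD.
      rewrite -mulr_sumr exchange_big /= ler_pM2l //; exact: pair_bound.
    set D := (C0 + 1 + _) * _ * _ * _; have D0 : 0 <= D by rewrite /D; nneg.
    rewrite big_mkcond /=; apply: ler_sum_ord => r; by case: ifP.
  apply: le_trans (lerD c0 c1) _.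
  have : H%:R * ((C0 + 1 + 4 * q%:R * K) * w * (A * V) * x) <=
     H%:R * ((C0 + 1 + 4 * q%:R * K) * w * hh * (A * V) * x).
    rewrite ler_wpM2l // ler_pM2r // ler_wpM2r // -[leLHS]mulr1 ler_wpM2l //; nneg.
  move=> h; apply: le_trans (lerD (lexx _) (lerD (lexx _) h)) _.
  by apply: eq_le; ring.
have VH : 0 <= 4 * V / H%:R by nneg.
apply: le_trans (ler_wpM2l VH sum_corr) _; apply: eq_le.
have HN : H%:R != 0 :> R by rewrite gt_eqF // ltr0n.
rewrite /type_one_const -/A -/V -/x; move: (H%:R) HN => h hN.
by field.
Qed.

End Box.
End TypeOne.

Lemma double_sum_le (R : realType) (z1 z2 y : R) :
  z1 <= y -> z2 <= y -> 0 <= y -> 2 * z1 + z2 <= 2 ^+ 2 * y.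
Proof. by move=> *; lra. Qed.

(** * The sum over [n] for type I *)

Section FibreSums.
Context {R : realType}.
Variables (q : nat) (f : nat -> R[i]) (K : R).
Hypothesis q2 : (2 <= q)%N.
Hypothesis fU : forall n, cabs (f n) = 1.
Hypothesis K1 : 1 <= K.
Hypothesis propK : forall lam kap rho, (rho < lam)%N ->
  #|propagation_exceptions q f lam kap rho|%:R
  <= K * weight q rho * (q ^ lam)%:R / (q ^ rho)%:R.

Let q0 : (0 < q)%N. Proof. exact: q_gt0. Qed.
Let qn0 n : 0 < (q ^ n)%:R :> R. Proof. exact: expqR_gt0. Qed.
Let qnN n : (q ^ n)%:R != 0 :> R. Proof. exact: expqR_neq0. Qed.

Variables (mu nu rho1 rho2 : nat) (theta : R) (r : nat).
Let t := (mu + rho1 + rho2)%N.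
Let Q := (q ^ t)%N.
Let A : R := (q ^ mu)%:R.
Let V : R := (q ^ nu)%:R.
Hypothesis mu0 : (0 < mu)%N.
Let t0 : (0 < t)%N. Proof. by rewrite /t -addnA ltn_addr. Qed.
Let Q0 : (0 < Q)%N. Proof. by rewrite expn_gt0 q0. Qed.

Let u n : R[i] := unit_ind q (n + r) * unit_ind q n.
Let T := fibre_sum q f mu rho1 rho2 theta r.
Let main : R := \sum_(m < q ^ mu | shell q mu m) cabs (unit_corr q f t (m * r)).

Let u_le1 n : cabs (u n) <= 1.
Proof. by rewrite cabsM -[leRHS]mulr1; apply: ler_pM; rewrite ?cabs_ge0 ?unit_ind_le1. Qed.

Let u_periodic : periodic_mod Q u.
Proof.
have pu := unit_ind_periodic (R := R) q t0.
by move=> n; rewrite /u pu; congr (_ * _); apply: (periodicP pu); rewrite modnDml.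
Qed.

Let fibre_full : \sum_(n < Q) u n * T n =
  Q%:R * \sum_(m < q ^ mu | shell q mu m) twist theta r m * unit_corr q f t (m * r).
Proof.
rewrite /T /fibre_sum; under eq_bigr => n _ do rewrite mulr_sumr.
rewrite exchange_big /= mulr_sumr; apply: eq_bigr => m sm.
rewrite mulrCA -(pair_unit_corr f q2 t0 _ (shell_coprime sm)) mulr_sumr.
by apply: eq_bigr => n _; rewrite mulrCA.
Qed.

Let fibre_full_le : cabs (\sum_(n < Q) u n * T n) <= Q%:R * main.
Proof.
rewrite fibre_full cabsM cabs_nat ler_wpM2l //; apply: le_trans (cabs_sum _ _ _) _.
by apply: ler_sum => m _; rewrite cabsM /twist cabs_e mul1r.
Qed.

Lemma fibre_sum_long : (t <= nu)%N ->
  cabs (\sum_(n < q ^ nu) u n * T n) <= V * main.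
Proof.
move=> tn.
have pF : periodic_mod Q (fun n => u n * T n).
  move=> n; rewrite u_periodic; congr (_ * _); apply: eq_bigr => m _.
  by rewrite pair_phase_periodic.
have E : (q ^ nu = Q * q ^ (nu - t))%N by rewrite /Q -expnD subnKC.
have -> : \sum_(n < q ^ nu) u n * T n = (q ^ (nu - t))%:R * \sum_(n < Q) u n * T n.
  transitivity (\sum_(n < Q * q ^ (nu - t)) u n * T n); first by rewrite -E.
  by rewrite (sum_periodic_muln _ Q0 pF) mulr_natl.
rewrite cabsM cabs_nat /V E natrM [Q%:R * _]mulrC -mulrA ler_pM2l //; exact: fibre_full_le.
Qed.

(* The indicator of [n < q^nu] minus its density has nearly vanishing averages
   along progressions, so the shift bound applies to it. *)
Lemma fibre_sum_short (kap rho3 s : nat) (Cw : R) :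
  (nu < t)%N -> (0 < rho3)%N -> (kap + rho3 < t)%N ->
  weight q rho3 * Q%:R * (q ^ (2 * s))%:R <= Cw * V * (q ^ rho3)%:R ->
  (2 * t + 4 * s <= mu + nu + kap)%N ->
  (t + 4 * (kap + rho3 + kap) + 4 * s <= mu + 2 * nu)%N ->
  cabs (\sum_(n < q ^ nu) u n * T n) <=
  (8 * K * Cw + 2) * (A * V) / (q ^ (2 * s))%:R + V * main.
Proof.
move=> nt r3 Jt c1 c2 c3.
set x : R := (q ^ (2 * s))%:R in c1 *.
have vQ : (q ^ nu <= Q)%N by rewrite leq_exp2l // ltnW.
have QN : (Q%:R : R) != 0 by exact: qnN.
have QR : 0 < (Q%:R : R) by exact: qn0.
(* [a] is the density of the range in a period. Subtracting it from the indicator gives [B]; the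
   constant [a] itself contributes a sum over a full period, bounded as in the long case. *)
pose a : R := V / Q%:R.
have a0 : 0 <= a by rewrite /a mulr_ge0 // ?invr_ge0 // ltW.
have a1 : a <= 1 by rewrite /a ler_pdivrMr // mul1r ler_nat.
pose B n : R[i] := u n * (((n %% Q < q ^ nu)%N%:R - a)%:C).
have pB : periodic_mod Q B by move=> n; rewrite /B u_periodic modn_mod.
have BR n : cj (B n) = B n by rewrite /B /u !conjcM !unit_ind_conj conjc_real.
have absB n : cabs (B n) <= `|(n %% Q < q ^ nu)%N%:R - a|.
  by rewrite /B cabsM cabs_real -[leRHS]mul1r ler_wpM2r.
have B1 n : cabs (B n) <= 1.
  apply: le_trans (absB n) _; rewrite ler_norml.
  by case: (_ < q ^ nu)%N; rewrite /= ?mulr1n ?mulr0n; apply/andP; move: (a) a0 a1 => a' h1 h2; split; lra.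
have J0 : (0 < kap + rho3)%N by rewrite addn_gt0 r3 orbT.
have PQ m : shell q mu m -> coprime m q by exact: shell_coprime.
(* [cb] bounds every step [q ^ (kap + rho3) * k] with [k < q ^ kap]; by [interval_discrepancy] the
   averages of [B] along these progressions are at most [cb ^ 2 / Q]. *)
pose cb := (q ^ (kap + rho3 + kap))%N.
pose Pmax : R := cb%:R ^+ 4 / Q%:R.
have Pm0 : 0 <= Pmax by rewrite /Pmax mulr_ge0 // ?invr_ge0 ?exprn_ge0 // ltW.
have PmaxP k : (0 < k < q ^ kap)%N ->
    \sum_(n < Q) cabs (dilated_mean Q B (q ^ (kap + rho3) * k) n) ^+ 2 <= Pmax.
  move=> /andP[k0 kk]; set cc := (q ^ (kap + rho3) * k)%N.
  have cc0 : (0 < cc)%N by rewrite muln_gt0 expn_gt0 q0.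
  have ccb : (cc <= cb)%N by rewrite /cc /cb (expnD q (kap + rho3)) leq_mul // ltnW.
  have qcc : (q %| cc)%N by rewrite dvdn_mulr // -{1}(expn1 q) dvdn_exp2l.
  have E n : cabs (dilated_mean Q B cc n) <= cb%:R ^+ 2 / Q%:R.
    have -> : dilated_mean Q B cc n = u n * (Q%:R^-1 *
        (\sum_(j < Q) ((n + cc * j) %% Q < q ^ nu)%N%:R - V))%:C.
      rewrite /dilated_mean rmorphM /= invC natC mulrCA; congr (_ * _).
      have -> : \sum_(j < Q) ((n + cc * j) %% Q < q ^ nu)%N%:R - V =
          \sum_(j < Q) (((n + cc * j) %% Q < q ^ nu)%N%:R - a).
        rewrite sumrB sumr_const card_ord -[a *+ Q]mulr_natl /a mulrC divfK //.
      rewrite sum_realC mulr_sumr; apply: eq_bigr => j _; rewrite /B /u.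
      have qj : (q %| cc * j)%N by rewrite dvdn_mulr.
      by rewrite (addnAC n (cc * j) r) (unit_ind_mod (n + r) qj) (unit_ind_mod n qj).
    rewrite cabsM cabs_real normrM normfV normr_nat -[leRHS]mul1r.
    apply: ler_pM; rewrite ?cabs_ge0 ?u_le1 // ?mulr_ge0 ?invr_ge0 //.
    rewrite mulrC ler_pM2r ?invr_gt0 //.
    apply: le_trans (interval_discrepancy Q0 vQ cc0 n) _.
    by rewrite -!natrX ler_nat leq_exp2r.
  apply: (@le_trans _ _ (Q%:R * (cb%:R ^+ 2 / Q%:R) ^+ 2)).
    apply: ler_sum_ord => n; rewrite ler_sqr ?nnegrE ?cabs_ge0 // mulr_ge0 ?sqr_ge0 // invr_ge0.
  by apply: eq_le; rewrite /Pmax; move: (Q%:R : R) (cb%:R : R) QN => y z yN; field.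
have em1 m : cabs (twist theta r m) <= 1 :> R by rewrite /twist cabs_e.
have [Y [Y0 Y2 Yle]] := shift_bound q2 fU K1 propK r J0 Jt pB B1 PQ Pm0 PmaxP em1.
have AQ : (q ^ mu <= Q)%N by rewrite leq_exp2l // /t -addnA leq_addr.
have MA : \sum_(m < Q | shell q mu m) (1 : R) <= A := shell_card q mu Q.
have M0 : 0 <= \sum_(m < Q | shell q mu m) (1 : R) by exact: sumr_ge0.
have BT : \sum_(n < Q) B n * T n =
    \sum_(m < Q | shell q mu m) twist theta r m * \sum_(n < Q) pair_phase q f t r m n * cj (B n).
  rewrite -(widen_sum (P := shell q mu) (fun m => twist theta r m * \sum_(n < Q) pair_phase q f t r m n * cj (B n)) AQ).
    rewrite /T /fibre_sum; under eq_bigr => n _ do rewrite mulr_sumr.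
    rewrite exchange_big; apply: eq_bigr => m _; rewrite mulr_sumr; apply: eq_bigr => n _.
    by rewrite BR mulrCA [B n * _]mulrC.
  by move=> m /shell_lt.
have split1 : \sum_(n < q ^ nu) u n * T n =
    \sum_(n < Q) B n * T n + a%:C * \sum_(n < Q) u n * T n.
  rewrite (big_ord_widen Q (fun n => u n * T n) vQ) big_mkcond /= mulr_sumr -big_split /=.
  apply: eq_bigr => n _; rewrite /B modn_small // rmorphB /=.
  by case: ifP => _; rewrite /= ?natC; ring.
rewrite split1; apply: le_trans (cabsD _ _) _; apply: lerD; last first.
  rewrite cabsM cabs_real_ge0 //; apply: le_trans (ler_wpM2l a0 fibre_full_le) _.
  by rewrite /a mulrA divfK.
rewrite BT; apply: le_trans Yle _.
have x0 : 0 < x := qn0 _.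
have A0 : 0 < A := qn0 _. have V0 : 0 < V := qn0 _.
have K0 : 0 <= K := le_trans ler01 K1.
have -> : (8 * K * Cw + 2) * (A * V) / x = 8 * K * (Cw * V / x) * A + 2 * (A * V / x).
  by field; rewrite gt_eqF.
apply: lerD.
  rewrite mulrC; apply: ler_pM => //.
    by have := weight_ge1 (R := R) q2 rho3 => /(le_trans ler01) ?; nneg; rewrite ltW.
  have -> : 8 * (K * weight q rho3 * Q%:R / (q ^ rho3)%:R) =
     8 * K * (weight q rho3 * Q%:R / (q ^ rho3)%:R) by ring.
  rewrite ler_wpM2l //; first by nneg.
  by rewrite ler_pdivrMr // mulrAC ler_pdivlMr.
have SB : \sum_(n < Q) cabs (B n) ^+ 2 <= 2 * V.
  apply: (@le_trans _ _ (\sum_(n < Q) ((n < q ^ nu)%N%:R + a ^+ 2))).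
    apply: ler_sum => n _; have := absB n; rewrite modn_small // => h.
    apply: (@le_trans _ _ (`|(n < q ^ nu)%N%:R - a| ^+ 2)).
      by rewrite ler_sqr ?nnegrE ?cabs_ge0.
    rewrite real_normK ?num_real //.
    by case: (_ < q ^ nu)%N; rewrite /= ?mulr1n ?mulr0n; move: (a) a0 a1 => a' h1 h2; nra.
  rewrite big_split /= mulr2n mulrDl !mul1r; apply: lerD.
    rewrite -natr_sum; have := count_interval Q 0 (q ^ nu); rewrite add0n => /(leq_trans _) h.
    by rewrite ler_nat; apply: h; apply: leq_sum => n _; rewrite leq0n.
  rewrite sumr_const card_ord -[_ *+ Q]mulr_natl.
  apply: (@le_trans _ _ (Q%:R * a)).
    by rewrite ler_pM2l // expr2 -[leRHS]mulr1 ler_wpM2l.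
  by rewrite /a mulrC divfK.
rewrite -ler_sqr ?nnegrE //; last by rewrite mulr_ge0 // ?mulr_ge0 ?invr_ge0 ?mulr_ge0 ?ltW.
apply: le_trans Y2 _.
have kp : 0 < (q ^ kap)%:R :> R := qn0 _.
apply: (@le_trans _ _ (A * Q%:R * (Q%:R * (2 * V / (q ^ kap)%:R + Pmax)))).
  apply: ler_pM; [by rewrite mulr_ge0| | |].
  - rewrite mulr_ge0 // addr_ge0 // mulr_ge0 ?invr_ge0 //.
    by apply: sumr_ge0 => n _; rewrite sqr_ge0.
  - by rewrite ler_wpM2r.
  by rewrite ler_wpM2l // lerD2r ler_pM2r // invr_gt0.
have -> : A * Q%:R * (Q%:R * (2 * V / (q ^ kap)%:R + Pmax)) =
    2 * (A * Q%:R ^+ 2 * V / (q ^ kap)%:R) + A * Q%:R * cb%:R ^+ 4.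
  rewrite /Pmax; move: (Q%:R : R) (cb%:R : R) ((q ^ kap)%:R : R) QN kp => y z k yN k0.
  by field; rewrite yN gt_eqF.
(* This and the next inequality are read off the exponents of [q]: [c2] settles the diagonal
   contribution, [c3] the off-diagonal one. *)
have T1 : A * Q%:R ^+ 2 * V / (q ^ kap)%:R <= (A * V / x) ^+ 2.
  rewrite ler_pdivrMr // exprMn exprVn [leRHS]mulrAC ler_pdivlMr ?exprn_gt0 //.
  rewrite /A /V /Q /x -?natrX -?natrM -?natrX -?natrM ler_nat -?expnM -?expnD -?expnM -?expnD leq_exp2l //.
  by clear -c2; lia.
have T2 : A * Q%:R * cb%:R ^+ 4 <= (A * V / x) ^+ 2.
  rewrite exprMn exprVn ler_pdivlMr ?exprn_gt0 //.
  rewrite /A /V /Q /x /cb -?natrX -?natrM -?natrX -?natrM ler_nat -?expnM -?expnD -?expnM -?expnD leq_exp2l //.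
  by clear -c3; lia.
rewrite exprMn; move: T1 T2 (sqr_ge0 (A * V / x)).
move: (A * Q%:R ^+ 2 * V / (q ^ kap)%:R) (A * Q%:R * cb%:R ^+ 4) ((A * V / x) ^+ 2) => z1 z2 y.
exact: double_sum_le.
Qed.

End FibreSums.

(** * Arithmetic functions *)

Section DivisorSums.
Context {R : realType}.

Definition moebius n : R :=
  \prod_(p <- primes n) (if logn p n == 1%N then -1 else 0).

Lemma moebius1 : moebius 1 = 1. Proof. by rewrite /moebius big_nil. Qed.

Lemma moebius_le1 n : `|moebius n| <= 1.
Proof.
rewrite /moebius; apply: (big_ind (fun x : R => `|x| <= 1)); first by rewrite normr1.
  by move=> x y x1 y1; rewrite normrM -[leRHS]mulr1 ler_pM.
by move=> p _; case: ifP => _; rewrite ?normrN ?normr1 ?normr0.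
Qed.

Lemma moebius_mul_prime p d : prime p -> (0 < d)%N ->
  moebius (p * d) = if (p %| d)%N then 0 else - moebius d.
Proof.
move=> pp d0; have p0 := prime_gt0 pp; have pd0 : (0 < p * d)%N by rewrite muln_gt0 p0.
case: ifP => pd.
  rewrite /moebius (big_rem p) /=; last by rewrite mem_primes pp pd0 dvdn_mulr.
  have -> : (logn p (p * d) == 1%N) = false; last by rewrite mul0r.
  rewrite lognM // (logn_prime p pp) eqxx add1n eqSS.
  by apply/negbTE; rewrite -lt0n logn_gt0 mem_primes pp d0 pd.
have pr : perm_eq (primes (p * d)) (p :: primes d).
  apply: uniq_perm; rewrite ?primes_uniq //=.
    by rewrite primes_uniq mem_primes pd !andbF.
  move=> r; rewrite inE primesM // (primes_prime pp) !inE; by [].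
rewrite /moebius (perm_big _ pr) /= big_cons lognM // (logn_prime p pp) eqxx.
have -> : logn p d = 0%N by apply/eqP; rewrite -leqn0 leqNgt logn_gt0 mem_primes pd !andbF.
rewrite addn0 eqxx /= mulN1r; congr (- _).
rewrite big_seq [RHS]big_seq; apply: eq_bigr => r rd.
have rp : r != p by apply: contraTneq rd => ->; rewrite mem_primes pd !andbF.
have pr' : prime r by move: rd; rewrite mem_primes => /and3P[].
by rewrite lognM // (logn_prime r pp) (negbTE rp) add0n.
Qed.

Lemma divisor_sum_widen (g : nat -> R) n Y : (0 < n)%N -> (n < Y)%N ->
  \sum_(d < Y | (0 < d)%N && (d %| n)%N) g d = \sum_(d <- divisors n) g d.
Proof.
move=> n0 nY; rewrite -(big_mkord (fun d => (0 < d)%N && (d %| n)%N) g) -big_filter.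
apply: perm_big; apply: uniq_perm; rewrite ?filter_uniq ?iota_uniq ?divisors_uniq //.
move=> d; rewrite mem_filter mem_index_iota /= -dvdn_divisors //.
case: (boolP (d %| n)%N) => [dn|_]; last by rewrite andbF.
by rewrite (dvdn_gt0 n0 dn) /= (leq_ltn_trans (dvdn_leq n0 dn) nY).
Qed.

(** For [p = pdiv n], the divisors [p d] with [d] prime to [p] cancel against the divisors [d], and
    those divisible by [p ^ 2] contribute 0. *)
Lemma moebius_sum n : (0 < n)%N -> \sum_(d <- divisors n) moebius d = (n == 1%N)%:R.
Proof.
move=> n0; case: eqP => [->|/eqP n1]; first by rewrite /= big_seq1 moebius1.
have n2 : (1 < n)%N by rewrite ltn_neqAle eq_sym n1 n0.
set p := pdiv n; have pp : prime p by exact: pdiv_prime.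
have pn : (p %| n)%N by exact: pdiv_dvd.
have p0 := prime_gt0 pp.
have [k nk] : exists k, (n = p * k)%N by case/dvdnP: pn => k ->; exists k; rewrite mulnC.
have k0 : (0 < k)%N by move: n0; rewrite nk muln_gt0 => /andP[].
rewrite -(divisor_sum_widen moebius n0 (ltnSn n)).
rewrite (bigID (fun d : 'I_n.+1 => (p %| d)%N)) /=.
have -> : \sum_(d < n.+1 | ((0 < d)%N && (d %| n)%N) && (p %| d)%N) moebius d =
    - \sum_(d < n.+1 | ((0 < d)%N && (d %| n)%N) && ~~ (p %| d)%N) moebius d.
  pose G d := if (d %| n)%N then moebius d else 0.
  transitivity (\sum_(d < n.+1 | (0 < d)%N && (p %| d)%N) G d).
    rewrite big_mkcond [RHS]big_mkcond /=; apply: eq_bigr => d _; rewrite /G.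
    by case: (0 < d)%N; case: (p %| d)%N; case: (d %| n)%N.
  rewrite -(sum_multiples p0); last first.
    by move=> d nd; rewrite /G; case: ifP => // /(dvdn_leq n0); rewrite leqNgt nd.
  rewrite -sumrN big_mkcond [RHS]big_mkcond /=; apply: eq_bigr => d _; rewrite /G.
  case: ltnP => //= d0; have dn x : (x %| n = (x %| p * k))%N by rewrite -nk.
  rewrite !dn dvdn_pmul2l //.
  case: (boolP (p %| d)%N) => pd /=; last first.
    rewrite andbT Gauss_dvdr; last by rewrite coprime_sym prime_coprime.
    by case: ifP => // _; rewrite moebius_mul_prime // (negbTE pd).
  by rewrite andbF; case: ifP => // _; rewrite moebius_mul_prime // pd.
by rewrite addNr.
Qed.

Notation Lam := (@von_mangoldt R).

Lemma von_mangoldt_ge0 n : 0 <= Lam n.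
Proof.
rewrite /von_mangoldt; case: (primes n) (mem_primes^~ n) => [|p [|//]] // h.
by rewrite ln_ge0 // ler1n; have := h p; rewrite inE eqxx => /esym/and3P[/prime_gt0].
Qed.

Lemma von_mangoldt_neq0 n : Lam n != 0 ->
  exists p, [/\ prime p, (n = p ^ logn p n)%N, (0 < logn p n)%N & Lam n = ln p%:R].
Proof.
rewrite /von_mangoldt; case E : (primes n) => [|p [|//]]; rewrite ?eqxx // => _.
have : p \in primes n by rewrite E inE.
rewrite mem_primes => /and3P[pp n0 pn]; exists p; split=> //.
  by rewrite {1}(prod_prime_decomp n0) prime_decompE E big_cons big_nil muln1.
by rewrite logn_gt0 E inE.
Qed.

Lemma von_mangoldt_prime_power p k : prime p -> (0 < k)%N -> Lam (p ^ k) = ln p%:R.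
Proof. by move=> pp k0; rewrite /von_mangoldt primesX // primes_prime. Qed.

(** Induction along [n = p k] with [p = pdiv n]: the only divisor of [n] not dividing [k] at which
    [Lam] is nonzero is [p ^ v], and it contributes [ln p]. *)
Lemma von_mangoldt_divisor_sum n : (0 < n)%N -> \sum_(d <- divisors n) Lam d = ln n%:R.
Proof.
elim/ltn_ind: n => n IH n0; case: (eqVneq n 1%N) => [->|n1].
  by rewrite /= big_seq1 /von_mangoldt ln1.
have n2 : (1 < n)%N by rewrite ltn_neqAle eq_sym n1 n0.
set p := pdiv n; have pp : prime p by exact: pdiv_prime.
have p0 := prime_gt0 pp.
have [k nk] : exists k, (n = p * k)%N by case/dvdnP: (pdiv_dvd n) => k ->; exists k; rewrite mulnC.
have k0 : (0 < k)%N by move: n0; rewrite nk muln_gt0 => /andP[].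
have kn : (k < n)%N by rewrite nk ltn_Pmull // prime_gt1.
set v := (logn p k).+1.
have pvn : (p ^ v %| n)%N by rewrite nk /v expnS dvdn_pmul2l // pfactor_dvdnn.
have pvk : ~~ (p ^ v %| k)%N by rewrite pfactor_dvdn // ltnn.
have -> : ln n%:R = ln p%:R + ln k%:R :> R by rewrite nk natrM lnM // posrE ltr0n.
have kn1 : (k < n.+1)%N by exact: ltnW.
rewrite -(IH k kn k0) -(divisor_sum_widen Lam n0 (ltnSn n)) -(divisor_sum_widen Lam k0 kn1).
have kdn : (k %| n)%N by rewrite nk dvdn_mull.
rewrite (bigID (fun d : 'I_n.+1 => (d %| k)%N)) /= addrC; congr (_ + _); last first.
  apply: eq_bigl => d; case: (boolP (d %| k)%N) => dk; rewrite ?andbF ?andbT //.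
  by rewrite (dvdn_trans dk kdn) andbT.
have pvlt : (p ^ v < n.+1)%N by rewrite ltnS dvdn_leq.
rewrite (bigD1 (Ordinal pvlt)) /=; last by rewrite expn_gt0 p0 pvn pvk.
rewrite von_mangoldt_prime_power // big1 ?addr0 // => d /andP[/andP[/andP[d0 dn] dk]] dv.
apply/eqP; apply: contraR dv => /von_mangoldt_neq0[r [pr dE l0 _]].
apply/eqP; apply: val_inj; rewrite /= dE.
have h1 : (logn r d <= logn r n)%N by rewrite -pfactor_dvdn // -dE.
have h2 : (logn r k < logn r d)%N by rewrite ltnNge -pfactor_dvdn // -dE.
have nE : logn r n = ((r == p) + logn r k)%N by rewrite nk lognM // (logn_prime r pp).
move: h1; rewrite nE.
case: (eqVneq r p) => [rp|rp]; last by rewrite add0n leqNgt h2.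
rewrite -rp /v in h2 *; rewrite -rp add1n => h1; congr (_ ^ _)%N; apply/eqP; by rewrite eqn_leq h1 h2.
Qed.

Lemma von_mangoldt_le_ln n : Lam n <= ln n%:R.
Proof.
case: n => [|n]; first by rewrite ln0 // /von_mangoldt.
rewrite -von_mangoldt_divisor_sum // (big_rem n.+1) ?divisors_id //= lerDl.
by apply: sumr_ge0 => d _; exact: von_mangoldt_ge0.
Qed.

Lemma moebius_sum_ord n Y : (0 < n)%N -> (n < Y)%N ->
  \sum_(d < Y | (0 < d)%N && (d %| n)%N) moebius d = (n == 1%N)%:R.
Proof. by move=> n0 nY; rewrite divisor_sum_widen // moebius_sum. Qed.

Lemma von_mangoldt_sum_ord n Y : (0 < n)%N -> (n < Y)%N ->
  \sum_(d < Y | (0 < d)%N && (d %| n)%N) Lam d = ln n%:R.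
Proof. by move=> n0 nY; rewrite divisor_sum_widen // von_mangoldt_divisor_sum. Qed.

Lemma ndiv_sum n Y : (0 < n)%N -> (n < Y)%N ->
  \sum_(d < Y | (0 < d)%N && (d %| n)%N) 1 = (ndiv n)%:R :> R.
Proof.
move=> n0 nY; rewrite (divisor_sum_widen (fun=> 1)) // -(divisor_sum_widen (fun=> 1) n0 (ltnSn n)).
by rewrite /ndiv natr_sum.
Qed.

Lemma ndiv0 : ndiv 0 = 0%N.
Proof. by rewrite /ndiv big_pred0 // => d; rewrite ord1. Qed.

Definition harmonic M : R := \sum_(d < M | (0 < d)%N) d%:R^-1.

Lemma harmonic_ge0 M : 0 <= harmonic M.
Proof. by apply: sumr_ge0 => d _; rewrite invr_ge0. Qed.

(** Each range [[q^j, q^(j+1))] contributes at most [q^(j+1) / q^j = q]. *)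
Lemma harmonic_expn q N : (2 <= q)%N -> harmonic (q ^ N) <= q%:R * N%:R.
Proof.
move=> q2; have q0 : (0 < q)%N by exact: leq_trans q2.
elim: N => [|N IH]; first by rewrite /harmonic expn0 big_ord1_cond /= mulr0.
have le1 : (q ^ N <= q ^ N.+1)%N by rewrite leq_exp2l.
have qN : 0 < (q ^ N)%:R :> R by rewrite ltr0n expn_gt0 q0.
rewrite -natr1 mulrDr mulr1 /harmonic (bigID (fun d : 'I__ => (d < q ^ N)%N)) /=; apply: lerD.
  by rewrite -(big_ord_widen_cond _ (fun d => (0 < d)%N) (fun d : nat => (d%:R : R)^-1) le1).
apply: (@le_trans _ _ (\sum_(d < q ^ N.+1) (q ^ N)%:R^-1)).
  rewrite big_mkcond /=; apply: ler_sum => d _; case: ifP => [/andP[d0]|_]; last by rewrite invr_ge0 ltW.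
  by rewrite -leqNgt => dN; rewrite lef_pV2 ?posrE ?ltr0n ?expn_gt0 ?q0 // ler_nat.
by rewrite sumr_const card_ord -[_ *+ _]mulr_natl expnS natrM mulfK // gt_eqF.
Qed.

Lemma sum_inv_multiples M g : (0 < g)%N ->
  \sum_(d < M | (0 < d)%N && (g %| d)%N) d%:R^-1 <= harmonic M / g%:R :> R.
Proof.
move=> g0; pose F d : R := if (d < M)%N then d%:R^-1 else 0.
have -> : \sum_(d < M | (0 < d)%N && (g %| d)%N) (d%:R^-1 : R) =
   \sum_(d < M | (0 < d)%N && (g %| d)%N) F d by apply: eq_bigr => d _; rewrite /F ltn_ord.
rewrite -(sum_multiples g0); last by move=> n Mn; rewrite /F ltnNge Mn.
rewrite /harmonic mulr_suml; apply: ler_sum => d d0; rewrite /F; case: ifP => _.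
  by rewrite natrM invfM mulrC.
by rewrite mulr_ge0 ?invr_ge0.
Qed.

(* [1 / lcm d1 d2 = gcd d1 d2 / (d1 d2)] is at most the sum of [g / (d1 d2)] over
   all common divisors [g]. *)
Lemma ndiv_square_sum M : \sum_(m < M) (ndiv m)%:R ^+ 2 <= M%:R * harmonic M ^+ 3 :> R.
Proof.
have count (l : nat) : (0 < l)%N -> \sum_(m < M | (0 < m)%N && (l %| m)%N) (1 : R) <= M%:R / l%:R.
  move=> l0; pose F n : R := (n < M)%N%:R.
  have -> : \sum_(m < M | (0 < m)%N && (l %| m)%N) (1 : R) =
      \sum_(m < M | (0 < m)%N && (l %| m)%N) F m by apply: eq_bigr => m _; rewrite /F ltn_ord.
  rewrite -(sum_multiples l0); last by move=> n Mn; rewrite /F ltnNge Mn.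
  apply: (@le_trans _ _ (M %/ l)%:R).
    apply: le_trans (_ : (\sum_(n < M) (1 <= n < 1 + M %/ l))%N%:R <= _); last first.
      by rewrite ler_nat; exact: count_interval.
    rewrite natr_sum big_mkcond /=; apply: ler_sum => k _; rewrite /F.
    case: ltnP => //= k0; rewrite add1n ltnS ler_nat; case: ltnP => // lk.
    by rewrite leq_divRL // mulnC (ltnW lk).
  by rewrite ler_pdivlMr ?ltr0n // -natrM ler_nat leq_trunc_div.
apply: (@le_trans _ _ (\sum_(m < M | (0 < m)%N) \sum_(d1 < M | (0 < d1)%N && (d1 %| m)%N)
    \sum_(d2 < M | (0 < d2)%N && (d2 %| m)%N) (1 : R))).
  rewrite [leRHS]big_mkcond /=; apply: ler_sum => m _; case: ltnP => m0; last first.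
    by move: m0; rewrite leqn0 => /eqP ->; rewrite ndiv0 expr0n.
  under eq_bigr => d1 _ do rewrite ndiv_sum //.
  by rewrite -[in X in _ <= X](mul1r (ndiv m)%:R) -mulr_suml ndiv_sum.
apply: (@le_trans _ _ (\sum_(d1 < M | (0 < d1)%N) \sum_(d2 < M | (0 < d2)%N)
    M%:R * \sum_(g < M | [&& (0 < g)%N, (g %| d1)%N & (g %| d2)%N]) g%:R / (d1%:R * d2%:R))).
  rewrite (exchange_big_dep (fun d1 : 'I_M => (0 < d1)%N)) /=; last by move=> m d _ /andP[].
  apply: ler_sum => d1 d10.
  rewrite (exchange_big_dep (fun d1 : 'I_M => (0 < d1)%N)) /=; last by move=> m d _ /andP[].
  apply: ler_sum => d2 d20.
  set g := gcdn d1 d2; have g0 : (0 < g)%N by rewrite gcdn_gt0 d10.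
  have gM : (g < M)%N by apply: leq_ltn_trans (ltn_ord d1); rewrite dvdn_leq // dvdn_gcdl.
  have l0 : (0 < lcmn d1 d2)%N by rewrite lcmn_gt0 d10.
  apply: (@le_trans _ _ (M%:R / (lcmn d1 d2)%:R)).
    apply: le_trans (count _ l0); rewrite big_mkcond [leRHS]big_mkcond /=; apply: ler_sum => m _.
    by rewrite dvdn_lcm; case: (0 < m)%N; case: (d1 %| m)%N; case: (d2 %| m)%N; rewrite /= ?d10 ?d20.
  have E : (lcmn d1 d2)%:R^-1 = g%:R / (d1%:R * d2%:R) :> R.
    rewrite -natrM -(muln_lcm_gcd d1 d2) -/g natrM invfM mulrCA divff ?mulr1 //.
    by rewrite pnatr_eq0 -lt0n.
  rewrite ler_wpM2l // E (bigD1 (Ordinal gM)) /=; last by rewrite g0 dvdn_gcdl dvdn_gcdr.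
  rewrite lerDl; apply: sumr_ge0 => i _; rewrite mulr_ge0 // invr_ge0 mulr_ge0 //.
apply: (@le_trans _ _ (M%:R * \sum_(g < M | (0 < g)%N) g%:R *
    (\sum_(d < M | (0 < d)%N && (g %| d)%N) d%:R^-1) ^+ 2)).
  apply: eq_le; rewrite mulr_sumr.
  under eq_bigr => d1 d10 do under eq_bigr => d2 d20 do rewrite mulr_sumr.
  under eq_bigr => d1 d10.
    rewrite (exchange_big_dep (fun g : 'I_M => (0 < g)%N && (g %| d1)%N)) /=; last first.
      by move=> d2 g _ /and3P[-> ->].
    over.
  rewrite (exchange_big_dep (fun g : 'I_M => (0 < g)%N)) /=; last by move=> d1 g _ /andP[].
  apply: eq_bigr => g g0; rewrite expr2 mulr_suml !mulr_sumr.
  apply: eq_big => [d1|d1 /andP[d10 /andP[_ gd1]]]; first by rewrite g0.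
  rewrite !mulr_sumr; apply: eq_big => [d2|d2 _]; first by rewrite g0 gd1.
  by rewrite invfM; ring.
have -> : M%:R * harmonic M ^+ 3 = M%:R * (\sum_(g < M | (0 < g)%N) g%:R^-1 * harmonic M ^+ 2).
  by rewrite -mulr_suml -/(harmonic M) -exprS.
rewrite ler_wpM2l //; apply: ler_sum => g g0.
have gR : 0 < g%:R :> R by rewrite ltr0n.
apply: (@le_trans _ _ (g%:R * (harmonic M / g%:R) ^+ 2)).
  rewrite ler_pM2l // ler_sqr ?nnegrE ?sum_inv_multiples //.
    by apply: sumr_ge0 => d _; rewrite invr_ge0.
  by rewrite mulr_ge0 ?invr_ge0 ?harmonic_ge0.
by apply: eq_le; field; rewrite gt_eqF.
Qed.

Lemma convolve (g : nat -> R) (F : nat -> R[i]) (P : pred nat) Y :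
  (forall n, (Y <= n)%N -> F n = 0) ->
  \sum_(a < Y | (0 < a)%N && P a) (g a)%:C * \sum_(k < Y | (0 < k)%N) F (a * k)%N =
  \sum_(n < Y | (0 < n)%N)
    (\sum_(a < Y | ((0 < a)%N && (a %| n)%N) && P a) g a)%:C * F n.
Proof.
move=> F0.
under eq_bigr => a /andP[a0 _] do rewrite (sum_multiples a0 F0) mulr_sumr.
rewrite (exchange_big_dep (fun n : 'I_Y => (0 < n)%N)) /=; last by move=> a n _ /andP[].
apply: eq_bigr => n n0; rewrite sum_realC mulr_suml; apply: eq_bigl => a.
by rewrite n0 /= andbAC.
Qed.

(** The terms come from powers of primes dividing [q], with exponent at most [q N] because
    [n < q^N <= 2^(q N)]. *)
Lemma von_mangoldt_ramified q N Y : (2 <= q)%N -> (Y <= q ^ N)%N ->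
  \sum_(n < Y | ~~ coprime n q) Lam n <= (q.+1)%:R * (q * N).+1%:R * ln q%:R.
Proof.
move=> q2 YN; have q0 : (0 < q)%N by exact: leq_trans q2.
have lq : 0 <= ln q%:R :> R by rewrite ln_ge0 // ler1n.
apply: (@le_trans _ _ (\sum_(n < Y) \sum_(p < q.+1) \sum_(k < (q * N).+1)
    (if n == (p ^ k)%N :> nat then ln q%:R else 0))).
  rewrite big_mkcond /=; apply: ler_sum => n _; case: ifP => [nc|_]; last first.
    by apply: sumr_ge0 => p _; apply: sumr_ge0 => k _; case: ifP.
  have G0 p : 0 <= \sum_(k < (q * N).+1) (if n == (p ^ k)%N :> nat then ln q%:R else 0) :> R.
    by apply: sumr_ge0 => k _; case: ifP.
  case: (eqVneq (Lam n) 0) => [->|/von_mangoldt_neq0[p [pp nE l0 ->]]].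
    by apply: sumr_ge0 => p _; exact: G0.
  have pq : (p %| q)%N.
    by move: nc; rewrite nE coprime_pexpl // prime_coprime // negbK.
  have ple : (p <= q)%N by rewrite dvdn_leq.
  have pl : (p < q.+1)%N by [].
  have kl : (logn p n < (q * N).+1)%N.
    rewrite ltnS -(leq_exp2l (m := 2)) //.
    apply: (@leq_trans n).
      by rewrite {2}nE leq_exp2r // prime_gt1.
    apply: (leq_trans (ltnW (ltn_ord n))); apply: (leq_trans YN).
    case: (posnP N) => [->|N0]; rewrite ?muln0 ?expn0 // expnM leq_exp2r //.
    by rewrite ltnW // ltn_expl.
  rewrite (bigD1 (Ordinal pl)) //= (bigD1 (Ordinal kl)) //= -nE eqxx -addrA.
  apply: (@le_trans _ _ (ln q%:R)).
    by rewrite ler_ln ?posrE ?ltr0n ?ler_nat // prime_gt0.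
  rewrite lerDl; apply: addr_ge0; first by apply: sumr_ge0 => k _; case: ifP.
  by apply: sumr_ge0 => p' _; exact: G0.
rewrite exchange_big /= -mulrA; apply: ler_sum_ord => p.
rewrite exchange_big /=; apply: ler_sum_ord => k; rewrite -big_mkcond /=.
case: (ltnP (p ^ k) Y) => pk; last first.
  rewrite big1 // => n /eqP E; by move: (ltn_ord n); rewrite E ltnNge pk.
rewrite (bigD1 (Ordinal pk)) //= big1 ?addr0 // => n /andP[/eqP E /eqP]; case.
by apply: val_inj.
Qed.

End DivisorSums.

(** * Removal of the cut-off *)

Section Cut.
Context {R : realType}.
Implicit Types x y : R.

Lemma cabs_ge_Re (z : R[i]) : `|complex.Re z| <= cabs z.
Proof. by have := normc_ge_Re z; rewrite cabsE lecR. Qed.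

Lemma cabs_e_sub1_far y : 1 / 4 <= y <= 3 / 4 -> 1 <= cabs (e y - 1).
Proof.
move=> /andP[lo hi]; apply: le_trans (cabs_ge_Re _).
have p0 := pi_gt0 R.
have -> : complex.Re (e y - 1) = cos (2 * pi * y) - 1 by rewrite /e /=.
have : cos (2 * pi * y) <= 0.
  have -> : 2 * pi * y = (2 * pi * y - pi) + pi by rewrite subrK.
  rewrite cosDpi oppr_le0; apply: cos_ge0_pihalf; apply/andP; split; nra.
by rewrite ler_normr => h; apply/orP; right; lra.
Qed.

Lemma cabs_e_mulrn_sub1 y k : cabs (e (k%:R * y) - 1) <= k%:R * cabs (e y - 1).
Proof.
elim: k => [|k IH]; first by rewrite mul0r e0 subrr cabs0 mul0r.
rewrite -natr1 mulrDl mul1r eD [k%:R * y]mulrC.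
have -> : e (y * k%:R) * e y - 1 = e y * (e (k%:R * y) - 1) + (e y - 1) by rewrite [y * _]mulrC; ring.
by apply: le_trans (cabsD _ _) _; rewrite cabsM cabs_e mul1r mulrDl mul1r lerD2r.
Qed.

(* With [k = Z / (4 h) + 1] the multiple [k h / Z] falls in [1/4, 3/4]. *)
Lemma cabs_e_sub1_half (Z h : nat) : (0 < h)%N -> (2 * h <= Z)%N ->
  h%:R <= Z%:R * cabs (e (h%:R / Z%:R : R) - 1).
Proof.
move=> h0 hZ; have Z0 : (0 < Z)%N by lia.
set k := (Z %/ (4 * h)).+1.
have k1 : (Z < 4 * h * k)%N by rewrite mulnC ltn_ceil // muln_gt0.
have k2 : (4 * h * k <= Z + 4 * h)%N.
  by rewrite /k mulnS addnC leq_add2r mulnC leq_trunc_div.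
have ZR : 0 < Z%:R :> R by rewrite ltr0n.
have far : 1 <= cabs (e (k%:R * (h%:R / Z%:R) : R) - 1).
  apply: cabs_e_sub1_far; rewrite mulrA ler_pdivlMr // ler_pdivrMr //.
  have a1 : Z%:R <= 4 * h%:R * k%:R :> R by rewrite -!natrM ler_nat ltnW.
  have a2 : 4 * h%:R * k%:R <= 3 * Z%:R :> R by rewrite -!natrM ler_nat; lia.
  by apply/andP; split; lra.
have := le_trans far (cabs_e_mulrn_sub1 _ _).
set c := cabs _ => kc; have c0 : 0 <= c := cabs_ge0 _.
have hk : h%:R * k%:R <= Z%:R :> R by rewrite -natrM ler_nat; lia.
have h0' : 0 <= h%:R :> R by [].
apply: (@le_trans _ _ (h%:R * (k%:R * c))); first by rewrite ler_peMr.
by rewrite mulrA ler_wpM2r.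
Qed.

(** Conjugation exchanges [h] and [Z - h], so one of the two is in the range of [cabs_e_sub1_half];
    the sum of both terms avoids the case distinction later. *)
Lemma inv_cabs_e_sub1 (Z h : nat) : (0 < h)%N -> (h < Z)%N ->
  (cabs (e (h%:R / Z%:R : R) - 1))^-1 <= Z%:R / h%:R + Z%:R / (Z - h)%:R.
Proof.
move=> h0 hZ; have Z0 : (0 < Z)%N by lia.
have ZR : 0 < Z%:R :> R by rewrite ltr0n.
have half h' : (0 < h')%N -> (2 * h' <= Z)%N ->
    (cabs (e (h'%:R / Z%:R : R) - 1))^-1 <= Z%:R / h'%:R.
  move=> h'0 h'Z; have h'R : 0 < h'%:R :> R by rewrite ltr0n.
  have := cabs_e_sub1_half h'0 h'Z; set c := cabs _ => hc.
  have c0 : 0 < c by rewrite -(pmulr_rgt0 _ ZR); exact: lt_le_trans hc.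
  by rewrite ler_pdivlMr // mulrC ler_pdivrMr.
case: (leqP (2 * h) Z) => hh.
  by apply: le_trans (half _ h0 hh) _; rewrite lerDl divr_ge0.
have -> : cabs (e (h%:R / Z%:R : R) - 1) = cabs (e ((Z - h)%:R / Z%:R : R) - 1).
  rewrite -[in RHS]cabsJ rmorphB /= conj_e rmorph1; congr (cabs (_ - 1)).
  have em1 : e (- 1 : R) = 1 by rewrite -conj_e (e_nat 1 : e (1 : R) = 1) rmorph1.
  rewrite natrB ?(ltnW hZ) //.
  have -> : - ((Z%:R - h%:R) / Z%:R) = h%:R / Z%:R - 1 :> R by field; rewrite gt_eqF.
  by rewrite eD em1 mulr1.
have h1 : (0 < Z - h)%N by lia.
have h2 : (2 * (Z - h) <= Z)%N by lia.
by apply: le_trans (half _ h1 h2) _; rewrite lerDr divr_ge0.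
Qed.

Lemma geometric_bound y (Y : nat) :
  cabs (\sum_(k < Y) e (- (k%:R * y))) * cabs (e y - 1) <= 2.
Proof.
have -> : cabs (e y - 1) = cabs (e (- y) - 1).
  by rewrite -[LHS]cabsJ rmorphB /= conj_e rmorph1.
rewrite -cabsM mulrC.
have -> : \sum_(k < Y) e (- (k%:R * y)) = \sum_(k < Y) e (- y) ^+ k.
  by apply: eq_bigr => k _; rewrite -e_mulrn -mulrN mulr_natl.
rewrite -subrX1; apply: le_trans (cabsB _ _) _; rewrite -e_mulrn cabs_e cabs1.
by rewrite -[2]/(1 + 1).
Qed.

Lemma harmonic_rev Z : \sum_(h < Z | (0 < h)%N) (Z - h)%:R^-1 = harmonic Z :> R.
Proof.
case: Z => [|Z]; first by rewrite /harmonic !big_ord0.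
rewrite /harmonic [LHS]big_mkcond [RHS]big_mkcond [LHS]big_ord_recl [RHS]big_ord_recl /= !add0r.
rewrite (reindex_inj rev_ord_inj) /=; apply: eq_bigr => h _; rewrite /bump /= !add1n.
by congr (_%:R^-1); have := ltn_ord h; lia.
Qed.

(** The Fourier coefficients of the indicator of [[0, Y)] modulo [Z]. *)
Definition cut_coef (Z Y h : nat) : R[i] :=
  Z%:R^-1 * \sum_(y < Y) e (- ((h * y)%:R / Z%:R)).

Lemma cut_coef_sum Z Y : (0 < Z)%N -> (Y <= Z)%N ->
  \sum_(h < Z) cabs (cut_coef Z Y h) <= 1 + 4 * harmonic Z.
Proof.
move=> Z0 YZ; have ZR : 0 < Z%:R :> R by rewrite ltr0n.
rewrite (bigID (fun h : 'I_Z => (0 < h)%N)) /= addrC; apply: lerD.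
  rewrite (bigD1 (Ordinal Z0)) //= big1 ?addr0; last first.
    by move=> h /andP[]; rewrite -leqNgt leqn0 => /eqP E /eqP []; apply: val_inj.
  rewrite /cut_coef cabsM cabsV cabs_nat mulrC ler_pdivrMr // mul1r.
  apply: le_trans (cabs_sum _ _ _) _; apply: (@le_trans _ _ (Y%:R * 1)); last by rewrite mulr1 ler_nat.
  by apply: ler_sum_ord => y; rewrite cabs_e.
apply: (@le_trans _ _ (\sum_(h < Z | (0 < h)%N) (2 * h%:R^-1 + 2 * (Z - h)%:R^-1))); last first.
  by rewrite big_split /= -!mulr_sumr harmonic_rev -/(harmonic Z); lra.
apply: ler_sum => h h0; rewrite /cut_coef cabsM cabsV cabs_nat.
have -> : \sum_(y < Y) e (- ((h * y)%:R / Z%:R)) = \sum_(y < Y) e (- (y%:R * (h%:R / Z%:R))) :> R[i].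
  by apply: eq_bigr => y _; rewrite natrM [h%:R * _]mulrC mulrA.
have := geometric_bound (h%:R / Z%:R) Y; set S := cabs _; set c := cabs _ => Sc.
have S0 : 0 <= S := cabs_ge0 _.
have hR : 0 < h%:R :> R by rewrite ltr0n.
have := inv_cabs_e_sub1 h0 (ltn_ord h); rewrite -/c => ci.
have c0 : 0 < c.
  rewrite /c lt_neqAle cabs_ge0 andbT eq_sym cabs_e_sub1 mulf_neq0 // normr_eq0 sin_pi_neq0 //.
    by rewrite mulf_neq0 // ?invr_eq0 gt_eqF.
  by rewrite ger0_norm ?divr_ge0 // ltr_pdivrMr // mul1r ltr_nat.
have S2 : S <= 2 * c^-1 by rewrite ler_pdivlMr.
apply: (@le_trans _ _ (Z%:R^-1 * (2 * (Z%:R / h%:R + Z%:R / (Z - h)%:R)))).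
  rewrite ler_pM2l ?invr_gt0 //; apply: le_trans S2 _.
  by rewrite ler_pM2l.
have ZN : Z%:R != 0 :> R by rewrite gt_eqF.
apply: eq_le; move: (h%:R^-1 : R) ((Z - h)%:R^-1 : R) => a b.
by field.
Qed.

Lemma cut_expansion Z Y X : (0 < Z)%N -> (Y <= Z)%N -> (X < Z)%N ->
  \sum_(h < Z) cut_coef Z Y h * e ((h * X)%:R / Z%:R) = (X < Y)%N%:R :> R[i].
Proof.
move=> Z0 YZ XZ; have ZN : Z%:R != 0 :> R[i] by rewrite pnatr_eq0 -lt0n.
transitivity (\sum_(y < Y) (y == X :> nat)%N%:R : R[i]).
  rewrite /cut_coef; under eq_bigr => h _ do rewrite -mulrA mulr_suml mulr_sumr.
  rewrite exchange_big /=; apply: eq_bigr => y _; rewrite -mulr_sumr.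
  have yZ : (y < Z)%N by exact: leq_trans YZ.
  rewrite eq_sym -(mulKf ZN (X == y)%:R); congr (_ * _).
  transitivity (if X == y :> nat then Z%:R else 0 : R[i]); last first.
    by case: eqP; rewrite ?mulr1 ?mulr0.
  rewrite -(e_orth Z0 XZ yZ); apply: eq_bigr => h _.
  by rewrite conj_e mulrC.
case: (ltnP X Y) => XY.
  rewrite (bigD1 (Ordinal XY)) //= eqxx big1 ?addr0 // => y /eqP yX.
  by case: eqP => // E; case: yX; apply: val_inj.
rewrite big1 // => y _; case: eqP => // E; by move: (ltn_ord y); rewrite E ltnNge XY.
Qed.

(** The condition [X i < Y] is a combination of the characters [e (h * X i / Z)] with coefficients
    of total mass at most [1 + 4 * harmonic Z]; each character amounts to one value of [theta],
    whence the uniform hypothesis. *)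
Lemma cut_bound (I : Type) (r : seq I) (P : pred I) (z : I -> R[i]) (X : I -> nat) Z Y (B : R) :
  (0 < Z)%N -> (Y <= Z)%N -> (forall i, P i -> (X i < Z)%N) ->
  (forall theta : R, cabs (\sum_(i <- r | P i) z i * e (theta * (X i)%:R)) <= B) ->
  cabs (\sum_(i <- r | P i) z i * (X i < Y)%N%:R) <= (1 + 4 * harmonic Z) * B.
Proof.
move=> Z0 YZ XZ BP.
have -> : \sum_(i <- r | P i) z i * (X i < Y)%N%:R =
    \sum_(h < Z) cut_coef Z Y h * \sum_(i <- r | P i) z i * e ((h%:R / Z%:R) * (X i)%:R).
  under [RHS]eq_bigr => h _ do rewrite mulr_sumr.
  rewrite exchange_big /=; apply: eq_bigr => i Pi.
  rewrite -(cut_expansion Z0 YZ (XZ i Pi)) mulr_sumr; apply: eq_bigr => h _.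
  by rewrite mulrCA natrM [h%:R * (X i)%:R / _]mulrAC.
have B0 : 0 <= B := le_trans (cabs_ge0 _) (BP 0).
apply: le_trans (cabs_sum _ _ _) _.
apply: le_trans (ler_wpM2r B0 (cut_coef_sum Z0 YZ)); rewrite mulr_suml.
by apply: ler_sum => h _; rewrite cabsM ler_wpM2l // cabs_ge0.
Qed.

(* Partial summation in the variable [X], so that no cut in [n] alone arises. *)
Lemma log_weight_bound (I : Type) (r : seq I) (P : pred I) (z : I -> R[i]) (X : I -> nat) Y (B : R) :
  (forall Y', (Y' <= Y)%N -> cabs (\sum_(i <- r | P i) z i * (X i < Y')%N%:R) <= B) ->
  cabs (\sum_(i <- r | P i) z i * ((ln (X i)%:R : R)%:C * (X i < Y)%N%:R)) <= 2 * ln Y%:R * B.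
Proof.
move=> BP; pose D j : R := ln j.+1%:R - ln j%:R.
have D0 j : 0 <= D j.
  rewrite subr_ge0; case: j => [|j]; first by rewrite ln0 // ln_ge0.
  by rewrite ler_ln ?posrE ?ltr0n // ler_nat.
have tel n : \sum_(j < n) D j = ln n%:R.
  rewrite -(big_mkord xpredT D) telescope_sumr // (ln0 (lexx 0)) subr0 //.
pose T Y' := \sum_(i <- r | P i) z i * (X i < Y')%N%:R.
have -> : \sum_(i <- r | P i) z i * ((ln (X i)%:R : R)%:C * (X i < Y)%N%:R) =
    \sum_(j < Y) (D j)%:C * (T Y - T j.+1).
  under [RHS]eq_bigr => j _ do rewrite /T -sumrB mulr_sumr.
  rewrite exchange_big /=; apply: eq_bigr => i _.
  transitivity (z i * \sum_(j < Y) ((D j)%:C * ((X i < Y)%N%:R - (X i < j.+1)%N%:R))); last first.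
    by rewrite mulr_sumr; apply: eq_bigr => j _; rewrite -mulrBr mulrCA.
  congr (_ * _); case: (ltnP (X i) Y) => XY; last first.
    rewrite mulr0 big1 // => j _; rewrite ltnS leqNgt (leq_trans (ltn_ord j) XY).
    by rewrite subrr mulr0.
  rewrite mulr1 -tel sum_realC (big_ord_widen Y (fun j => (D j)%:C) (ltnW XY)) big_mkcond /=.
  apply: eq_bigr => j _; rewrite ltnS; case: ltnP => jX; rewrite ?subr0 ?subrr ?mulr1 ?mulr0 //.
apply: le_trans (cabs_sum _ _ _) _.
apply: (@le_trans _ _ (\sum_(j < Y) D j * (B + B))).
  apply: ler_sum => j _; rewrite cabsM cabs_real_ge0 // ler_wpM2l //.
  by apply: le_trans (cabsB _ _) _; apply: lerD; apply: BP.
by rewrite -mulr_suml tel; apply: eq_le; ring.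
Qed.

End Cut.

(** * Vaughan's identity *)

Lemma sum_support (V : zmodType) (G : nat -> V) A B :
  (forall n, (A <= n)%N -> G n = 0) -> (forall n, (B <= n)%N -> G n = 0) ->
  \sum_(n < A) G n = \sum_(n < B) G n.
Proof.
wlog AB : A B / (A <= B)%N => [W GA GB|GA _].
  by case: (leqP A B) => h; [exact: W|symmetry; apply: W => //; exact: ltnW].
rewrite (big_ord_widen B G AB) big_mkcond /=; apply: eq_bigr => n _.
by case: ltnP => // /GA ->.
Qed.

Lemma shell_partition (V : zmodType) (G : nat -> V) q A : (2 <= q)%N ->
  \sum_(m < q ^ A | (0 < m)%N && coprime m q) G m =
  \sum_(i < A) \sum_(m < q ^ i.+1 | shell q i.+1 m) G m.
Proof.
move=> q2; have q0 : (0 < q)%N by exact: leq_trans q2.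
elim: A => [|A IH]; first by rewrite big_ord0 expn0 big_ord1_cond.
have le1 : (q ^ A <= q ^ A.+1)%N by rewrite leq_exp2l.
rewrite big_ord_recr /= -IH (bigID (fun m : 'I__ => (m < q ^ A)%N)) /=; congr (_ + _).
  by rewrite (big_ord_widen_cond _ (fun m => (0 < m)%N && coprime m q) G le1).
apply: eq_bigl => m; rewrite /shell /= ltn_ord /= -leqNgt andbC; case: (leqP (q ^ A) m) => //= Am.
by rewrite (leq_trans _ Am) // expn_gt0 q0.
Qed.

Section Vaughan.
Context {R : realType}.
Variables (Y U V : nat) (F : nat -> R[i]).
Hypothesis F0 : forall n, (Y <= n)%N -> F n = 0.
Notation Lam := (@von_mangoldt R).

(** It vanishes for [0 < m < U], which makes the second term of Vaughan's identity bilinear with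
    both variables large. *)
Definition moebius_tail m : R :=
  \sum_(a < Y | ((0 < a)%N && (a %| m)%N) && (U <= a)%N) moebius a.

Definition moebius_head a : R := if (a < U)%N then moebius a else 0.

Definition vaughan_coef d : R :=
  \sum_(b < Y | ((0 < b)%N && (b %| d)%N) && (b < V)%N) Lam b * moebius_head (d %/ b).

Lemma moebius_tail_le m : (0 < m)%N -> `|moebius_tail m| <= (ndiv m)%:R.
Proof.
move=> m0; apply: le_trans (ler_norm_sum _ _ _) _.
apply: (@le_trans _ _ (\sum_(a < Y | (0 < a)%N && (a %| m)%N) 1)%N%:R).
  rewrite natr_sum big_mkcondr /=; apply: ler_sum => a _; case: ifP => // _.
  exact: moebius_le1.
by rewrite ler_nat (ndiv_ge (P := fun a => (0 < a)%N)).
Qed.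

Lemma moebius_tail0 m : (0 < m)%N -> (m < U)%N -> moebius_tail m = 0.
Proof.
move=> m0 mU; rewrite /moebius_tail big_pred0 // => a; apply/negbTE.
apply/negP => /andP[/andP[_ am]]; rewrite leqNgt => /negP; apply.
exact: leq_ltn_trans (dvdn_leq m0 am) mU.
Qed.

Lemma moebius_head_le1 a : `|moebius_head a| <= 1.
Proof. by rewrite /moebius_head; case: ifP => _; rewrite ?moebius_le1 // normr0. Qed.

Lemma vaughan_coef_le d : (0 < d)%N -> `|vaughan_coef d| <= ln d%:R.
Proof.
move=> d0; have YW : (Y <= Y + d.+1)%N by rewrite leq_addr.
have dW : (d < Y + d.+1)%N by rewrite addnS ltnS leq_addl.
rewrite -(von_mangoldt_sum_ord d0 dW); apply: le_trans (ler_norm_sum _ _ _) _.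
apply: (@le_trans _ _ (\sum_(b < Y | (0 < b)%N && (b %| d)%N) Lam b)); last first.
  rewrite (big_ord_widen_cond _ (fun b => (0 < b)%N && (b %| d)%N) Lam YW).
  rewrite [leRHS](bigID (fun b : 'I__ => (b < Y)%N)) /= lerDl.
  by apply: sumr_ge0 => b _; exact: von_mangoldt_ge0.
rewrite big_mkcondr /=; apply: ler_sum => b _; case: ifP => _; last exact: von_mangoldt_ge0.
rewrite normrM ger0_norm ?von_mangoldt_ge0 // -[leRHS]mulr1 ler_wpM2l ?von_mangoldt_ge0 //.
exact: moebius_head_le1.
Qed.

Lemma vaughan_coef0 d : (U * V <= d)%N -> vaughan_coef d = 0.
Proof.
move=> UVd; rewrite /vaughan_coef big1 // => b /andP[/andP[b0 bd] bV].
rewrite /moebius_head; case: ltnP => dU; last by rewrite mulr0.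
have : (d < U * V)%N by rewrite -(divnK bd) ltn_mul.
by rewrite ltnNge UVd.
Qed.

Let Fmul a : (0 < a)%N -> forall n, (Y <= n)%N -> F (a * n) = 0.
Proof. by move=> a0 n Yn; apply: F0; rewrite (leq_trans Yn) // leq_pmull. Qed.

Lemma moebius_inversion b : (0 < b)%N -> (1 < Y)%N ->
  F b = \sum_(m < Y | (0 < m)%N) (moebius_tail m)%:C * F (b * m)%N +
        \sum_(a < Y | (0 < a)%N && (a < U)%N) (moebius a)%:C * \sum_(k < Y | (0 < k)%N) F (b * (a * k))%N.
Proof.
move=> b0 Y1; rewrite (convolve (@moebius R) (fun a => (a < U)%N) (Fmul b0)) -big_split /=.
have tot m : (0 < m)%N -> (m < Y)%N -> moebius_tail m +
    \sum_(a < Y | ((0 < a)%N && (a %| m)%N) && (a < U)%N) moebius a = (m == 1%N)%:R.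
  move=> m0 mY; rewrite -(moebius_sum_ord m0 mY) [RHS](bigID (fun a : 'I_Y => (U <= a)%N)) /=.
  by congr (_ + _); apply: eq_bigl => a; rewrite -ltnNge.
transitivity (\sum_(m < Y | (0 < m)%N) ((m == 1%N :> nat)%:R : R)%:C * F (b * m)%N).
  rewrite (bigD1 (Ordinal Y1)) //= mul1r muln1 big1 ?addr0 // => m /andP[_ m1].
  case: eqP => [E|_]; last by rewrite mul0r.
  by case/eqP: m1; apply: val_inj.
by apply: eq_bigr => m m0; rewrite -mulrDl -rmorphD /= tot.
Qed.

(** For [b >= V], [moebius_inversion] splits [F b] according to the size of [a]. In the part
    [a < U], the sum over all [b] collapses because the divisor sum of [Lam] is [ln], and the terms
    [b < V] are subtracted again; grouped by [d = a b] these give [vaughan_coef]. *)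
Lemma vaughan : (1 < Y)%N ->
  \sum_(b < Y | (0 < b)%N) (Lam b)%:C * F b =
  \sum_(b < Y | (0 < b)%N && (b < V)%N) (Lam b)%:C * F b +
  \sum_(m < Y | (0 < m)%N) (moebius_tail m)%:C *
     \sum_(b < Y | (0 < b)%N && ~~ (b < V)%N) (Lam b)%:C * F (m * b)%N +
  (\sum_(a < Y | (0 < a)%N && (a < U)%N) (moebius a)%:C *
     \sum_(n < Y | (0 < n)%N) (ln n%:R)%:C * F (a * n)%N -
   \sum_(d < Y | (0 < d)%N) (vaughan_coef d)%:C * \sum_(k < Y | (0 < k)%N) F (d * k)%N).
Proof.
move=> Y1; rewrite [LHS](bigID (fun b : 'I_Y => (b < V)%N)) /= -addrA; congr (_ + _).
transitivity (\sum_(b < Y | (0 < b)%N && ~~ (b < V)%N)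
   ((Lam b)%:C * (\sum_(m < Y | (0 < m)%N) (moebius_tail m)%:C * F (b * m)%N) +
    (Lam b)%:C * (\sum_(a < Y | (0 < a)%N && (a < U)%N)
      (moebius a)%:C * \sum_(k < Y | (0 < k)%N) F (b * (a * k))%N))).
  by apply: eq_bigr => b /andP[b0 _]; rewrite {1}(moebius_inversion b0 Y1) mulrDr.
rewrite big_split /=; congr (_ + _).
  under eq_bigr => b _ do rewrite mulr_sumr.
  rewrite exchange_big /=; apply: eq_bigr => m _; rewrite mulr_sumr; apply: eq_bigr => b _.
  by rewrite mulrCA mulnC.
pose G d := \sum_(k < Y | (0 < k)%N) F (d * k)%N.
have G0 d : (Y <= d)%N -> G d = 0.
  move=> Yd; rewrite /G big1 // => k k0; apply: F0; rewrite (leq_trans Yd) // leq_pmulr //.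
have full a : (0 < a)%N -> \sum_(b < Y | (0 < b)%N) (Lam b)%:C * G (a * b)%N =
    \sum_(n < Y | (0 < n)%N) (ln n%:R)%:C * F (a * n)%N.
  move=> a0; transitivity (\sum_(b < Y | (0 < b)%N && true) (Lam b)%:C *
      \sum_(k < Y | (0 < k)%N) F (a * (b * k))%N).
    apply: eq_big => [b|b _]; first by rewrite andbT.
    by congr (_ * _); apply: eq_bigr => k _; rewrite mulnA.
  rewrite (convolve Lam xpredT (Fmul a0)); apply: eq_bigr => n n0.
  congr (_%:C * _); rewrite -(von_mangoldt_sum_ord n0 (ltn_ord n)).
  by apply: eq_bigl => b; rewrite andbT.
transitivity (\sum_(a < Y | (0 < a)%N && (a < U)%N) (moebius a)%:C *
    \sum_(b < Y | (0 < b)%N && ~~ (b < V)%N) (Lam b)%:C * G (a * b)%N).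
  under eq_bigr => b _ do rewrite mulr_sumr.
  rewrite exchange_big /=; apply: eq_bigr => a _; rewrite mulr_sumr; apply: eq_bigr => b _.
  rewrite mulrCA; congr (_ * (_ * _)); apply: eq_bigr => k _.
  by rewrite mulnCA mulnA.
transitivity (\sum_(a < Y | (0 < a)%N && (a < U)%N) ((moebius a)%:C *
     (\sum_(n < Y | (0 < n)%N) (ln n%:R)%:C * F (a * n)%N) -
    (moebius a)%:C * \sum_(b < Y | (0 < b)%N && (b < V)%N) (Lam b)%:C * G (a * b)%N)).
  apply: eq_bigr => a /andP[a0 _]; rewrite -full // -mulrBr; congr (_ * _).
  by rewrite [in RHS](bigID (fun b : 'I_Y => (b < V)%N)) /= addrAC subrr add0r.
rewrite sumrB; congr (_ - _).
transitivity (\sum_(b < Y | (0 < b)%N && (b < V)%N) (Lam b)%:C *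
    \sum_(d < Y | (0 < d)%N && (b %| d)%N) (moebius_head (d %/ b))%:C * G d).
  under eq_bigr => a _ do rewrite mulr_sumr.
  rewrite exchange_big /=; apply: eq_bigr => b /andP[b0 _].
  pose H d := (moebius_head (d %/ b))%:C * G d.
  rewrite -(sum_multiples (F := H) b0) /H; last by move=> d Yd; rewrite G0 // mulr0.
  rewrite mulr_sumr big_mkcondr /=; apply: eq_bigr => a a0.
  rewrite mulKn // /moebius_head mulnC; case: ifP => _; last by rewrite mul0r mulr0.
  by rewrite mulrCA.
under [LHS]eq_bigr => b _ do rewrite mulr_sumr.
rewrite (exchange_big_dep (fun d : 'I_Y => (0 < d)%N)) /=; last by move=> b d _ /andP[].
apply: eq_bigr => d d0; rewrite -/(G d) /vaughan_coef sum_realC mulr_suml.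
apply: eq_big => [b|b _]; first by rewrite d0 /= andbAC.
by rewrite rmorphM mulrA.
Qed.

End Vaughan.

(** * Estimates on the shells *)

Lemma le_sqrt_mul (R : realType) (x y D : R) : 0 <= x -> 0 <= y -> 0 <= D ->
  x ^+ 2 <= D * y ^+ 2 -> x <= Num.sqrt D * y.
Proof.
move=> x0 y0 D0 h; rewrite -ler_sqr ?nnegrE ?mulr_ge0 ?sqrtr_ge0 //.
by rewrite exprMn sqr_sqrtr.
Qed.

Section Shells.
Context {R : realType}.
Variables (q : nat) (f : nat -> R[i]) (K : R).
Hypothesis q2 : (2 <= q)%N.
Hypothesis fU : forall n, cabs (f n) = 1.
Hypothesis K1 : 1 <= K.
Hypothesis propK : forall lam kap rho, (rho < lam)%N ->
  #|propagation_exceptions q f lam kap rho|%:R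
  <= K * weight q rho * (q ^ lam)%:R / (q ^ rho)%:R.

Variables (N l s v : nat) (Mf Cf Cw hh : R).
Hypotheses (s0 : (0 < s)%N) (sl : (40 * s <= l + 40)%N) (l300 : (300 <= l)%N).
Hypotheses (lN : (40 * l <= N)%N) (v1 : (N + 4 * s <= 2 * v)%N) (v2 : (2 * v <= N + 1 + 4 * s)%N).
Hypothesis Cf0 : 0 <= Cf.
Hypothesis FS : forall t, (l < t)%N -> fourier_sup q f t Mf.
Hypothesis FC : Mf ^+ 2 * (q ^ (36 * s))%:R <= Cf.
Hypothesis CwP : forall j, weight q (4 * j) <= Cw * (q ^ j)%:R.
Hypotheses (hh1 : 1 <= hh) (hhP : (q%:R * (2 * N)%:R) ^+ 3 <= hh ^+ 2).

Let q0 : (0 < q)%N. Proof. exact: q_gt0. Qed.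
Let qn0 n : 0 < (q ^ n)%:R :> R. Proof. exact: expqR_gt0. Qed.
Let w : R := weight q (12 * s).
Let w1 : 1 <= w. Proof. exact: weight_ge1. Qed.
Let K0 : 0 <= K. Proof. exact: le_trans K1. Qed.
Let hh0 : 0 <= hh. Proof. exact: le_trans hh1. Qed.

Definition cut_cost : R := 1 + 4 * harmonic (q ^ N.+1).
Definition saving : R := (q ^ N.+1)%:R / (q ^ s)%:R.

Lemma saving_ge0 : 0 <= saving. Proof. by rewrite divr_ge0. Qed.

Lemma cut_cost_ge0 : 0 <= cut_cost.
Proof. by rewrite addr_ge0 // mulr_ge0 // harmonic_ge0. Qed.

Lemma ndiv_square_sum_expn M : (M <= 2 * N)%N ->
  \sum_(a < q ^ M) (ndiv a)%:R ^+ 2 <= (q ^ M)%:R * hh ^+ 2.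
Proof.
move=> MN; apply: le_trans (ndiv_square_sum _) _; rewrite ler_wpM2l //.
apply: le_trans hhP; rewrite lerXn2r ?nnegrE ?harmonic_ge0 ?mulr_ge0 //.
by apply: le_trans (harmonic_expn _ q2) _; rewrite ler_wpM2l // ler_nat.
Qed.

(** The cut [m n < Y] is removed first, as this only moves [theta]; Cauchy-Schwarz in [m] then
    separates the coefficients [alpha] from the sums over [n]. *)
Lemma shell_bound mu nu (alpha b : nat -> R[i]) (La D theta : R) Y :
  (mu + nu = N.+1)%N -> (Y <= q ^ N.+1)%N -> 0 <= La -> 0 <= D ->
  \sum_(m < q ^ mu | shell q mu m) cabs (alpha m) ^+ 2 <= (q ^ mu)%:R * La ^+ 2 ->
  (forall theta, \sum_(m < q ^ mu | shell q mu m)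
     cabs (\sum_(n < q ^ nu) b n * (f (m * n)%N * e (theta * (m * n)%:R))) ^+ 2
     <= D * ((q ^ mu)%:R * (q ^ nu)%:R ^+ 2) / (q ^ (2 * s))%:R) ->
  cabs (\sum_(m < q ^ mu | shell q mu m) \sum_(n < q ^ nu)
     (alpha m * (b n * (f (m * n)%N * e (theta * (m * n)%:R)))) * (m * n < Y)%N%:R)
  <= cut_cost * (La * Num.sqrt D * saving).
Proof.
move=> muN YN La0 D0 aP bP.
have Z0 : (0 < q ^ N.+1)%N by rewrite expn_gt0 q0.
pose z (p : 'I_(q ^ mu) * 'I_(q ^ nu)) : R[i] :=
  alpha p.1 * (b p.2 * (f (p.1 * p.2)%N * e (theta * (p.1 * p.2)%:R))).
pose X (p : 'I_(q ^ mu) * 'I_(q ^ nu)) : nat := (p.1 * p.2)%N.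
have XZ (p : 'I_(q ^ mu) * 'I_(q ^ nu)) : shell q mu p.1 && true -> (X p < q ^ N.+1)%N.
  by move=> _; rewrite /X -muN expnD ltn_mul.
rewrite pair_big /=; apply: (cut_bound (z := z) Z0 YN XZ) => th.
have -> : \sum_(p : 'I_(q ^ mu) * 'I_(q ^ nu) | shell q mu p.1 && true) z p * e (th * (X p)%:R) =
    \sum_(m < q ^ mu | shell q mu m) alpha m *
      \sum_(n < q ^ nu) b n * (f (m * n)%N * e ((theta + th) * (m * n)%:R)).
  under [RHS]eq_bigr => m _ do rewrite mulr_sumr.
  rewrite [RHS]pair_big /=; apply: eq_bigr => p _; rewrite /z /X mulrDl eD.
  by rewrite -!mulrA.
rewrite [leRHS]mulrAC [leRHS]mulrC.
apply: le_sqrt_mul => //; rewrite ?cabs_ge0 ?mulr_ge0 ?saving_ge0 //.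
apply: le_trans (cabs_CS _ _ _ _) _.
apply: (@le_trans _ _ (((q ^ mu)%:R * La ^+ 2) * (D * ((q ^ mu)%:R * (q ^ nu)%:R ^+ 2) / (q ^ (2 * s))%:R))).
  by apply: ler_pM; rewrite ?aP ?bP //; apply: sumr_ge0 => m _; rewrite sqr_ge0.
apply: eq_le; rewrite /saving -muN expnD natrM [(2 * s)%N]mulnC expnM [((q ^ s) ^ 2)%:R]natrX.
move: (gt_eqF (qn0 s)); move: ((q ^ s)%:R : R) ((q ^ mu)%:R : R) ((q ^ nu)%:R : R) => x a c xN.
by field; rewrite xN.
Qed.

Definition type_two_factor : R := 8 * (2 * Cf + (36 * q%:R + 16) * K + 1) * w.

(** From [mu + v <= N] and [N + 4 * s <= 2 * v] follows [mu + 4 * s <= N.+1 - mu], so the range of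
    [n] contains a full period. This is why [q ^ v] exceeds the square root of [q ^ N] by
    [q ^ (2 * s)]. *)
Lemma type_two_shell mu (alpha : nat -> R[i]) (b : nat -> R[i]) (Lb theta : R) Y :
  (l < mu)%N -> (mu + v <= N)%N -> (Y <= q ^ N.+1)%N ->
  (forall m, shell q mu m -> cabs (alpha m) <= (ndiv m)%:R) ->
  (forall n, cabs (b n) <= Lb) ->
  cabs (\sum_(m < q ^ mu | shell q mu m) \sum_(n < q ^ (N.+1 - mu))
     (alpha m * (b n * (f (m * n)%N * e (theta * (m * n)%:R)))) * (m * n < Y)%N%:R)
  <= cut_cost * (hh * Num.sqrt (type_two_factor * Lb ^+ 2) * saving).
Proof.
move=> lmu muv YN aP bP.
have E : (mu + (N.+1 - mu) = N.+1)%N by clear -muv; lia.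
have c1 : (8 * s < mu)%N by clear -sl l300 lmu; lia.
have c2 : (mu + 4 * s <= N.+1 - mu)%N by clear -muv v1; lia.
have c3 : (l < mu + 4 * s)%N by clear -lmu; lia.
have c4 : (mu <= 2 * N)%N by clear -muv; lia.
have w0 : 0 <= w := le_trans ler01 w1.
have K0' := K0.
apply: shell_bound => //.
- by rewrite /type_two_factor; nneg.
- apply: le_trans (ndiv_square_sum_expn c4); rewrite big_mkcond /=.
  apply: ler_sum => m _; case: ifP => [sm|_]; last by rewrite sqr_ge0.
  by rewrite ler_sqr ?nnegrE ?cabs_ge0 // aP.
- by move=> th; exact: (type_two_square q2 fU K1 propK th s0 c1 c2 Cf0 bP (FS c3) FC).
Qed.

Definition type_one_factor : R := type_one_const q K Cf (8 * K * Cw + 2) * w * hh.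

Let Cw0 : 0 <= Cw.
Proof.
have := le_trans (weight_ge1 (R := R) q2 _) (CwP 0); rewrite expn0 mulr1.
exact: le_trans.
Qed.

(** By [CwP] the weight at [4 j] costs only [q ^ j], so [q ^ (3 j)] remains to compensate the excess
    of the period over the range of [n]; [j = l + 4 s] suffices as [mu - nu <= 2 l + 4 s]. *)
Let weight_gain mu nu : (mu <= l + v)%N -> (mu + nu = N.+1)%N ->
  weight q (4 * (l + 4 * s)) * (q ^ (mu + 2 * s + 2 * s))%:R * (q ^ (2 * s))%:R
  <= Cw * (q ^ nu)%:R * (q ^ (4 * (l + 4 * s)))%:R.
Proof.
move=> mul muN; have qlt : (1 < q)%N := q2.
have ineq : (l + 4 * s + (mu + 2 * s + 2 * s) + 2 * s <= nu + 4 * (l + 4 * s))%N.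
  by clear -mul muN v2; lia.
apply: (@le_trans _ _ (Cw * (q ^ (l + 4 * s))%:R * (q ^ (mu + 2 * s + 2 * s))%:R * (q ^ (2 * s))%:R)).
  by rewrite ler_wpM2r // ler_wpM2r.
by rewrite -!mulrA ler_wpM2l // -!natrM ler_nat -!expnD addnA leq_exp2l.
Qed.

(** [FS] needs a period with more than [l] digits. For [mu <= l] this is ensured by taking [q ^ l]
    distances; for larger [mu], [q ^ (2 * s)] of them suffice, but the period may exceed the range
    of [n]. *)
Lemma type_one_box mu theta : (0 < mu)%N -> (mu <= l + v)%N ->
  \sum_(m < q ^ mu | shell q mu m)
    cabs (\sum_(n < q ^ (N.+1 - mu)) unit_ind q n * (f (m * n)%N * e (theta * (m * n)%:R))) ^+ 2 <=
  type_one_factor * ((q ^ mu)%:R * (q ^ (N.+1 - mu))%:R ^+ 2) / (q ^ (2 * s))%:R.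
Proof.
move=> mu0 mulv.
have w0 : 0 <= w := le_trans ler01 w1.
have K0' := K0.
have C00 : 0 <= 8 * K * Cw + 2 by have := Cw0 => ?; nneg.
set nu := (N.+1 - mu)%N.
have E : (mu + nu = N.+1)%N by clear -mulv lN sl v2 l300; rewrite /nu; lia.
clearbody nu.
case: (leqP mu l) => mul.
  have d1 : (2 * s <= l)%N by clear -sl l300; lia.
  have d2 : (l + 2 * s < nu)%N by clear -sl l300 mul E lN; lia.
  have d3 : (6 * s < mu + l + 2 * s)%N by clear -sl l300; lia.
  have d4 : (l < mu + l + 2 * s)%N by clear -mu0; lia.
  have d5 : (mu + l <= 2 * N)%N by clear -mul lN; lia.
  have d6 : (mu + l + 2 * s <= nu)%N by clear -mul lN E sl l300; lia.
  apply: (type_one_square q2 fU K1 propK mu0 s0 d1 d2 d3 Cf0 (FS d4) FC hh1 (ndiv_square_sum_expn d5) C00).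
  move=> r _; apply: le_trans (fibre_sum_long f q2 theta r mu0 d6) _.
  rewrite lerDr; nneg; exact: ltW.
have d1 : (2 * s <= 2 * s)%N by [].
have d2 : (2 * s + 2 * s < nu)%N by clear -sl l300 mulv E lN v2; lia.
have d3 : (6 * s < mu + 2 * s + 2 * s)%N by clear -sl l300 mul; lia.
have d4 : (l < mu + 2 * s + 2 * s)%N by clear -mul; lia.
have d5 : (mu + 2 * s <= 2 * N)%N by clear -E lN sl l300; lia.
apply: (type_one_square q2 fU K1 propK mu0 s0 d1 d2 d3 Cf0 (FS d4) FC hh1 (ndiv_square_sum_expn d5) C00).
move=> r _; case: (leqP (mu + 2 * s + 2 * s) nu) => tn.
  apply: le_trans (fibre_sum_long f q2 theta r mu0 tn) _.
  rewrite lerDr; nneg; exact: ltW.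
have r3 : (0 < 4 * (l + 4 * s))%N by clear -l300; lia.
have Jt : (2 * l + 16 * s + 4 * (l + 4 * s) < mu + 2 * s + 2 * s)%N by clear -tn E lN sl l300; lia.
(* The value [kap = 2 l + 16 s] is dictated here, by [mu - nu <= 2 l + 4 s]. In [e3], eliminating
   [mu] and [nu] leaves [34 l + 204 s <= N + 1], which [40 s <= l + 40], [300 <= l] and [40 l <= N]
   provide. *)
have e2 : (2 * (mu + 2 * s + 2 * s) + 4 * s <= mu + nu + (2 * l + 16 * s))%N by clear -E mulv v2; lia.
have e3 : (mu + 2 * s + 2 * s + 4 * (2 * l + 16 * s + 4 * (l + 4 * s) + (2 * l + 16 * s)) + 4 * s
    <= mu + 2 * nu)%N by clear -E mulv v2 lN sl l300; lia.
apply: le_trans (fibre_sum_short q2 fU K1 propK theta r mu0 tn r3 Jt (weight_gain mulv E) e2 e3) _.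
rewrite lerD2r ler_wpM2r ?invr_ge0 // ler_wpM2r ?mulr_ge0 // ler_peMr //.
Qed.

Lemma type_one_shell mu (alpha : nat -> R[i]) (La theta : R) Y :
  (0 < mu)%N -> (mu <= l + v)%N -> (Y <= q ^ N.+1)%N -> 0 <= La ->
  (forall m, shell q mu m -> cabs (alpha m) <= La) ->
  cabs (\sum_(m < q ^ mu | shell q mu m) \sum_(n < q ^ (N.+1 - mu))
     (alpha m * (unit_ind q n * (f (m * n)%N * e (theta * (m * n)%:R)))) * (m * n < Y)%N%:R)
  <= cut_cost * (La * Num.sqrt type_one_factor * saving).
Proof.
move=> mu0 mulv YN La0 aP.
have E : (mu + (N.+1 - mu) = N.+1)%N by clear -mulv lN sl v2 l300; lia.
have w0 : 0 <= w := le_trans ler01 w1.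
have K0' := K0.
apply: shell_bound => //.
- by have := Cw0 => ?; rewrite /type_one_factor /type_one_const; nneg.
- apply: (@le_trans _ _ (\sum_(m < q ^ mu) La ^+ 2)); last first.
    by rewrite sumr_const card_ord -[_ *+ _]mulr_natl.
  rewrite big_mkcond /=; apply: ler_sum => m _; case: ifP => [sm|_]; last by rewrite sqr_ge0.
  by rewrite ler_sqr ?nnegrE ?cabs_ge0 // aP.
- by move=> th; exact: type_one_box.
Qed.

End Shells.

(** * Vaughan's identity applied to the sieved sum *)

Section PrimeSum.
Context {R : realType}.
Variables (q : nat) (f : nat -> R[i]) (K : R).
Hypothesis q2 : (2 <= q)%N.
Hypothesis fU : forall n, cabs (f n) = 1.
Hypothesis K1 : 1 <= K.
Hypothesis propK : forall lam kap rho, (rho < lam)%N ->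
  #|propagation_exceptions q f lam kap rho|%:R
  <= K * weight q rho * (q ^ lam)%:R / (q ^ rho)%:R.

Variables (N l s v : nat) (Mf Cf Cw hh : R).
Hypotheses (s0 : (0 < s)%N) (sl : (40 * s <= l + 40)%N) (l300 : (300 <= l)%N).
Hypotheses (lN : (40 * l <= N)%N) (v1 : (N + 4 * s <= 2 * v)%N) (v2 : (2 * v <= N + 1 + 4 * s)%N).
Hypothesis Cf0 : 0 <= Cf.
Hypothesis FS : forall t, (l < t)%N -> fourier_sup q f t Mf.
Hypothesis FC : Mf ^+ 2 * (q ^ (36 * s))%:R <= Cf.
Hypothesis CwP : forall j, weight q (4 * j) <= Cw * (q ^ j)%:R.
Hypotheses (hh1 : 1 <= hh) (hhP : (q%:R * (2 * N)%:R) ^+ 3 <= hh ^+ 2).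
Variables (theta : R) (Y : nat).
Hypotheses (Y1 : (1 < Y)%N) (YN : (Y <= q ^ N)%N).

Let q0 : (0 < q)%N. Proof. exact: q_gt0. Qed.
Let L : R := N%:R * ln q%:R.
Let U := (q ^ l)%N.
Let V := (q ^ v)%N.
Let lvN : (l + v <= N)%N. Proof. by clear -lN sl v2 l300; lia. Qed.
Let YN1 : (Y <= q ^ N.+1)%N.
Proof. by apply: leq_trans YN _; rewrite leq_exp2l. Qed.

Let lnq0 : 0 <= ln q%:R :> R. Proof. by rewrite ln_ge0 // ler1n. Qed.
Let L0 : 0 <= L. Proof. by rewrite mulr_ge0. Qed.

Let lnL n : (n <= q ^ N)%N -> ln n%:R <= L.
Proof.
move=> nN; case: (posnP n) => [->|n0]; first by rewrite ln0.
have -> : L = ln (q ^ N)%:R by rewrite natrX lnXn ?ltr0n // /L mulr_natl.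
by rewrite ler_ln ?posrE ?ltr0n ?expn_gt0 ?q0 // ler_nat.
Qed.

(** Cut-off, twist and coprimality to [q] in one function: wherever it is nonzero at a product
    [m n], both factors are coprime to [q]. *)
Definition sieved n : R[i] :=
  if (n < Y)%N then unit_ind q n * (f n * e (theta * n%:R)) else 0.
Let F := sieved.

Lemma sieved0 n : (Y <= n)%N -> F n = 0.
Proof. by move=> Yn; rewrite /F /sieved ltnNge Yn. Qed.

Lemma sieved_le1 n : cabs (F n) <= 1.
Proof.
rewrite /F /sieved; case: ifP => _; last by rewrite cabs0.
by rewrite !cabsM fU cabs_e !mulr1 unit_ind_le1.
Qed.

Let F_mul m n : coprime m q ->
  F (m * n)%N = unit_ind q n * (f (m * n)%N * e (theta * (m * n)%:R)) * (m * n < Y)%N%:R.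
Proof.
move=> cm; rewrite /F /sieved; case: ifP => _; rewrite ?mulr1 ?mulr0 //.
by rewrite unit_ind_mul.
Qed.

Let F_ncop m n : ~~ coprime m q -> F (m * n)%N = 0.
Proof.
move=> cm; rewrite /F /sieved; case: ifP => // _.
by rewrite /unit_ind coprimeMl (negbTE cm) mul0r.
Qed.

Let F00 m : F (m * 0)%N = 0.
Proof.
rewrite /F /sieved muln0; case: ifP => // _.
by rewrite /unit_ind /coprime gcd0n gtn_eqF // mul0r.
Qed.

Let Fm m n : (0 < m)%N -> (Y <= n)%N -> F (m * n)%N = 0.
Proof. by move=> m0 Yn; apply: sieved0; rewrite (leq_trans Yn) // leq_pmull. Qed.

Let Fn m n : (0 < n)%N -> (Y <= m)%N -> F (m * n)%N = 0.
Proof. by move=> n0 Ym; apply: sieved0; rewrite (leq_trans Ym) // leq_pmulr. Qed.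

(** As [m >= q ^ mu.-1] on the shell, [m n < Y <= q ^ N] forces [n < q ^ (N.+1 - mu)]; hence boxes
    whose exponents add up to [N.+1]. *)
Lemma inner_sum (g : nat -> R) mu m : (0 < mu)%N -> (mu <= N)%N -> shell q mu m ->
  \sum_(n < Y | (0 < n)%N) (g n)%:C * F (m * n)%N =
  \sum_(n < q ^ (N.+1 - mu)) (g n)%:C *
    (unit_ind q n * (f (m * n)%N * e (theta * (m * n)%:R)) * (m * n < Y)%N%:R).
Proof.
move=> mu0 muN sm; have /and3P[lo hi cm] := sm.
have m0 : (0 < m)%N by apply: leq_trans lo; rewrite expn_gt0 q0.
pose G n := (g n)%:C * F (m * n)%N.
transitivity (\sum_(n < Y) G n).
  rewrite big_mkcond /=; apply: eq_bigr => n _; case: posnP => //.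
  by rewrite /G => ->; rewrite F00 mulr0.
rewrite (sum_support (B := (q ^ (N.+1 - mu))%N)).
- by apply: eq_bigr => n _; rewrite /G F_mul.
- by move=> n Yn; rewrite /G Fm // mulr0.
- move=> n nu; rewrite /G sieved0 ?mulr0 //; apply: leq_trans YN _.
  have -> : (q ^ N = q ^ mu.-1 * q ^ (N.+1 - mu))%N.
    by rewrite -expnD; congr (_ ^ _)%N; clear -mu0 muN; lia.
  exact: leq_mul.
Qed.

Lemma outer_sum (T : nat -> R[i]) A :
  (forall m, ~~ coprime m q -> T m = 0) ->
  (forall m, (0 < m)%N -> (q ^ A <= m)%N -> T m = 0) ->
  (forall m, (Y <= m)%N -> T m = 0) ->
  \sum_(m < Y | (0 < m)%N) T m = \sum_(i < A) \sum_(m < q ^ i.+1 | shell q i.+1 m) T m.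
Proof.
move=> Tc TA TY; rewrite -shell_partition //.
rewrite [LHS]big_mkcond [RHS]big_mkcond /=.
rewrite (sum_support (G := fun m => if (0 < m)%N then T m else 0) (B := (q ^ A)%N)).
- apply: eq_bigr => m _; case: (0 < m)%N => //=; case: ifP => // /negbT cm.
  by rewrite Tc.
- by move=> m /TY ->; case: ifP.
- by move=> m mA; case: ifP => // m0; rewrite TA.
Qed.

Lemma trivial_part :
  cabs (\sum_(b < Y | (0 < b)%N && (b < V)%N) (von_mangoldt R b)%:C * F b) <= V%:R * L.
Proof.
apply: le_trans (cabs_sum _ _ _) _.
apply: (@le_trans _ _ (\sum_(b < Y) (0 <= b < 0 + V)%N%:R * L)).
  rewrite big_mkcond /=; apply: ler_sum => b _; rewrite add0n.
  case: ifP => [/andP[_ bV]|_]; last by rewrite mulr_ge0.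
  rewrite bV /= mul1r cabsM cabs_real_ge0 ?von_mangoldt_ge0 // -[leRHS]mulr1.
  apply: ler_pM; rewrite ?cabs_ge0 ?von_mangoldt_ge0 ?sieved_le1 //.
  apply: le_trans (von_mangoldt_le_ln _) _; apply: lnL.
  exact: leq_trans (ltnW (ltn_ord b)) YN.
by rewrite -mulr_suml ler_wpM2r // -natr_sum ler_nat count_interval.
Qed.

Let cc := cut_cost (R := R) q N.
Let sv := saving (R := R) q N s.
Let S2 : R := Num.sqrt (type_two_factor q K s Cf * L ^+ 2).
Let S1 : R := Num.sqrt (type_one_factor q K s Cf Cw hh).

Let cc0 : 0 <= cc. Proof. exact: cut_cost_ge0. Qed.
Let sv0 : 0 <= sv. Proof. exact: saving_ge0. Qed.
Let S10 : 0 <= S1. Proof. exact: sqrtr_ge0. Qed.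
Let S20 : 0 <= S2. Proof. exact: sqrtr_ge0. Qed.
Let hh0 : 0 <= hh. Proof. exact: le_trans hh1. Qed.

(** [moebius_tail] vanishes for [m < U], and [F (m b)] vanishes for [m >= q ^ (N - v)] when
    [b >= V], so only the shells [l < mu <= N - v] remain. *)
Lemma type_two_part :
  cabs (\sum_(m < Y | (0 < m)%N) (moebius_tail Y U m)%:C *
     \sum_(b < Y | (0 < b)%N && ~~ (b < V)%N) (von_mangoldt R b)%:C * F (m * b)%N)
  <= N%:R * (cc * (hh * S2 * sv)).
Proof.
(* The upper limit changes nothing for [b < Y], but makes [g] at most [L] for every [b]. *)
pose g b : R := if (V <= b < q ^ N)%N then von_mangoldt R b else 0.
have g_le b : cabs ((g b)%:C * unit_ind q b) <= L.
  rewrite cabsM cabs_real -[leRHS]mulr1; apply: ler_pM; rewrite ?cabs_ge0 ?unit_ind_le1 //.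
  rewrite /g; case: ifP => [/andP[_ bN]|_]; last by rewrite normr0.
  rewrite ger0_norm ?von_mangoldt_ge0 //; apply: le_trans (von_mangoldt_le_ln _) _.
  by apply: lnL; exact: ltnW.
have gE m : \sum_(b < Y | (0 < b)%N && ~~ (b < V)%N) (von_mangoldt R b)%:C * F (m * b)%N =
    \sum_(b < Y | (0 < b)%N) (g b)%:C * F (m * b)%N.
  rewrite big_mkcondr /=; apply: eq_bigr => b _; rewrite /g -leqNgt.
  rewrite (leq_trans (ltn_ord b) YN) andbT; case: ifP => // _; by rewrite mul0r.
under eq_bigr => m _ do rewrite gE.
pose T m : R[i] := (moebius_tail Y U m)%:C * \sum_(b < Y | (0 < b)%N) (g b)%:C * F (m * b)%N.
rewrite (outer_sum (T := T) (A := (N - v)%N)) /T.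
- have NvN : (N - v <= N)%N by rewrite leq_subr.
  apply: le_trans (cabs_sum _ _ _) _.
  apply: (@le_trans _ _ ((N - v)%:R * (cc * (hh * S2 * sv)))); last first.
    by rewrite ler_wpM2r ?mulr_ge0 // ler_nat.
  apply: ler_sum_ord => i; case: (leqP i.+1 l) => il.
    rewrite big1 ?cabs0 ?mulr_ge0 // => m /and3P[lo hi _].
    rewrite moebius_tail0 ?mul0r //; first by apply: leq_trans lo; rewrite expn_gt0 q0.
    by apply: leq_trans hi _; rewrite leq_exp2l.
  have iN : (i.+1 + v <= N)%N by have := ltn_ord i; clear; lia.
  have iN' : (i.+1 <= N)%N by clear -iN; lia.
  have aP m : shell q i.+1 m -> cabs ((moebius_tail Y U m : R)%:C) <= (ndiv m)%:R.
    move=> /and3P[lo _ _]; rewrite cabs_real; apply: moebius_tail_le.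
    by apply: leq_trans lo; rewrite expn_gt0 q0.
  have := type_two_shell q2 fU K1 propK s0 sl l300 v1 Cf0 FS FC hh1 hhP theta il iN YN1 aP g_le.
  rewrite -/cc -/sv -/S2; apply: le_trans; apply: eq_le; congr cabs.
  apply: eq_bigr => m sm; rewrite (inner_sum g (ltn0Sn i) iN' sm) mulr_sumr.
  by apply: eq_bigr => n _; rewrite !mulrA.
- by move=> m cm; rewrite big1 ?mulr0 // => b _; rewrite F_ncop // mulr0.
- move=> m m0 mA; rewrite big1 ?mulr0 // => b _; rewrite /g; case: ifP => [/andP[Vb _]|_]; last by rewrite mul0r.
  rewrite sieved0 ?mulr0 //; apply: leq_trans YN _.
  have -> : (q ^ N = q ^ (N - v) * V)%N by rewrite -expnD subnK //; clear -lvN; lia.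
  exact: leq_mul.
- by move=> m Ym; rewrite big1 ?mulr0 // => b b0; rewrite Fn // mulr0.
Qed.

Lemma type_one_part A (c : nat -> R) (La : R) : (A <= l + v)%N -> 0 <= La ->
  (forall m, (q ^ A <= m)%N -> c m = 0) ->
  (forall m, (0 < m)%N -> (m < q ^ A)%N -> `|c m| <= La) ->
  cabs (\sum_(m < Y | (0 < m)%N) (c m)%:C * \sum_(k < Y | (0 < k)%N) F (m * k)%N)
  <= A%:R * (cc * (La * S1 * sv)).
Proof.
move=> Alv La0 cA cL.
pose T m : R[i] := (c m)%:C * \sum_(k < Y | (0 < k)%N) F (m * k)%N.
rewrite (outer_sum (T := T) (A := A)) /T.
- apply: le_trans (cabs_sum _ _ _) _; apply: ler_sum_ord => i.
  have iA : (i.+1 <= l + v)%N by apply: leq_trans Alv.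
  have iN : (i.+1 <= N)%N by apply: leq_trans lvN.
  have aP m : shell q i.+1 m -> cabs ((c m)%:C) <= La.
    move=> /and3P[lo hi _]; rewrite cabs_real; apply: cL.
      by apply: leq_trans lo; rewrite expn_gt0 q0.
    by apply: leq_trans hi _; rewrite leq_exp2l.
  have := type_one_shell q2 fU K1 propK s0 sl l300 lN v2 Cf0 FS FC CwP hh1 hhP theta (ltn0Sn i) iA YN1 La0 aP.
  rewrite -/cc -/sv -/S1; apply: le_trans; apply: eq_le; congr cabs.
  apply: eq_bigr => m sm.
  transitivity ((c m)%:C * \sum_(n < Y | (0 < n)%N) (1 : R)%:C * F (m * n)%N).
    by congr (_ * _); apply: eq_bigr => k _; rewrite mul1r.
  rewrite (inner_sum (fun=> 1) (ltn0Sn i) iN sm) mulr_sumr.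
  by apply: eq_bigr => n _; rewrite mul1r !mulrA.
- by move=> m cm; rewrite big1 ?mulr0 // => b _; rewrite F_ncop.
- by move=> m m0 mA; rewrite cA // mul0r.
- by move=> m Ym; rewrite big1 ?mulr0 // => b b0; rewrite Fn.
Qed.

(** [ln n = ln (m n) - ln m]: the first term is removed by partial summation in [m n] and costs
    [2 L], the second is absorbed in the coefficients and costs [L]. *)
Lemma type_one_log_part A (c : nat -> R) (La : R) : (A <= l + v)%N -> 0 <= La ->
  (forall m, (q ^ A <= m)%N -> c m = 0) ->
  (forall m, (0 < m)%N -> (m < q ^ A)%N -> `|c m| <= La) ->
  cabs (\sum_(m < Y | (0 < m)%N) (c m)%:C * \sum_(n < Y | (0 < n)%N) (ln n%:R)%:C * F (m * n)%N)
  <= A%:R * (3 * L * (cc * (La * S1 * sv))).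
Proof.
move=> Alv La0 cA cL.
pose T m : R[i] := (c m)%:C * \sum_(n < Y | (0 < n)%N) (ln n%:R)%:C * F (m * n)%N.
rewrite (outer_sum (T := T) (A := A)) /T.
- apply: le_trans (cabs_sum _ _ _) _; apply: ler_sum_ord => i.
  have iA : (i.+1 <= l + v)%N by apply: leq_trans Alv.
  have iN : (i.+1 <= N)%N by apply: leq_trans lvN.
  have m_gt0 m : shell q i.+1 m -> (0 < m)%N.
    by move=> /and3P[lo _ _]; apply: leq_trans lo; rewrite expn_gt0 q0.
  have aP m : shell q i.+1 m -> cabs ((c m)%:C) <= La.
    move=> sm; have /and3P[lo hi _] := sm; rewrite cabs_real; apply: cL; first exact: m_gt0 sm.
    by apply: leq_trans hi _; rewrite leq_exp2l.
  have aP2 m : shell q i.+1 m -> cabs ((c m * ln m%:R)%:C) <= La * L.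
    move=> sm; rewrite cabs_real normrM; apply: ler_pM => //.
      by have := aP m sm; rewrite cabs_real.
    have m1 : 0 <= ln m%:R :> R by rewrite ln_ge0 // ler1n m_gt0.
    rewrite ger0_norm // lnL //; have /and3P[_ hi _] := sm.
    by apply: leq_trans (ltnW hi) _; rewrite leq_exp2l.
  have LaL : 0 <= La * L by rewrite mulr_ge0.
  have B2 := type_one_shell q2 fU K1 propK s0 sl l300 lN v2 Cf0 FS FC CwP hh1 hhP theta (ltn0Sn i) iA YN1 LaL aP2.
  have B1 Y' : (Y' <= Y)%N -> cabs (\sum_(m < q ^ i.+1 | shell q i.+1 m) \sum_(n < q ^ (N.+1 - i.+1))
     ((c m)%:C * (unit_ind q n * (f (m * n)%N * e (theta * (m * n)%:R)))) * (m * n < Y')%N%:R)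
     <= cc * (La * S1 * sv).
    move=> Y'Y; have Y'N := leq_trans Y'Y YN1.
    exact: (type_one_shell q2 fU K1 propK s0 sl l300 lN v2 Cf0 FS FC CwP hh1 hhP theta (ltn0Sn i) iA Y'N La0 aP).
  set B := cc * (La * S1 * sv) in B1 *.
  pose z (p : 'I_(q ^ i.+1) * 'I_(q ^ (N.+1 - i.+1))) : R[i] :=
    (c p.1)%:C * (unit_ind q p.2 * (f (p.1 * p.2)%N * e (theta * (p.1 * p.2)%:R))).
  pose X (p : 'I_(q ^ i.+1) * 'I_(q ^ (N.+1 - i.+1))) : nat := (p.1 * p.2)%N.
  have B3 : cabs (\sum_(p : 'I_(q ^ i.+1) * 'I_(q ^ (N.+1 - i.+1)) | shell q i.+1 p.1 && true)
      z p * ((ln (X p)%:R : R)%:C * (X p < Y)%N%:R)) <= 2 * ln Y%:R * B.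
    apply: log_weight_bound => Y' Y'Y; have := B1 Y' Y'Y.
    by rewrite pair_big /=; apply.
  have E : \sum_(m < q ^ i.+1 | shell q i.+1 m)
      (c m)%:C * (\sum_(n < Y | (0 < n)%N) (ln n%:R)%:C * F (m * n)%N) =
    \sum_(p : 'I_(q ^ i.+1) * 'I_(q ^ (N.+1 - i.+1)) | shell q i.+1 p.1 && true)
      z p * ((ln (X p)%:R : R)%:C * (X p < Y)%N%:R) -
    \sum_(m < q ^ i.+1 | shell q i.+1 m) \sum_(n < q ^ (N.+1 - i.+1))
     ((c m * ln m%:R)%:C * (unit_ind q n * (f (m * n)%N * e (theta * (m * n)%:R)))) * (m * n < Y)%N%:R.
    rewrite -(pair_big (fun m : 'I__ => shell q i.+1 m) xpredT (fun (m : 'I_(q ^ i.+1)) (n : 'I_(q ^ (N.+1 - i.+1))) =>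
      (c m)%:C * (unit_ind q n * (f (m * n)%N * e (theta * (m * n)%:R))) *
      ((ln (m * n)%:R : R)%:C * (m * n < Y)%N%:R))) /= -sumrB.
    apply: eq_bigr => m sm; rewrite (inner_sum (fun n => ln n%:R) (ltn0Sn i) iN sm) mulr_sumr -sumrB.
    apply: eq_bigr => n _; case: (posnP n) => [->|n0].
      by rewrite /unit_ind /coprime gcd0n gtn_eqF // !(mul0r, mulr0) subr0.
    have -> : ln (m * n)%:R = ln m%:R + ln n%:R :> R.
      by rewrite natrM lnM // posrE ltr0n // (m_gt0 _ sm).
    by rewrite rmorphD rmorphM /=; ring.
  rewrite E; apply: le_trans (cabsB _ _) _; apply: le_trans (lerD B3 B2) _.
  rewrite -/cc -/sv -/S1.
  have B0 : 0 <= B by rewrite /B !mulr_ge0.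
  have -> : cc * (La * L * S1 * sv) = L * B by rewrite /B; ring.
  rewrite -mulrDl ler_wpM2r //.
  by have := lnL YN; lra.
- by move=> m cm; rewrite big1 ?mulr0 // => b _; rewrite F_ncop // mulr0.
- by move=> m m0 mA; rewrite cA // mul0r.
- by move=> m Ym; rewrite big1 ?mulr0 // => b b0; rewrite Fn // mulr0.
Qed.

Lemma sieved_prime_sum :
  cabs (\sum_(b < Y | (0 < b)%N) (von_mangoldt R b)%:C * F b) <=
  (q ^ v)%:R * L + N%:R * (cc * (hh * S2 * sv)) + 4 * N%:R * L * (cc * (S1 * sv)).
Proof.
rewrite (vaughan U V sieved0 Y1).
apply: le_trans (cabsD _ _) _.
have -> : 4 * N%:R * L * (cc * (S1 * sv)) =
  N%:R * (3 * L * (cc * (1 * S1 * sv))) + N%:R * (cc * (L * S1 * sv)) by ring.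
apply: lerD.
  apply: le_trans (cabsD _ _) _; apply: lerD; first exact: trivial_part.
  exact: type_two_part.
apply: le_trans (cabsB _ _) _; apply: lerD.
  have -> : \sum_(a < Y | (0 < a)%N && (a < U)%N) (moebius a)%:C *
     \sum_(n < Y | (0 < n)%N) (ln n%:R)%:C * F (a * n)%N =
     \sum_(a < Y | (0 < a)%N) (moebius_head U a)%:C *
     \sum_(n < Y | (0 < n)%N) (ln n%:R)%:C * F (a * n)%N.
    rewrite big_mkcondr /=; apply: eq_bigr => a _; rewrite /moebius_head; case: ifP => // _.
    by rewrite mul0r.
  have lv : (l <= l + v)%N by rewrite leq_addr.
  apply: le_trans (type_one_log_part (c := moebius_head U) lv ler01 _ _) _.
  - by move=> m mU; rewrite /moebius_head ltnNge mU.
  - by move=> m _ _; exact: moebius_head_le1.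
  - by rewrite ler_wpM2r ?mulr_ge0 // ler_nat (leq_trans lv).
apply: le_trans (type_one_part (c := vaughan_coef Y U V) (leqnn _) L0 _ _) _.
- by move=> m mU; apply: vaughan_coef0; rewrite -expnD.
- move=> m m0 mA; apply: le_trans (vaughan_coef_le _ _ _ m0) _; apply: lnL.
  by apply: leq_trans (ltnW mA) _; rewrite leq_exp2l.
- by rewrite ler_wpM2r ?mulr_ge0 // ler_nat.
Qed.

End PrimeSum.

(** * Choice of the parameters *)

Lemma cut_cost_arith (R : realType) (h n k : R) :
  1 <= n -> 1 <= k -> h <= k * (n + 1) -> 1 + 4 * h <= 9 * k * n.
Proof. by move=> *; nra. Qed.

(** [n], [h], [sw], [X] stand for [N], [hh], the root of the weight and [q ^ N / q ^ s]; each of the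
    four contributions is at most a constant times [n ^+ 3 * h * sw * X]. *)
Lemma vaughan_terms_le (R : realType) (n h sw X lq Q a1 a2 cc t1 s1 s2 sv t4 : R) :
  1 <= n -> 1 <= h -> 1 <= sw -> 1 <= X -> 0 <= lq -> 1 <= Q -> 0 <= a1 -> 0 <= a2 ->
  0 <= cc -> cc <= 9 * Q * n -> t1 <= X -> 0 <= s1 -> s1 <= a1 * sw * h ->
  0 <= s2 -> s2 <= a2 * sw * (n * lq) -> sv = Q * X -> t4 <= (Q + 1) * (2 * Q * n) * lq ->
  t1 * (n * lq) + n * (cc * (h * s2 * sv)) + 4 * n * (n * lq) * (cc * (s1 * sv)) + t4 <=
  (lq + 9 * Q ^+ 2 * lq * a2 + 36 * Q ^+ 2 * lq * a1 + 2 * Q * (Q + 1) * lq) *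
  (n ^+ 3 * h * sw * X).
Proof.
move=> n1 h1 sw1 X1 lq0 Q1 a10 a20 cc0 ccP t1P s10 s1P s20 s2P -> t4P.
have one x : 1 <= x -> 0 <= x := le_trans ler01.
have [n0 h0 sw0 X0 Q0] : [/\ 0 <= n, 0 <= h, 0 <= sw, 0 <= X & 0 <= Q].
  by split; apply: one.
have mul1 x y : 1 <= x -> 1 <= y -> 1 <= x * y.
  by move=> x1 y1; rewrite -[leLHS]mulr1; apply: ler_pM.
set E := n ^+ 3 * h * sw * X.
have nX : n * X <= E.
  have -> : E = n * X * (n * n * h * sw) by rewrite /E; ring.
  by apply: ler_peMr; [nneg|rewrite !mul1].
have nE : n <= E by apply: le_trans nX; apply: ler_peMr.
have -> : (lq + 9 * Q ^+ 2 * lq * a2 + 36 * Q ^+ 2 * lq * a1 + 2 * Q * (Q + 1) * lq) * E =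
    lq * E + 9 * Q ^+ 2 * lq * a2 * E + 36 * Q ^+ 2 * lq * a1 * E + 2 * Q * (Q + 1) * lq * E.
  by ring.
apply: lerD; last first.
  apply: le_trans t4P _.
  have -> : (Q + 1) * (2 * Q * n) * lq = 2 * Q * (Q + 1) * lq * n by ring.
  by apply: ler_wpM2l => //; nneg.
apply: lerD; last first.
  apply: (@le_trans _ _ (4 * n * (n * lq) * ((9 * Q * n) * ((a1 * sw * h) * (Q * X))))).
    apply: ler_wpM2l; first by nneg.
    by apply: ler_pM => //; [nneg|apply: ler_wpM2r => //; nneg].
  by apply: eq_le; rewrite /E; ring.
apply: lerD.
  apply: (@le_trans _ _ (lq * (n * X))); last exact: ler_wpM2l.
  have -> : lq * (n * X) = X * (n * lq) by ring.
  by apply: ler_wpM2r => //; nneg.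
apply: (@le_trans _ _ (n * ((9 * Q * n) * (h * (a2 * sw * (n * lq)) * (Q * X))))).
  apply: ler_wpM2l => //; apply: ler_pM => //; first by nneg.
  by apply: ler_wpM2r; [nneg|apply: ler_wpM2l].
by apply: eq_le; rewrite /E; ring.
Qed.

Section ParameterChoice.
Context {R : realType}.
Variables (q : nat) (f : nat -> R[i]) (K : R).
Hypothesis q2 : (2 <= q)%N.
Hypothesis fU : forall n, cabs (f n) = 1.
Hypothesis K1 : 1 <= K.
Hypothesis propK : forall lam kap rho, (rho < lam)%N ->
  #|propagation_exceptions q f lam kap rho|%:R
  <= K * weight q rho * (q ^ lam)%:R / (q ^ rho)%:R.

Let q0 : (0 < q)%N. Proof. exact: q_gt0. Qed.
Let Q : R := q%:R.
Let Q1 : 1 <= Q. Proof. by rewrite /Q ler1n. Qed.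
Let Q0 : 0 <= Q. Proof. by []. Qed.
Let Qp : 0 < Q. Proof. by rewrite ltr0n. Qed.
Let QN : Q != 0. Proof. by rewrite gt_eqF. Qed.
Let lq0 : 0 < ln Q. Proof. by rewrite ln_gt0 // ltr1n. Qed.
Let qXE n : (q ^ n)%:R = Q `^ n%:R. Proof. by rewrite natrX powR_mulrn. Qed.
Let powD x y : Q `^ (x + y) = Q `^ x * Q `^ y.
Proof. by rewrite powRD // QN implybT. Qed.
Let pow_ge0 x : 0 <= Q `^ x. Proof. exact: powR_ge0. Qed.
Let pow_le x y : x <= y -> Q `^ x <= Q `^ y. Proof. exact: ler_powR. Qed.

(** From [ln j <= j]; the case [j = 0] rests on [ln 0 = 0]. *)
Lemma weight_linear j : weight q (4 * j) <= Q `^ ln 4 * (q ^ j)%:R.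
Proof.
have l4 : 0 <= ln 4 :> R by rewrite ln_ge0 // ler1n.
rewrite /weight qXE -powD; apply: pow_le; case: j => [|j].
  by rewrite muln0 ln0 // addr0.
by rewrite natrM lnM ?posrE ?ltr0n // lerD2l ltW // ln_sublinear // ltr0n.
Qed.

(** The property is used with [kappa = 1] and [lambda = t.-1 >= l]: [1 <= c * l%:R] gives
    [kappa <= c * lambda], and monotony of [gamma] replaces [t.-1] by [l]. *)
Lemma fourier_property_sup gamma c l : fourier_property q f gamma c ->
  {homo gamma : m n / (m <= n)%N >-> m <= n} -> (0 < l)%N -> 0 <= c -> 1 <= c * l%:R ->
  forall t, (l < t)%N -> fourier_sup q f t (Q `^ (- gamma l)).
Proof.
move=> fp gm l0 c0 cl t lt x.
have lt1 : (l <= t.-1)%N by rewrite -ltnS prednK // (leq_trans _ lt).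
have t0 : (0 < t.-1)%N by exact: leq_trans lt1.
have ct : 1%:R <= c * t.-1%:R by apply: le_trans cl _; rewrite ler_wpM2l // ler_nat.
have := fp t.-1 1%N t0 (ltn0Sn 0) ct x.
rewrite cabs_le_normC cabsM cabsV cabs_nat mulrC ler_pdivrMr ?ltr0n ?expn_gt0 ?q0 // big_mkord.
under eq_bigr => n _ do rewrite expn1.
move=> /le_trans; apply; rewrite ler_wpM2r //; apply: pow_le.
by rewrite lerN2; exact: gm.
Qed.

(** By Parseval the mean square of the [D] Fourier sums of a unimodular sequence of length [D] is
    [D], so the largest of them is at least [sqrt D]. *)
Lemma fourier_sup_lower l M : fourier_sup q f l.+1 M -> 1 <= M ^+ 2 * (q ^ l)%:R.
Proof.
move=> fs; set D := (q ^ l)%N; have D0 : (0 < D)%N by rewrite expn_gt0 q0.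
have DR : 0 < D%:R :> R by rewrite ltr0n.
have := parsevalN (R := R) D0 (fun h => f (q * h)%N).
under [X in _ = _ * X]eq_bigr => h _ do rewrite fU expr1n.
rewrite sumr_const card_ord => E.
have : D%:R * D%:R <= D%:R * (M * D%:R) ^+ 2.
  rewrite -{}E; apply: ler_sum_ord => a.
  have -> : \sum_(h < D) f (q * h)%N * cj (e ((h * a)%:R / D%:R : R)) =
      \sum_(h < D) f (q * h)%N * e (- (h%:R * (a%:R / D%:R))).
    by apply: eq_bigr => h _; rewrite conj_e natrM mulrA.
  have MD : 0 <= M * D%:R := le_trans (cabs_ge0 _) (fs 0).
  by rewrite ler_sqr ?nnegrE ?cabs_ge0 //; have := fs (a%:R / D%:R).
rewrite ler_pM2l // exprMn expr2 mulrA => h; rewrite -(ler_pM2r DR) mul1r.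
exact: h.
Qed.

Lemma decay_le_half gam l : fourier_sup q f l.+1 (Q `^ (- gam)) -> 2 * gam <= l%:R.
Proof.
move=> /fourier_sup_lower; rewrite qXE -powR_mulrn // -powRrM -powD => h.
have : 0 <= ln (Q `^ (- gam * 2 + l%:R)) by rewrite ln_ge0.
by rewrite ln_powR pmulr_lge0 // => h2; lra.
Qed.

Definition mangoldt_const (Cf Cw : R) : R :=
  ln Q + 9 * Q ^+ 2 * ln Q * Num.sqrt (8 * (2 * Cf + (36 * Q + 16) * K + 1))
  + 36 * Q ^+ 2 * ln Q * Num.sqrt (type_one_const q K Cf (8 * K * Cw + 2))
  + 2 * Q * (Q + 1) * ln Q.

Lemma mangoldt_sum_le (N l s : nat) (Mf Cf Cw hh theta : R) (Y : nat) :
  (0 < s)%N -> (40 * s <= l + 40)%N -> (300 <= l)%N -> (40 * l <= N)%N ->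
  0 <= Cf -> 0 <= Cw ->
  (forall t, (l < t)%N -> fourier_sup q f t Mf) ->
  Mf ^+ 2 * (q ^ (36 * s))%:R <= Cf ->
  (forall j, weight q (4 * j) <= Cw * (q ^ j)%:R) ->
  1 <= hh -> (q%:R * (2 * N)%:R) ^+ 3 <= hh ^+ 2 ->
  (1 < Y)%N -> (Y <= q ^ N)%N ->
  cabs (\sum_(n < Y) (von_mangoldt R n)%:C * f n * e (theta * n%:R)) <=
  mangoldt_const Cf Cw *
  (N%:R ^+ 3 * hh * Num.sqrt (weight q (12 * s)) * ((q ^ N)%:R / (q ^ s)%:R)).
Proof.
move=> s0 sl l300 lN Cf0 Cw0 FS FC CwP hh1 hhP Y1 YN.
pose v := (N.+1 %/ 2 + 2 * s)%N.
have v1 : (N + 4 * s <= 2 * v)%N by rewrite /v; clear; lia.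
have v2 : (2 * v <= N + 1 + 4 * s)%N by rewrite /v; clear; lia.
have vs : (v + s <= N)%N by clear -v2 sl l300 lN; lia.
have sN : (s <= N)%N by clear -vs; lia.
have N0 : (0 < N)%N by clear -lN l300; lia.
have main := sieved_prime_sum q2 fU K1 propK s0 sl l300 lN v1 v2 Cf0 FS FC CwP hh1 hhP theta Y1 YN.
have ram := von_mangoldt_ramified (R := R) q2 YN.
have K0 : 0 <= K := le_trans ler01 K1.
have -> : \sum_(n < Y) (von_mangoldt R n)%:C * f n * e (theta * n%:R) =
    \sum_(b < Y | (0 < b)%N) (von_mangoldt R b)%:C * sieved q f theta Y b +
    \sum_(n < Y | ~~ coprime n q) (von_mangoldt R n)%:C * (f n * e (theta * n%:R)).
  rewrite [X in X + _]big_mkcond [X in _ + X]big_mkcond -big_split /=; apply: eq_bigr => n _.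
  rewrite /sieved ltn_ord /unit_ind -mulrA; case: (posnP n) => [->|n0].
    by rewrite /coprime gcd0n gtn_eqF //= add0r.
  by case: coprime; rewrite /= ?mul1r ?mul0r ?mulr0 ?addr0 ?add0r.
apply: le_trans (cabsD _ _) _.
have ram' : cabs (\sum_(n < Y | ~~ coprime n q) (von_mangoldt R n)%:C * (f n * e (theta * n%:R))) <=
    (Q + 1) * (2 * Q * N%:R) * ln Q.
  apply: le_trans (cabs_sum _ _ _) _.
  apply: (@le_trans _ _ (\sum_(n < Y | ~~ coprime n q) von_mangoldt R n)).
    by apply: ler_sum => n _; rewrite !cabsM fU cabs_e !mulr1 cabs_real_ge0 ?von_mangoldt_ge0.
  apply: le_trans ram _; rewrite natr1 ler_wpM2r ?(ltW lq0) // ler_wpM2l //.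
  by rewrite -!natrM ler_nat; have := leq_mul q0 N0; clear; lia.
apply: le_trans (lerD main ram') _.
have w1 : 1 <= weight q (12 * s) :> R by exact: weight_ge1.
have w0 : 0 <= weight q (12 * s) :> R := le_trans ler01 w1.
have hh0 : 0 <= hh := le_trans ler01 hh1.
have sw1 : 1 <= Num.sqrt (weight q (12 * s)) :> R by rewrite -sqrtr1 ler_sqrt.
have C2 : 0 <= 8 * (2 * Cf + (36 * Q + 16) * K + 1) by nneg.
have C1 : 0 <= type_one_const q K Cf (8 * K * Cw + 2) by rewrite /type_one_const; nneg.
have qs0 : 0 < (q ^ s)%:R :> R by rewrite ltr0n expn_gt0 q0.
apply: vaughan_terms_le => //.
- by rewrite ler1n.
- by rewrite ler_pdivlMr // mul1r ler_nat leq_exp2l.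
- exact: ltW.
- exact: cut_cost_ge0.
- rewrite /cut_cost; have := harmonic_expn (R := R) N.+1 q2; rewrite -/Q => H.
  have N1 : 1 <= N%:R :> R by rewrite ler1n.
  move: H; rewrite -natr1; move: (harmonic _) (N%:R : R) N1 Q1 => h n n1 k1 H.
  exact: cut_cost_arith.
- by rewrite ler_pdivlMr // -natrM -expnD ler_nat leq_exp2l.
- rewrite /type_one_factor (sqrtrM _ (mulr_ge0 C1 w0)) (sqrtrM _ C1).
  rewrite ler_wpM2l ?mulr_ge0 ?sqrtr_ge0 // -[leRHS]ger0_norm // -sqrtr_sqr ler_sqrt ?sqr_ge0 //.
  by rewrite expr2 ler_peMr.
- rewrite /type_two_factor (sqrtrM _ (mulr_ge0 C2 w0)) (sqrtrM _ C2) sqrtr_sqr ger0_norm //.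
  by rewrite mulr_ge0 // ltW.
- by rewrite /saving expnS natrM mulrA.
Qed.

Lemma c2_ge : 9 / 2 <= c2 R q.
Proof.
rewrite /c2; have h : 2 <= (maxn (omega q) 2)%:R :> R by rewrite ler_nat leq_maxr.
by have := lq0; rewrite /Q; lra.
Qed.

Definition gain_const : R :=
  (2 * Q) `^ (3 / 2) * (2 / ln Q) `^ c2 R q * Q `^ (ln 24 / 2) * Q.

Lemma gain_bound (N s : nat) (x g : R) :
  1 <= g -> g <= s%:R -> s%:R <= g + 1 -> (0 < N)%N -> 1 <= x ->
  (q ^ N)%:R <= Q * x -> N%:R <= 2 * ln x / ln Q ->
  N%:R ^+ 3 * (Q * (2 * N)%:R) `^ (3 / 2) * Num.sqrt (weight q (12 * s)) *
    ((q ^ N)%:R / (q ^ s)%:R) <=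
  gain_const * (ln x `^ c2 R q * x * Q `^ (- g + ln g)).
Proof.
move=> g1 gs sg N0 x1 qx Nx.
have N1 : 1 <= N%:R :> R by rewrite ler1n.
have lx0 : 0 <= ln x by rewrite ln_ge0.
have c2' := c2_ge; have c20 : 0 <= c2 R q by apply: le_trans c2'; rewrite divr_ge0.
have A1 : N%:R ^+ 3 * (Q * (2 * N)%:R) `^ (3 / 2) <=
    (2 * Q) `^ (3 / 2) * ((2 / ln Q) `^ c2 R q * ln x `^ c2 R q).
  have -> : Q * (2 * N)%:R = (2 * Q) * N%:R by rewrite natrM; ring.
  rewrite powRM ?mulr_ge0 // mulrCA ler_wpM2l ?powR_ge0 //.
  rewrite -powR_mulrn // -powRD; last by rewrite pnatr_eq0 -lt0n N0 implybT.
  apply: (@le_trans _ _ (N%:R `^ c2 R q)).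
    by apply: ler_powR => //; move: c2'; lra.
  have lq' : 0 <= 2 / ln Q by rewrite divr_ge0 // ltW.
  rewrite -powRM //; apply: ge0_ler_powR; rewrite ?nnegrE //.
    by rewrite mulr_ge0.
  by apply: le_trans Nx _; apply: eq_le; rewrite mulrAC.
have s0 : (0 < s)%N by rewrite -(ltr0n R); apply: lt_le_trans gs; exact: lt_le_trans g1.
have lg0 : 0 <= ln g by rewrite ln_ge0.
(* [s <= g + 1 <= 2 g] gives [12 s <= 24 g]; the root halves the logarithm, and [ln g >= 0] allows
   the half to be replaced by [ln g]. *)
have A2 : Num.sqrt (weight q (12 * s)) <= Q `^ (ln 24 / 2) * Q `^ ln g.
  rewrite -powR12_sqrt; last exact: powR_ge0.
  rewrite /weight -powRrM -powD; apply: pow_le.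
  have : ln (12 * s)%:R <= ln (24 * g).
    rewrite ler_ln ?posrE ?ltr0n ?muln_gt0 //; last by rewrite mulr_gt0 // (lt_le_trans _ g1).
    by rewrite natrM; lra.
  rewrite lnM ?posrE //; last exact: lt_le_trans g1.
  by lra.
have A3 : (q ^ N)%:R / (q ^ s)%:R <= Q * x * Q `^ (- g).
  apply: ler_pM => //.
  by rewrite qXE -powRN; apply: pow_le; rewrite lerN2.
rewrite powD.
apply: (@le_trans _ _ ((2 * Q) `^ (3 / 2) * ((2 / ln Q) `^ c2 R q * ln x `^ c2 R q) *
   (Q `^ (ln 24 / 2) * Q `^ ln g) * (Q * x * Q `^ (- g)))); last first.
  by apply: eq_le; rewrite /gain_const; ring.
apply: ler_pM => //.
  by rewrite !mulr_ge0 ?powR_ge0 ?sqrtr_ge0 ?exprn_ge0.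
apply: ler_pM => //.
by rewrite mulr_ge0 ?powR_ge0 ?exprn_ge0.
Qed.

Lemma mangoldt_sum_large gamma c : fourier_property q f gamma c ->
  {homo gamma : m n / (m <= n)%N >-> m <= n} -> 0 <= c ->
  exists C, forall theta x : R, 2 <= x -> let l := gamma_index q x in
    (300 <= l)%N -> 1 <= c * l%:R -> 20 <= gamma l ->
    cabs (mangoldt_sum f theta x) <=
    C * (ln x `^ c2 R q * x * Q `^ (- (gamma l / 20) + ln (gamma l / 20))).
Proof.
move=> fp gm c0; pose Cf : R := Q `^ 36; pose Cw := Q `^ ln 4.
exists (mangoldt_const Cf Cw * gain_const) => theta x x2 l l300 cl g20.
have Cf0 : 0 <= Cf by exact: powR_ge0.
have Cw0 : 0 <= Cw by exact: powR_ge0.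
have l0 : (0 < l)%N by exact: leq_trans l300.
have FS := fourier_property_sup fp gm l0 c0 cl.
set g := gamma l / 20; have g1 : 1 <= g by rewrite /g; lra.
have g0 : 0 <= g := le_trans ler01 g1.
pose s := (Num.truncn g).+1.
have gs : g <= s%:R by apply: ltW; exact: truncnS_gt.
have sg : s%:R <= g + 1 by rewrite /s -natr1 lerD2r truncn_le.
have half := decay_le_half (FS l.+1 (ltnSn l)).
(* From [s <= gamma l / 20 + 1] and [gamma l <= l / 2]. *)
have sl : (40 * s <= l + 40)%N.
  by rewrite -(ler_nat R) natrM natrD; move: sg half; rewrite /g; lra.
(* [36 s <= (36 / 20) gamma l + 36]: the squared decay absorbs the first term, and [Cf], which is
   [q] to the power 36, the second. *)
have FCe : - gamma l * 2%:R + 36%:R * s%:R <= 36 by move: sg g20; rewrite /g; lra.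
have e32 : 3 / 2 * 2%:R = 3%:R :> R by lra.
have x0 : 0 < x by exact: lt_le_trans x2.
have x1 : 1 <= x by apply: le_trans x2; rewrite ler1n.
set y := ln x / ln Q.
have y0 : 0 <= y by rewrite divr_ge0 ?ln_ge0 // ltW.
pose N := (Num.truncn y).+1.
have yN : y < N%:R := truncnS_gt y.
have Ny : N%:R <= y + 1 by rewrite /N -natr1 lerD2r truncn_le.
(* [l] is twice the integer part of [y / 80], so the 80 in [gamma_index] is the 40 in [lN]. *)
have l40 : (40 * l)%:R <= y.
  rewrite /l /gamma_index mulnA natrM.
  have : (Num.truncn (ln x / (80 * ln Q)))%:R <= ln x / (80 * ln Q).
    by rewrite truncn_le divr_ge0 ?ln_ge0 ?mulr_ge0 // ltW.
  have -> : ln x / (80 * ln Q) = y / 80 by rewrite /y; field; rewrite gt_eqF.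
  by rewrite -/Q; lra.
have lN : (40 * l <= N)%N by rewrite ltnW // -(ltr_nat R) (le_lt_trans l40).
have N0 : (0 < N)%N by [].
have lnqN n : ln (q ^ n)%:R = n%:R * ln Q by rewrite natrX lnXn // mulr_natl.
have qp n : 0 < (q ^ n)%:R :> R by rewrite ltr0n expn_gt0 q0.
have xN : x < (q ^ N)%:R.
  by rewrite -ltr_ln ?posrE // lnqN -ltr_pdivrMr.
have qx : (q ^ N)%:R <= Q * x.
  rewrite expnS natrM ler_pM2l // -ler_ln ?posrE // lnqN -ler_pdivlMr // -/y.
  by rewrite truncn_le.
have Nx : N%:R <= 2 * ln x / ln Q.
  rewrite -mulrA -/y mulr_natl mulr2n; apply: le_trans Ny _; rewrite lerD2l.
  by apply: le_trans l40; rewrite ler1n muln_gt0.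
have YN : ((Num.truncn x).+1 <= q ^ N)%N by rewrite truncn_lt_nat // ltW.
have Y1 : (1 < (Num.truncn x).+1)%N by rewrite ltnS truncn_gt0.
(* [hh ^+ 2] bounds the mean square of the divisor function, a cube of the harmonic sum; hence the
   exponent [3 / 2]. *)
pose hh := (Q * (2 * N)%:R) `^ (3 / 2).
have b1 : 1 <= Q * (2 * N)%:R by rewrite -natrM ler1n !muln_gt0 q0.
have hh1 : 1 <= hh.
  by rewrite -[leLHS](powRr0 (Q * (2 * N)%:R)) ler_powR // divr_ge0.
have hhP : (Q * (2 * N)%:R) ^+ 3 <= hh ^+ 2.
  rewrite /hh -[_ `^ _ ^+ 2]powR_mulrn ?powR_ge0 // -powRrM -powR_mulrn ?(le_trans ler01 b1) //.
  by rewrite e32.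
have FC : (Q `^ (- gamma l)) ^+ 2 * (q ^ (36 * s))%:R <= Cf.
  rewrite /Cf -powR_mulrn ?powR_ge0 // -powRrM qXE -powD; apply: pow_le.
  by rewrite natrM.
rewrite /mangoldt_sum big_mkord.
apply: le_trans (mangoldt_sum_le theta (ltn0Sn _) sl l300 lN Cf0 Cw0 FS FC weight_linear hh1 hhP Y1 YN) _.
have K0 : 0 <= K := le_trans ler01 K1.
have lq := ltW lq0; have Q0' := Q0.
have C0 : 0 <= mangoldt_const Cf Cw.
  by rewrite /mangoldt_const; nneg; exact: sqrtr_ge0.
by rewrite -[leRHS]mulrA ler_wpM2l //; exact: gain_bound.
Qed.

End ParameterChoice.

(** * Bounded [x], and the conclusion *)

Lemma prime_sum_bound_gt0 (R : realType) q (gamma : nat -> R) (x : R) :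
  (2 <= q)%N -> 2 <= x -> 0 < prime_sum_bound q gamma x.
Proof.
move=> q2 x2; have q0 : (0 < q)%N by exact: leq_trans q2.
have lq : 0 < ln q%:R :> R by rewrite ln_gt0 // ltr1n.
have x1 : 1 < x by apply: lt_le_trans x2; rewrite ltr1n.
rewrite /prime_sum_bound /c1; repeat apply: mulr_gt0.
- by apply: powR_gt0; rewrite lt_max exprn_gt0 // orbT.
- exact: powR_gt0.
- by apply: powR_gt0; exact: ln_gt0.
- exact: lt_trans x1.
- by apply: powR_gt0; rewrite ltr0n.
Qed.

(** Serves where [x] stays bounded, so that any bound independent of [theta] will do. *)
Lemma mangoldt_sum_trivial (R : realType) (f : nat -> R[i]) (theta x X : R) :
  (forall n, cabs (f n) = 1) -> 0 <= x -> x <= X ->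
  cabs (mangoldt_sum f theta x) <= (X + 1) ^+ 2.
Proof.
move=> fU x0 xX; rewrite /mangoldt_sum big_mkord; apply: le_trans (cabs_sum _ _ _) _.
have tx : (Num.truncn x).+1%:R <= X + 1 by rewrite -natr1 lerD2r (le_trans _ xX) // truncn_le.
have X0 : 0 <= X + 1 by exact: le_trans tx.
apply: (@le_trans _ _ ((Num.truncn x).+1%:R * (X + 1))); last by rewrite expr2 ler_wpM2r.
apply: ler_sum_ord => n; rewrite !cabsM fU cabs_e !mulr1 cabs_real_ge0 ?von_mangoldt_ge0 //.
apply: le_trans (von_mangoldt_le_ln _) _; case: (posnP n) => [->|n0]; first by rewrite ln0.
apply: le_trans (ltW (ln_sublinear _)) _; first by rewrite ltr0n.
by apply: le_trans tx; rewrite ler_nat ltnW.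
Qed.

Lemma gamma_index_bounded (R : realType) q l (x : R) : (2 <= q)%N -> 2 <= x ->
  (gamma_index q x < l)%N -> x <= (q ^ (80 * l))%:R.
Proof.
move=> q2 x2 il; have q0 : (0 < q)%N by exact: leq_trans q2.
have lq : 0 < ln q%:R :> R by rewrite ln_gt0 // ltr1n.
have x0 : 0 < x by exact: lt_le_trans x2.
rewrite -ler_ln ?posrE ?ltr0n ?expn_gt0 ?q0 // natrX lnXn ?ltr0n // -[_ *+ _]mulr_natl.
rewrite -ler_pdivrMr //; have := truncnS_gt (ln x / (80 * ln q%:R)).
have -> : ln x / (80 * ln q%:R) = ln x / ln q%:R / 80 by field; rewrite gt_eqF.
rewrite ltr_pdivrMr // => /ltW /le_trans; apply; rewrite -natrM ler_nat mulnC leq_mul2l /=.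
apply: leq_ltn_trans il; rewrite /gamma_index.
have -> : ln x / ln q%:R / 80 = ln x / (80 * ln q%:R) by field; rewrite gt_eqF.
by rewrite mul2n -addnn leq_addr.
Qed.

Theorem theorem1 (R : realType) (q : nat) (f : nat -> R[i])
    (gamma : nat -> R) (c : R) :
  (2 <= q)%N ->
  unit_circle_valued f ->
  weak_small_propagation q f ->
  {homo gamma : m n / (m <= n)%N >-> m <= n} ->
  gamma n @[n --> \oo] --> +oo ->
  0 < c ->
  fourier_property q f gamma c ->
  exists C : R, forall theta x : R, 2 <= x ->
    `|mangoldt_sum f theta x| <= (C * prime_sum_bound q gamma x)%:C.
Proof.
move=> q2 fU' [K' prop'] gm glim c0 fp.
have q0 : (0 < q)%N by exact: leq_trans q2.
have qR : 0 < q%:R :> R by rewrite ltr0n.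
have qN : q%:R != 0 :> R by rewrite gt_eqF.
have fU n : cabs (f n) = 1 by apply: complexI; rewrite -cabsE fU'.
(* At least 1, so that the last block in [bad_sum] is covered by the same constant. *)
pose K := Num.max K' 1.
have K1 : 1 <= K by rewrite le_max lexx orbT.
have propK lam kap rho : (rho < lam)%N ->
    #|propagation_exceptions q f lam kap rho|%:R
    <= K * weight q rho * (q ^ lam)%:R / (q ^ rho)%:R.
  move=> rl; apply: le_trans (prop' lam kap rho rl) _.
  have -> : K * weight q rho * (q ^ lam)%:R / (q ^ rho)%:R =
      K * q%:R `^ (lam%:R - rho%:R + ln rho%:R).
    have pD x y : q%:R `^ (x + y) = q%:R `^ x * q%:R `^ y :> R.
      by rewrite powRD // qN implybT.
    by rewrite !pD powRN !powR_mulrn // -!natrX /weight; ring.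
  by rewrite ler_wpM2r ?powR_ge0 // le_max lexx.
have [C CP] := mangoldt_sum_large q2 fU K1 propK fp gm (ltW c0).
have [l0 l0P] : exists l0, forall l, (l0 <= l)%N ->
    [/\ (300 <= l)%N, 1 <= c * l%:R & 20 <= gamma l].
  have [n1 _ n1P] := (cvgryPge _).1 glim 20.
  exists (300 + n1 + (Num.truncn c^-1).+1)%N => l ll; split.
  - by apply: leq_trans ll; rewrite -addnA leq_addr.
  - rewrite mulrC -ler_pdivrMr // mul1r; apply: le_trans (ltW (truncnS_gt _)) _.
    by rewrite ler_nat; apply: leq_trans ll; rewrite leq_addl.
  - apply: n1P; apply: leq_trans ll; rewrite -addnA addnCA leq_addr //.
(* Below [l0] the last factor of the bound takes finitely many positive values; the sum of their
   inverses gives [1 <= small * G] for whichever occurs. *)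
pose small : R := \sum_(i < l0) (q%:R `^ (- (gamma i / 20) + ln (gamma i / 20)))^-1.
have powp x : 0 < q%:R `^ x :> R by exact: powR_gt0.
have c1p : 0 < c1 R q.
  have lq : 0 < ln q%:R :> R by rewrite ln_gt0 // ltr1n.
  by rewrite /c1 mulr_gt0 // powR_gt0 // lt_max exprn_gt0 // orbT.
have c2p : 0 <= c2 R q by apply: le_trans (c2_ge q2); rewrite divr_ge0.
have ln2 : 0 < ln 2 :> R by rewrite ln_gt0 // ltr1n.
pose B0 : R := ((q ^ (80 * l0))%:R + 1) ^+ 2.
have B00 : 0 <= B0 by exact: sqr_ge0.
(* The other factors are bounded below over [x >= 2]: [ln x] by [ln 2], and [x] by 1. *)
pose C' := B0 * small / (c1 R q * ln 2 `^ c2 R q).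
have small0 : 0 <= small by apply: sumr_ge0 => i _; rewrite invr_ge0 ltW.
exists (`|C| / c1 R q + C') => theta x x2; rewrite cabs_le_normC mulrDl.
have x0 : 0 < x by exact: lt_le_trans x2.
have x1 : 1 <= x by apply: le_trans x2; rewrite ler1n.
have p0 := ltW (prime_sum_bound_gt0 gamma q2 x2).
have cc0 : 0 < c1 R q * ln 2 `^ c2 R q by rewrite mulr_gt0 // powR_gt0.
have C'0 : 0 <= C' by apply: divr_ge0; [exact: mulr_ge0|exact: ltW].
have C0 : 0 <= `|C| / c1 R q by rewrite divr_ge0 // ltW.
case: (leqP l0 (gamma_index q x)) => il.
  have [a1 a2 a3] := l0P _ il.
  apply: ler_wpDr; first exact: mulr_ge0.
  apply: le_trans (CP theta x x2 a1 a2 a3) _; rewrite /prime_sum_bound /=.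
  set P := ln x `^ _ * x * _.
  have P0 : 0 <= P by rewrite /P !mulr_ge0 ?powR_ge0 // ltW.
  have -> : `|C| / c1 R q * (c1 R q * ln x `^ c2 R q * x *
      q%:R `^ (- (gamma (gamma_index q x) / 20) + ln (gamma (gamma_index q x) / 20))) = `|C| * P.
    by rewrite /P; field; rewrite gt_eqF.
  by rewrite ler_wpM2r // ler_norm.
apply: ler_wpDl; first exact: mulr_ge0.
apply: le_trans (mangoldt_sum_trivial theta fU (ltW x0) (gamma_index_bounded q2 x2 il)) _.
rewrite -/B0 /prime_sum_bound /=; set G := q%:R `^ _.
have Gp : 0 < G := powp _.
have sG : 1 <= small * G.
  rewrite -ler_pdivrMr // mul1r /small (bigD1 (Ordinal il)) //= -/G lerDl.
  by apply: sumr_ge0 => i _; rewrite invr_ge0 ltW.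
have lx : ln 2 `^ c2 R q <= ln x `^ c2 R q.
  by apply: ge0_ler_powR; rewrite ?nnegrE ?ln_ge0 ?ler_ln ?posrE ?ler1n // ltW.
have xl : ln 2 `^ c2 R q <= ln x `^ c2 R q * x.
  by apply: le_trans lx _; rewrite ler_peMr // powR_ge0.
have -> : C' * (c1 R q * ln x `^ c2 R q * x * G) =
    B0 * ((small * G) * (ln x `^ c2 R q * x / ln 2 `^ c2 R q)).
  rewrite /C'; field; rewrite !gt_eqF //; exact: powR_gt0.
apply: ler_peMr => //; rewrite -[leLHS]mulr1; apply: ler_pM => //.
by rewrite ler_pdivlMr ?powR_gt0 // mul1r.
Qed.
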